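(* Let $X$ be a complex Banach space and let $f:\mathbb{R}_+\to X$ be bounded, continuous and Lipschitz continuous. Suppose that the Laplace transform $\widehat{f}$ admits a boundary function $F\in L^1_{\mathrm{loc}}(\mathbb{R};X)$, i.e. $$\lim_{\alpha\to0+}\int_\mathbb{R}\widehat{f}(\alpha+\mathrm{i}s)\psi(s)\,\mathrm{d}s=\int_\mathbb{R}F(s)\psi(s)\,\mathrm{d}s\quad\text{for all }\psi\in C_\mathrm{c}(\mathbb{R}).$$ Then $f\in C_0(\mathbb{R}_+;X)$, i.e. $\|f(t)\|\to0$ as $t\to\infty$. Moreover, let $M:\mathbb{R}_+\to[1,\infty)$ be a continuous non-decreasing function. Then: (a) If $k\ge1$ is an integer, $F\in C^k(\mathbb{R};X)$ and there is a constant $C>0$ such that $\|F^{(j)}(s)\|\le C M(|s|)^{j+1}$ for all $s\in\mathbb{R}$ and $0\le j\le k$, then for every $c>0$, $$\|f(t)\|=O\left(\frac{1}{M_k^{-1}(ct)}\right),\quad t\to\infty,$$ where $M_k^{-1}$ is the inverse of the strictly increasing function $M_k:\mathbb{R}_+\to(0,\infty)$, $M_k(R)=M(R)\big((1+R)^2M(R)\big)^{1/k}$. (b) If $F\in C^\infty(\mathbb{R};X)$ and there is a constant $C>0$ such that $\|F^{(j)}(s)\|\le C\, j!\, M(|s|)^{j+1}$ for all $s\in\mathbb{R}$ and all integers $j\ge0$, then for every $c\in(0,1/2)$, $$\|f(t)\|=O\left(\frac{1}{M_{\log}^{-1}(ct)}\right),\quad t\to\infty,$$ where $M_{\log}^{-1}$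 is the inverse of the strictly increasing function $M_{\log}:\mathbb{R}_+\to(0,\infty)$, $M_{\log}(R)=M(R)\big(\log(1+R)+\log M(R)\big)$.
   Context: For a bounded measurable $f:\mathbb{R}_+\to X$ the Laplace transform is $\widehat{f}(\lambda)=\int_0^\infty \mathrm{e}^{-\lambda t}f(t)\,\mathrm{d}t$ for $\operatorname{Re}\lambda>0$. $C_0(\mathbb{R}_+;X)$ denotes continuous functions vanishing at infinity. The inverses $M_k^{-1}$, $M_{\log}^{-1}$ are defined on the ranges of $M_k$, $M_{\log}$, which contain $ct$ for all sufficiently large $t$. *)

(* Defs.v *)
From mathcomp Require Import all_boot all_order all_algebra.
From mathcomp Require Import all_classical all_reals all_analysis.
From mathcomp Require Export complex.
Import Order.TTheory GRing.Theory Num.Theory numFieldNormedType.Exports.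
Set Implicit Arguments. Unset Strict Implicit. Unset Printing Implicit Defensive.
Local Open Scope classical_set_scope.
Local Open Scope ring_scope.
Local Open Scope complex_scope.

Section Defs.
Context {R : realType}.

Definition expC (z : R[i]) : R[i] :=
  (expR (complex.Re z))%:C * ((cos (complex.Im z))%:C + 'i * (sin (complex.Im z))%:C).

Context {X : normedModType R[i]^o}.
Local Notation mu := (@lebesgue_measure R).

(* The norm of X takes values in R[i] (always real, nonnegative);
   nrm is its real value. *)
Definition nrm (x : X) : R := complex.Re `|x|.

Definition simple_eval (s : seq (set R * X)) (t : R) : X :=
  \sum_(p <- s) (if `[< p.1 t >] then p.2 else 0).

Definition simple_ok (D : set R) (s : seq (set R * X)) : Prop :=
  forall i : nat, (i < size s)%N ->
    measurable (nth (set0, (0%R : X)) s i).1 /\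
    (mu ((nth (set0, (0%R : X)) s i).1 `&` D) < +oo)%E.

Definition simple_int (D : set R) (s : seq (set R * X)) : X :=
  \sum_(p <- s) ((fine (mu (p.1 `&` D)))%:C *: p.2).

Definition is_bochner_int (D : set R) (g : R -> X) (I : X) : Prop :=
  measurable D /\
  exists u : nat -> seq (set R * X),
    (forall n, simple_ok D (u n)) /\
    (exists N, mu.-negligible N /\
       forall t, D t -> ~ N t -> (fun n => simple_eval (u n) t) @ \oo --> g t) /\
    ((fun n => (\int[mu]_(t in D) (nrm (simple_eval (u n) t - g t))%:E)%E)
        @ \oo --> 0%E) /\
    ((fun n => simple_int D (u n)) @ \oo --> I).

Definition bochner_int (D : set R) (g : R -> X) : X :=
  xget 0 [set I | is_bochner_int D g I].

Definition locally_bochner (F : R -> X) : Prop :=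
  forall a b : R, exists I, is_bochner_int `[a, b] F I.

(* Laplace transform of f : R_+ -> X (values of f on t<0 are irrelevant) *)
Definition laplace (f : R -> X) (lam : R[i]) : X :=
  bochner_int `[0, +oo[ (fun t => expC (- lam * t%:C) *: f t).

Definition has_rderiv (F : R -> X) (s : R) (v : X) : Prop :=
  (fun h : R => (h^-1)%:C *: (F (s + h) - F s)) @ 0^' --> v.

End Defs.

Definition Mk {R : realType} (M : R -> R) (k : nat) (r : R) : R :=
  M r * powR ((1 + r) ^+ 2 * M r) (k%:R^-1).

Definition Mlog {R : realType} (M : R -> R) (r : R) : R :=
  M r * (ln (1 + r) + ln (M r)).

(* Main.v *)
Require Import Defs.
From mathcomp Require Import all_boot all_order all_algebra.
From mathcomp Require Import all_classical all_reals all_analysis.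
From mathcomp Require Import complex measurable_realfun ring lra.
Import Order.TTheory GRing.Theory Num.Theory numFieldNormedType.Exports.
Set Implicit Arguments. Unset Strict Implicit. Unset Printing Implicit Defensive.
Local Open Scope classical_set_scope.
Local Open Scope ring_scope.
Local Open Scope complex_scope.

(* Ingham's method. Take a nonnegative phi, a product of powers of sinc, that is the Fourier
   transform of a spline psi with support in [-r, r]. As f is bounded and Lipschitz, f(t) times
   the integral of phi differs from (f * phi)(t) by O(1/r). For a > 0, Fubini turns the
   convolution of phi with e^{-a tau} f(tau) into the integral of
   psi(s) e^{ist} times the Laplace transform at a + is, and the boundary hypothesis gives, as
   a -> 0+, that (f * phi)(t) is the integral of psi(s) e^{ist} F(s). The Riemann-Lebesgue
   lemma gives f(t) -> 0. If F is C^k, integrating by parts k times bounds the integral by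
   t^{-k} times the size of the derivatives of psi F, and r = M_k^{-1}(ct) balances the two
   errors. For (b), the spline is of class C^{2k} with |psi^(n)| <= (8k/r)^n, and
   k = floor(t / M(r)) with l! <= e k (k/e)^l for l <= k makes the integral exponentially small
   in t / M(r). *)

(** The a.e. convergent sequences in [is_bochner_int] are awkward to carry through estimates. The
    analysis is done with [bint], whose errors are measured by upper integrals, so that integrands
    need not be shown measurable along the way; [bochner_intE] translates back for the Laplace
    transform and the boundary hypothesis. The kernel bounds must be uniform in the number of
    averages, because in (b) that number grows with t. The two scales in the statement come from the
    second error multiplied by r. In (a) it is of order r^2 M(r)^(k+1) / t^k, and M_k(r)^k =
    M(r)^(k+1) (1+r)^2 is exactly what is needed to bound it. In (b) it is of order r^2 M(r) k
    e^(-t/M(r)). Writing e^y = (1+r) M(r), so that t / M(r) = y/c, it is at most a constant times y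
    e^(2y) e^(-y/c), which stays bounded because 1/c > 2: this is the origin of the condition c <
    1/2. *)

Section norm.
Context {R : realType} {X : normedModType R[i]^o}.
Implicit Types x y : X.

Lemma nrmE x : `|x| = (nrm x)%:C :> R[i].
Proof.
rewrite /nrm; have := normr_ge0 x; rewrite lecE => /andP[/eqP h _].
by case: `|x| h => a b /= ->.
Qed.

Lemma nrm_ge0 x : 0 <= nrm x.
Proof. by have := normr_ge0 x; rewrite nrmE -(rmorph0 (@real_complex R)) lecR. Qed.

Lemma nrm0 : nrm (0 : X) = 0.
Proof. by rewrite /nrm normr0. Qed.

Lemma nrmN x : nrm (- x) = nrm x.
Proof. by rewrite /nrm normrN. Qed.

Lemma nrmD x y : nrm (x + y) <= nrm x + nrm y.
Proof. by have := ler_normD x y; rewrite !nrmE -rmorphD lecR. Qed.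

Lemma nrm_sub x y : nrm (x - y) <= nrm x + nrm y.
Proof. by rewrite -(nrmN y) nrmD. Qed.

Lemma nrmBC x y : nrm (x - y) = nrm (y - x).
Proof. by rewrite -nrmN opprB. Qed.

Lemma nrmB_tri y x z : nrm (x - z) <= nrm (x - y) + nrm (y - z).
Proof. by rewrite (le_trans _ (nrmD _ _))// addrA subrK. Qed.

Lemma nrm_le0 x : nrm x <= 0 -> x = 0.
Proof.
move=> h; apply/eqP; rewrite -normr_eq0 nrmE.
by have /eqP -> : nrm x == 0 by rewrite eq_le h nrm_ge0.
Qed.

Lemma cvg_nrmP (T : Type) (F : set_system T) {FF : Filter F} (g : T -> X) (l : X) :
  (g @ F --> l) <-> (forall e : R, 0 < e -> \forall x \near F, nrm (g x - l) <= e).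
Proof.
split=> [/cvgrPdist_le h e e0|h].
  have e0' : (0 : R[i]) < e%:C by rewrite -(rmorph0 (@real_complex R)) ltcR.
  by apply: filterS (h _ e0') => x; rewrite nrmE lecR nrmBC.
(* In the order of [R[i]], [0 < e] forces the imaginary part of [e] to vanish, so only real radii
   occur. *)
apply/cvgrPdist_le => e; rewrite ltcE/= => /andP[/eqP ime e0].
have -> : e = (complex.Re e)%:C by case: e ime {e0} => a b /= ->.
by apply: filterS (h _ e0) => x; rewrite nrmE lecR nrmBC.
Qed.

End norm.

(** * Modulus and completeness of the scalars *)

Notation cabs := (@nrm _ _[i]^o).

Section cabs.
Context {R : realType}.
Implicit Types (c d : R[i]) (a b : R).

Lemma nrmZ (X : normedModType R[i]^o) c (x : X) : nrm (c *: x) = cabs c * nrm x.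
Proof. by apply/(@complexI R); rewrite rmorphM/= -!nrmE; exact: normrZ. Qed.

Lemma cabsM c d : cabs (c * d) = cabs c * cabs d.
Proof. by apply/(@complexI R); rewrite rmorphM/= -!nrmE; exact: normrM. Qed.

Lemma cabsE c : cabs c = Num.sqrt (complex.Re c ^+ 2 + complex.Im c ^+ 2).
Proof. by rewrite /nrm (normc_def c). Qed.

Lemma cabsR a : cabs a%:C = `|a|.
Proof. by rewrite cabsE /= expr0n/= addr0 sqrtr_sqr. Qed.

Lemma cabs_i : cabs ('i : R[i]) = 1.
Proof. by rewrite cabsE/= expr0n/= add0r expr1n sqrtr1. Qed.

Lemma cabs_Re c : `|complex.Re c| <= cabs c.
Proof. by rewrite cabsE -sqrtr_sqr ler_wsqrtr// lerDl sqr_ge0. Qed.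

Lemma cabs_Im c : `|complex.Im c| <= cabs c.
Proof. by rewrite cabsE -sqrtr_sqr ler_wsqrtr// lerDr sqr_ge0. Qed.

Lemma cabs_leD c : cabs c <= `|complex.Re c| + `|complex.Im c|.
Proof.
rewrite {1}(complexE c); apply: le_trans (nrmD _ _) _.
by rewrite cabsM !cabsR cabs_i mul1r.
Qed.

Lemma nrmZR (X : normedModType R[i]^o) a (x : X) : nrm (a%:C *: x) = `|a| * nrm x.
Proof. by rewrite nrmZ cabsR. Qed.

End cabs.

Section complete.
Context {R : realType}.

(** Completeness is a hypothesis rather than a structure, so that one integration theory serves both
    [X] and the scalar field [R[i]^o], where it is proved componentwise. *)
Definition nrm_complete (X : normedModType R[i]^o) := forall u : nat -> X,
  (forall e : R, 0 < e -> exists N, forall m n, (N <= m)%N -> (N <= n)%N ->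
     nrm (u m - u n) <= e) ->
  exists l, forall e : R, 0 < e -> exists N, forall n, (N <= n)%N -> nrm (u n - l) <= e.

Lemma completeNormedMod_nrm_complete (X : completeNormedModType R[i]^o) : nrm_complete X.
Proof.
move=> u cu; suff /cvg_ex[l /cvg_nrmP ul] : cvg (u @ \oo).
  exists l => e /ul [N _ hN]; exists N => n Nn; exact: hN.
apply/cauchy_cvgP/cauchy_exP => e; rewrite ltcE/= => /andP[/eqP ime e0].
have -> : e = (complex.Re e)%:C by case: e ime {e0} => a b /= ->.
have e20 : 0 < complex.Re e / 2 by rewrite divr_gt0.
have [N hN] := cu _ e20; exists (u N); exists N => // n /= Nn.
rewrite -ball_normE/= nrmE ltcR (@le_lt_trans _ _ (complex.Re e / 2))//; last first.
  by rewrite ltr_pdivrMr// ltr_pMr// ltr1n.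
exact: hN.
Qed.

End complete.

Section complete_complex.
Context {R : realType}.

Lemma cauchy_real_cvg (u : nat -> R) :
  (forall e : R, 0 < e -> exists N, forall m n, (N <= m)%N -> (N <= n)%N -> `|u m - u n| <= e) ->
  exists l, forall e : R, 0 < e -> exists N, forall n, (N <= n)%N -> `|u n - l| <= e.
Proof.
move=> cu; suff /cvg_ex[l /cvgrPdist_le ul] : cvg (u @ \oo).
  by exists l => e /ul [N _ hN]; exists N => n Nn; rewrite distrC; exact: hN.
apply/cauchy_cvgP/cauchy_exP => e e0.
have e20 : 0 < e / 2 by rewrite divr_gt0.
have [N hN] := cu _ e20; exists (u N); exists N => // n /= Nn.
rewrite -ball_normE/= (@le_lt_trans _ _ (e / 2))//; last first.
  by rewrite ltr_pdivrMr// ltr_pMr// ltr1n.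
exact: hN.
Qed.

Lemma complex_nrm_complete : @nrm_complete R R[i]^o.
Proof.
move=> u cu.
have [e e0|a ha] := @cauchy_real_cvg (fun n => complex.Re (u n)).
  have [N hN] := cu _ e0; exists N => m n Nm Nn; apply: le_trans (hN _ _ Nm Nn).
  by have := cabs_Re (u m - u n); case: (u m) => ? ?; case: (u n).
have [e e0|b hb] := @cauchy_real_cvg (fun n => complex.Im (u n)).
  have [N hN] := cu _ e0; exists N => m n Nm Nn; apply: le_trans (hN _ _ Nm Nn).
  by have := cabs_Im (u m - u n); case: (u m) => ? ?; case: (u n).
exists (a +i* b) => e e0.
have e20 : 0 < e / 2 by rewrite divr_gt0.
have [N1 h1] := ha _ e20; have [N2 h2] := hb _ e20.
exists (maxn N1 N2) => n; rewrite geq_max => /andP[/h1 {}h1 /h2 {}h2].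
apply: le_trans (cabs_leD _) _; rewrite (splitr e).
by case: (u n) h1 h2 => p q /= h1 h2; rewrite lerD.
Qed.

End complete_complex.

(** * The Bochner integral *)

Section simple.
Context {R : realType} {X : normedModType R[i]^o}.
Local Notation mu := (@lebesgue_measure R).
Implicit Types (s : seq (set R * X)) (D A : set R) (x y : X).

Lemma simple_ok_cons D p s :
  simple_ok D (p :: s) <-> (measurable p.1 /\ (mu (p.1 `&` D) < +oo)%E) /\ simple_ok D s.
Proof.
split=> [h|[h1 h2] [_ //|i]]; last by rewrite /= ltnS => /h2.
by split=> [|i hi]; [exact: (h 0%N)|exact: (h i.+1)].
Qed.

Lemma simple_ok_cat D s1 s2 : simple_ok D s1 -> simple_ok D s2 -> simple_ok D (s1 ++ s2).
Proof.
by elim: s1 => //= p s1 ih /simple_ok_cons[h1 h2] h3; apply/simple_ok_cons; split => //; exact: ih.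
Qed.

Lemma simple_ok_map D (F : X -> X) s :
  simple_ok D s -> simple_ok D [seq (p.1, F p.2) | p <- s].
Proof.
elim: s => // p s ih /simple_ok_cons[h1 h2]; apply/simple_ok_cons; split => //; exact: ih.
Qed.

Lemma simple_eval_cons p s t :
  simple_eval (p :: s) t = (if `[< p.1 t >] then p.2 else 0) + simple_eval s t.
Proof. by rewrite /simple_eval big_cons. Qed.

Lemma simple_int_cons D p s :
  simple_int D (p :: s) = (fine (mu (p.1 `&` D)))%:C *: p.2 + simple_int D s.
Proof. by rewrite /simple_int big_cons. Qed.

Lemma simple_eval_cat s1 s2 t : simple_eval (s1 ++ s2) t = simple_eval s1 t + simple_eval s2 t.
Proof. by rewrite /simple_eval big_cat. Qed.

Lemma simple_int_cat D s1 s2 : simple_int D (s1 ++ s2) = simple_int D s1 + simple_int D s2.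
Proof. by rewrite /simple_int big_cat. Qed.

(** [V] is arbitrary: a simple function takes finitely many values, each on a measurable set. The
    offset [y] accumulates the values already chosen in the induction. *)
Lemma measurable_simple (V : X -> R) D s y : measurable D -> simple_ok D s ->
  measurable_fun setT (fun t => V (y + simple_eval s t)).
Proof.
move=> mD; elim: s y => [y _|p s ih y /simple_ok_cons[[mp _] hs]].
  rewrite [X in measurable_fun _ X](_ : _ = cst (V y)); first exact: measurable_cst.
  by apply/funext => t; rewrite /simple_eval big_nil addr0.
rewrite [X in measurable_fun _ X](_ : _ = fun t =>
   if `[< p.1 t >] then V (y + p.2 + simple_eval s t) else V (y + simple_eval s t)); last first.
  by apply/funext => t; rewrite simple_eval_cons; case: ifP; rewrite ?add0r ?addrA.
apply: measurable_fun_ifT; [|exact: ih|exact: ih].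
apply: (measurable_fun_bool true); rewrite setTI (_ : _ @^-1` _ = p.1)//.
by apply/seteqP; split => t /=; [move/asboolP|move=> ?; apply/asboolP].
Qed.

Lemma simple_int_setD D A s : measurable D -> measurable A -> simple_ok setT s ->
  simple_int (D `&` A) s + simple_int (D `\` A) s = simple_int D s.
Proof.
move=> mD mA; elim: s => [_|p s ih /simple_ok_cons[[mp fp] hs]].
  by rewrite /simple_int !big_nil addr0.
rewrite !simple_int_cons addrACA -(ih hs); congr (_ + _).
rewrite -scalerDl -rmorphD; congr (_%:C *: _).
have fin B : measurable B -> mu (p.1 `&` B) \is a fin_num.
  move=> mB; rewrite ge0_fin_numE//; apply: le_lt_trans fp; rewrite setIT.
  by apply: le_measure; rewrite ?inE//; exact: measurableI.
rewrite -fineD ?fin//; [|exact: measurableI|exact: measurableD].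
congr fine; rewrite -measureU.
- by congr (mu _); rewrite -setIUr setUIDK.
- by apply: measurableI => //; exact: measurableI.
- by apply: measurableI => //; exact: measurableD.
- by rewrite setIACA setDE (setIACA D) setICr !setI0.
Qed.

(* Applied to the norm and, for the positivity of integrals, to the negative part of Re. *)
Record sublinear (V : X -> R) : Prop := {
  subl_ge0 : forall x, 0 <= V x;
  subl_nrm : forall x, V x <= nrm x;
  subl_D : forall x y, V (x + y) <= V x + V y;
  subl_Z : forall (a : R) x, 0 <= a -> V (a%:C *: x) <= a * V x }.

Lemma sublinear_nrm : sublinear (@nrm R X).
Proof.
split=> [x|x|x y|a x a0]; rewrite ?nrm_ge0 ?nrmD// nrmZR ger0_norm//.
Qed.

(* The sets of a simple list may overlap; splitting the domain along the first set and carrying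
   the accumulated value y reduces the list one set at a time. *)
Lemma simple_int_sublinear (V : X -> R) D s y : sublinear V -> measurable D -> simple_ok setT s ->
  (mu D < +oo)%E \/ y = 0 ->
  ((V (simple_int D s + (fine (mu D))%:C *: y))%:E <= \int[mu]_(t in D) (V (y + simple_eval s t))%:E)%E.
Proof.
move=> sV; elim: s D y => [D y mD _ fD|p s ih D y mD /simple_ok_cons[[mp fp] hs] fD].
  rewrite /simple_int big_nil add0r; under eq_integral do rewrite /simple_eval big_nil addr0.
  rewrite integral_cst//; case: fD => [fD|->].
    rewrite (@le_trans _ _ ((V y)%:E * (fine (mu D))%:E)%E)//.
      by rewrite -EFinM lee_fin mulrC subl_Z// fine_ge0.
    by rewrite fineK// ge0_fin_numE.
  (* Here [D] may have infinite measure, but the integrand is the constant [V 0 = 0], so both sides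
     vanish. *)
  rewrite scaler0; have -> : V 0 = 0.
    by apply/eqP; rewrite eq_le subl_ge0// andbT (le_trans (subl_nrm sV _))// nrm0.
  by rewrite mul0e.
have -> : (\int[mu]_(t in D) (V (y + simple_eval (p :: s) t))%:E)%E =
  (\int[mu]_(t in D `&` p.1) (V (y + p.2 + simple_eval s t))%:E +
   \int[mu]_(t in D `\` p.1) (V (y + simple_eval s t))%:E)%E.
  rewrite -[in LHS](setUIDK D p.1) ge0_integral_setU//; first last.
  - rewrite disj_set2E; apply/eqP. by rewrite setDE (setIACA D) setICr setI0.
  - by move=> t _; rewrite lee_fin subl_ge0.
  - apply/measurable_EFinP; apply: measurable_funTS; apply: (@measurable_simple V setT) => //.
    exact/simple_ok_cons.
  - exact: measurableD.
  - exact: measurableI.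
  congr (_ + _)%E; apply: eq_integral => t; rewrite inE => -[Dt pt]; rewrite simple_eval_cons.
    by rewrite asboolT ?addrA.
  by rewrite asboolF ?add0r.
(* On this piece the measure is finite by [simple_ok], so the induction hypothesis may carry the
   nonzero value [y + p.2]. *)
have fDp : (mu (D `&` p.1) < +oo)%E.
  apply: le_lt_trans fp; rewrite setIT; apply: le_measure; rewrite ?inE//; exact: measurableI.
have h1 := ih (D `&` p.1) (y + p.2) (measurableI _ _ mD mp) hs (or_introl fDp).
have h2 : ((V (simple_int (D `\` p.1) s + (fine (mu (D `\` p.1)))%:C *: y))%:E <=
    \int[mu]_(t in D `\` p.1) (V (y + simple_eval s t))%:E)%E.
  apply: ih => //; first exact: measurableD.
  case: fD => fD; [left|by right]; apply: le_lt_trans fD.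
  by apply: le_measure; rewrite ?inE//; exact: measurableD.
apply: le_trans (leeD h1 h2); rewrite -EFinD lee_fin; apply: le_trans (subl_D sV _ _).
rewrite le_eqVlt; apply/orP; left; apply/eqP; congr V; rewrite simple_int_cons -(simple_int_setD mD mp hs).
have -> : (fine (mu D))%:C *: y = (fine (mu (D `&` p.1)))%:C *: y + (fine (mu (D `\` p.1)))%:C *: y.
  case: fD => [fD|->]; last by rewrite !scaler0 addr0.
  rewrite -scalerDl -rmorphD -fineD.
  - congr ((fine _)%:C *: _); rewrite -measureU.
    + by rewrite setUIDK.
    + exact: measurableI.
    + exact: measurableD.
    + by rewrite setDE setIACA setICr setI0.
  - by rewrite ge0_fin_numE.
  - rewrite ge0_fin_numE//; apply: le_lt_trans fD.
    by apply: le_measure; rewrite ?inE//; exact: measurableD.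
rewrite setIC scalerDr [RHS]addrACA.
have AC (a b c d e : X) : a + (b + c) + (d + e) = b + c + (d + a + e).
  by rewrite (addrC a) -!addrA; congr (_ + (_ + _)); rewrite addrCA.
exact: AC.
Qed.

End simple.

(** * Upper integrals *)

Section upper_integral.
Context {R : realType}.
Local Notation mu := (@lebesgue_measure R).
Implicit Types (h : R -> R) (e a b : R).

(* The upper integral of h is at most e; unlike \int[mu], it is subadditive on all functions. *)
Definition uint_le h e := exists m : R -> \bar R,
  [/\ measurable_fun setT m, forall t, ((h t)%:E <= m t)%E & (\int[mu]_t m t <= e%:E)%E].

Lemma uint_leW h h' e e' : (forall t, h t <= h' t) -> e' <= e -> uint_le h' e' -> uint_le h e.
Proof.
move=> hh ee [m [mm hm im]]; exists m; split => // [t|].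
  by apply: le_trans (hm t); rewrite lee_fin.
by apply: le_trans im _; rewrite lee_fin.
Qed.

Lemma uint_leD h h' e e' : (forall t, 0 <= h t) -> (forall t, 0 <= h' t) ->
  uint_le h e -> uint_le h' e' -> uint_le (fun t => h t + h' t) (e + e').
Proof.
move=> h0 h0' [m [mm hm im]] [m' [mm' hm' im']].
have m0 t : setT t -> (0 <= m t)%E by move=> _; apply: le_trans (hm t); rewrite lee_fin.
have m0' t : setT t -> (0 <= m' t)%E by move=> _; apply: le_trans (hm' t); rewrite lee_fin.
exists (fun t => m t + m' t)%E; split => [|t|]; first exact: emeasurable_funD.
  by rewrite EFinD leeD.
by rewrite ge0_integralD// EFinD leeD.
Qed.

Lemma uint_leZ a h e : 0 <= a -> (forall t, 0 <= h t) ->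
  uint_le h e -> uint_le (fun t => a * h t) (a * e).
Proof.
move=> a0 h0 [m [mm hm im]].
have m0 t : setT t -> (0 <= m t)%E by move=> _; apply: le_trans (hm t); rewrite lee_fin.
exists (fun t => a%:E * m t)%E; split => [|t|]; first exact: measurable_funeM.
  by rewrite EFinM; apply: lee_wpmul2l; rewrite ?lee_fin.
by rewrite ge0_integralZl_EFin// EFinM; apply: lee_wpmul2l; rewrite ?lee_fin.
Qed.

Lemma uint_le_measurable h e : measurable_fun setT h -> (\int[mu]_t (h t)%:E <= e%:E)%E ->
  uint_le h e.
Proof. by move=> mh ih; exists (EFin \o h); split => //; exact/measurable_EFinP. Qed.

Lemma uint_le0 : uint_le (fun=> 0) 0.
Proof. by apply: uint_le_measurable => //; rewrite integral0. Qed.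

Lemma uint_le_indic (A : set R) a : measurable A -> (mu A < +oo)%E -> 0 <= a ->
  uint_le (fun t => if `[< A t >] then a else 0) (a * fine (mu A)).
Proof.
move=> mA fA a0; have E : (fun t => if `[< A t >] then a else 0) = (fun t => a * \1_A t).
  apply/funext => t; rewrite indicE; case: ifPn => /asboolP At; first by rewrite mem_set// mulr1.
  by rewrite memNset// mulr0.
rewrite E; apply: uint_leZ => //; apply: uint_le_measurable => //; rewrite integral_indic// setIT fineK// ge0_fin_numE//.
Qed.

Lemma mu_itv a b : a <= b -> mu `[a, b[%classic = (b - a)%:E.
Proof.
move=> ab; rewrite lebesgue_measure_itv/= lte_fin; case: ltP => // ba.
have -> : b = a by apply/eqP; rewrite eq_le ab ba.
by rewrite subrr.
Qed.

Lemma uint_le_itv a b K : a <= b -> 0 <= K ->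
  uint_le (fun t => if `[< `[a, b[%classic t >] then K else 0) (K * (b - a)).
Proof.
move=> ab K0; have := @uint_le_indic `[a, b[%classic K; rewrite mu_itv//=; apply => //.
by rewrite ltey.
Qed.

End upper_integral.

(** * The integral by approximation in upper L1 distance *)

Section bint.
Context {R : realType} {X : normedModType R[i]^o}.
Local Notation mu := (@lebesgue_measure R).
Implicit Types (g : R -> X) (I J : X) (A : set R) (s : seq (set R * X)).

Definition cutf A g : R -> X := fun t => if `[< A t >] then g t else 0.

(* The a.e. convergence demanded by is_bochner_int is dropped here: it is recovered by letting
   the L1 distances decrease geometrically. *)
Definition bint g I := forall e : R, 0 < e -> exists s, [/\ simple_ok setT s,
  uint_le (fun t => nrm (simple_eval s t - g t)) e & nrm (simple_int setT s - I) <= e].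

Lemma bint_close g I : (forall e : R, 0 < e -> exists g' I', [/\ bint g' I',
  uint_le (fun t => nrm (g' t - g t)) e & nrm (I' - I) <= e]) -> bint g I.
Proof.
move=> h e e0; have e20 : 0 < e / 2 by rewrite divr_gt0.
have [g' [I' [bg' ug' nI']]] := h _ e20; have [s [os us ns]] := bg' _ e20.
exists s; split => //; last first.
  by rewrite (splitr e) (le_trans (nrmB_tri I' _ _))// lerD.
rewrite (splitr e); apply: uint_leW (uint_leD _ _ us ug') => // t; exact: nrmB_tri || exact: nrm_ge0.
Qed.

Lemma bint0 : bint (fun=> 0) 0.
Proof.
move=> e e0; exists [::]; split => //.
  apply: uint_leW (ltW e0) uint_le0 => t.
  by rewrite /simple_eval big_nil subrr nrm0.
by rewrite /simple_int big_nil subrr nrm0 ltW.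
Qed.

Lemma bintD g g' I I' : bint g I -> bint g' I' -> bint (fun t => g t + g' t) (I + I').
Proof.
move=> bg bg' e e0; have e20 : 0 < e / 2 by rewrite divr_gt0.
have [s [os us ns]] := bg _ e20; have [s' [os' us' ns']] := bg' _ e20.
have E (a b c d : X) : (a + b) - (c + d) = (a - c) + (b - d) by rewrite opprD addrACA.
exists (s ++ s'); split; first exact: simple_ok_cat.
  rewrite (splitr e); apply: uint_leW (uint_leD _ _ us us') => // t; last first.
  - exact: nrm_ge0.
  - exact: nrm_ge0.
  by rewrite simple_eval_cat E nrmD.
by rewrite simple_int_cat E (splitr e) (le_trans (nrmD _ _))// lerD.
Qed.

Lemma bintZ c g I : bint g I -> bint (fun t => c *: g t) (c *: I).
Proof.
move=> bg e e0; have c1 : 0 < cabs c + 1 by rewrite ltr_wpDl// nrm_ge0.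
have [s [os us ns]] := bg (e / (cabs c + 1)) (divr_gt0 e0 c1).
have ec : cabs c * (e / (cabs c + 1)) <= e.
  by rewrite mulrCA ler_piMr ?(ltW e0)// ler_pdivrMr// mul1r lerDl.
exists [seq (p.1, c *: p.2) | p <- s]; split; first exact: simple_ok_map.
  apply: uint_leW ec (uint_leZ (nrm_ge0 _) _ us) => t; last exact: nrm_ge0.
  rewrite -nrmZ scalerBr le_eqVlt; apply/orP; left; apply/eqP; congr (nrm (_ - _)).
  rewrite /simple_eval big_map scaler_sumr; apply: eq_bigr => p _.
  by case: ifP => //; rewrite scaler0.
apply: le_trans ec; apply: le_trans (ler_wpM2l (nrm_ge0 _) ns).
rewrite -nrmZ scalerBr /simple_int big_map scaler_sumr /=.
by under eq_bigr do rewrite scalerA mulrC -scalerA.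
Qed.

Lemma bintN g I : bint g I -> bint (fun t => - g t) (- I).
Proof.
move=> /(bintZ (-1)); rewrite scaleN1r; congr bint; apply/funext => t.
by rewrite scaleN1r.
Qed.

Lemma bintB g g' I I' : bint g I -> bint g' I' -> bint (fun t => g t - g' t) (I - I').
Proof. by move=> bg /bintN; exact: bintD. Qed.

Lemma bint_ext g g' I : g =1 g' -> bint g I -> bint g' I.
Proof. by move=> /funext ->. Qed.

(** True for simple functions by [simple_int_sublinear]; it survives the limit because [V] is
    subadditive and dominated by the norm, so each replacement costs at most the approximation
    error. *)
Lemma bint_sublinear (V : X -> R) g I e : sublinear V -> bint g I ->
  uint_le (fun t => V (g t)) e -> V I <= e.
Proof.
move=> sV bg ug; apply/ler_addgt0Pr => d d0.
have d20 : 0 < d / 2 by rewrite divr_gt0.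
have [s [os us ns]] := bg _ d20.
rewrite -(subrK (simple_int setT s) I) addrC (le_trans (subl_D sV _ _))//.
rewrite [d]splitr addrA lerD//; last first.
  by rewrite (le_trans (subl_nrm sV _))// nrmBC.
have [m [mm hm im]] := uint_leD (fun t => subl_ge0 sV (g t)) (fun=> nrm_ge0 _) ug us.
rewrite -lee_fin; apply: le_trans im.
have := @simple_int_sublinear _ _ V setT s 0 sV measurableT os (or_intror erefl).
rewrite scaler0 addr0 => /le_trans; apply.
apply: ge0_le_integral => //.
- by move=> t _; rewrite lee_fin subl_ge0.
- by apply/measurable_EFinP; exact: (@measurable_simple _ _ V setT).
- move=> t _; apply: le_trans (hm t); rewrite lee_fin add0r.
  by rewrite -{1}(subrK (g t) (simple_eval s t)) addrC (le_trans (subl_D sV _ _))// lerD2l subl_nrm.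
Qed.

Lemma bint_nrm g I e : bint g I -> uint_le (fun t => nrm (g t)) e -> nrm I <= e.
Proof. by apply: bint_sublinear; exact: sublinear_nrm. Qed.

Lemma bint_unique g I J : bint g I -> bint g J -> I = J.
Proof.
move=> bI bJ; apply/eqP; rewrite -subr_eq0; apply/eqP/nrm_le0.
apply: bint_nrm (bintB bI bJ) _; apply: uint_leW (lexx _) uint_le0 => t.
by rewrite subrr nrm0.
Qed.

(** The integrals of approximants with error 1/(n+1) form a Cauchy sequence by [bint_nrm], and
    completeness supplies the value. *)
Lemma bint_exists g : nrm_complete X -> (forall e : R, 0 < e -> exists g' I', bint g' I' /\
  uint_le (fun t => nrm (g' t - g t)) e) -> exists I, bint g I.
Proof.
move=> cX h.
have /choice[u hu] : forall n : nat, exists p : (R -> X) * X, bint p.1 p.2 /\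
    uint_le (fun t => nrm (p.1 t - g t)) n.+1%:R^-1.
  by move=> n; have [|g' [I' [? ?]]] := h n.+1%:R^-1; [rewrite invr_gt0|exists (g', I')].
have uuu m n : nrm ((u m).2 - (u n).2) <= m.+1%:R^-1 + n.+1%:R^-1.
  apply: bint_nrm (bintB (hu m).1 (hu n).1) _.
  apply: uint_leW (lexx _) (uint_leD _ _ (hu m).2 (hu n).2) => t; rewrite ?nrm_ge0//.
  by rewrite (nrmBC ((u n).1 t)) nrmB_tri.
have inv_small (e : R) : 0 < e -> exists N, forall n, (N <= n)%N -> n.+1%:R^-1 <= e.
  move=> e0; exists (Num.truncn e^-1) => n Nn; rewrite invf_ple ?posrE//.
  by rewrite (le_trans (ltW (truncnS_gt _)))// ler_nat.
have [e e0|I hI] := cX (fun n => (u n).2).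
  have [N hN] := inv_small _ (divr_gt0 e0 (@ltr0Sn R 1)).
  by exists N => m n Nm Nn; rewrite (le_trans (uuu _ _))// (splitr e) lerD// hN.
exists I; apply: bint_close => e e0.
have [N hN] := inv_small _ e0; have [N' hN'] := hI _ e0.
exists (u (maxn N N')).1, (u (maxn N N')).2; have [b1 b2] := hu (maxn N N'); split => //.
  by apply: uint_leW b2 => //; exact: hN (leq_maxl _ _).
exact: hN' (leq_maxr _ _).
Qed.

Lemma bint_cst A x : measurable A -> (mu A < +oo)%E ->
  bint (cutf A (fun=> x)) ((fine (mu A))%:C *: x).
Proof.
move=> mA fA e e0; exists [:: (A, x)]; split.
- by apply/simple_ok_cons; rewrite /= setIT.
- apply: uint_leW (ltW e0) uint_le0 => t.
  by rewrite /simple_eval big_seq1 /cutf /= subrr nrm0.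
by rewrite /simple_int big_seq1/= setIT subrr nrm0 ltW.
Qed.

Lemma bint_cst_itv a b x : a <= b -> bint (cutf `[a, b[%classic (fun=> x)) ((b - a)%:C *: x).
Proof.
by move=> ab; have := @bint_cst `[a, b[%classic x; rewrite mu_itv//=; apply => //; rewrite ltey.
Qed.

Lemma uint_le_nrm_simple s : simple_ok setT s -> exists e, uint_le (fun t => nrm (simple_eval s t)) e.
Proof.
elim: s => [_|p s ih /simple_ok_cons[[mp fp] /ih[e ue]]].
  exists 0; apply: uint_leW (lexx _) uint_le0 => t; by rewrite /simple_eval big_nil nrm0.
rewrite setIT in fp; exists (nrm p.2 * fine (mu p.1) + e).
apply: uint_leW (lexx _) (uint_leD _ _ (uint_le_indic mp fp (nrm_ge0 _)) ue) => t.
- by rewrite simple_eval_cons (le_trans (nrmD _ _))// lerD//; case: ifP => // _; rewrite nrm0.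
- by case: ifP => // _; exact: nrm_ge0.
- exact: nrm_ge0.
Qed.

Lemma bint_uint_le g I : bint g I -> exists2 e, 0 <= e & uint_le (fun t => nrm (g t)) e.
Proof.
move=> /(_ _ ltr01)[s [os us _]]; have [e ue] := uint_le_nrm_simple os.
exists (Num.max 0 (e + 1)); first by rewrite le_max lexx.
apply: uint_leW (uint_leD _ _ ue us) => [t||t|t]; rewrite ?nrm_ge0//; last first.
  by rewrite le_max lexx orbT.
by rewrite -{1}(subKr (simple_eval s t) (g t)) (le_trans (nrm_sub _ _)).
Qed.

Lemma bint_cutf A g I : nrm_complete X -> measurable A -> bint g I -> exists J, bint (cutf A g) J.
Proof.
move=> cX mA bg; apply: bint_exists => // e e0; have [s [os us ns]] := bg _ e0.
have [J bJ] : exists J, bint (cutf A (simple_eval s)) J.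
  elim: s os {us ns} => [_|p s ih /simple_ok_cons[[mp fp] /ih[J bJ]]].
    exists 0; apply: bint_ext bint0 => t; rewrite /cutf /simple_eval big_nil; by case: ifP.
  exists ((fine (mu (A `&` p.1)))%:C *: p.2 + J).
  have fA : (mu (A `&` p.1) < +oo)%E.
    rewrite setIT in fp; apply: le_lt_trans fp; apply: le_measure; rewrite ?inE//; exact: measurableI.
  apply: bint_ext (bintD (bint_cst _ (measurableI _ _ mA mp) fA) bJ) => t.
  rewrite /cutf simple_eval_cons (_ : `[< (A `&` p.1) t >] = `[< A t >] && `[< p.1 t >]).
    by case: `[< A t >] => //=; rewrite addr0.
  by rewrite -asbool_and.
exists (cutf A (simple_eval s)), J; split => //; apply: uint_leW us => // t.
by rewrite /cutf; case: ifP => // _; rewrite subrr nrm0 nrm_ge0.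
Qed.

End bint.

(** * Equivalence with the Bochner integral of the statement *)

Section bochner.
Context {R : realType} {X : normedModType R[i]^o}.
Local Notation mu := (@lebesgue_measure R).
Implicit Types (g : R -> X) (I J : X) (D A : set R) (s : seq (set R * X)).

(** No measurability is required: the integral of a nonnegative function is a supremum over the
    simple functions below it, a set that grows with the function. *)
Lemma ge0_le_integral_any (h1 h2 : R -> \bar R) : (forall t, (0 <= h1 t)%E) ->
  (forall t, (h1 t <= h2 t)%E) -> (\int[mu]_t h1 t <= \int[mu]_t h2 t)%E.
Proof.
move=> h0 h12; have h20 t : (0 <= h2 t)%E := le_trans (h0 t) (h12 t).
rewrite !ge0_integralTE//; apply: le_ereal_sup => _ [k /= hk <-].
by exists k => // t; apply: le_trans (h12 t).
Qed.

Definition simple_cutf D s := [seq (p.1 `&` D, p.2) | p <- s].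

Lemma simple_ok_cutf D s : measurable D -> simple_ok D s -> simple_ok setT (simple_cutf D s).
Proof.
move=> mD; elim: s => // p s ih /simple_ok_cons[[mp fp] hs].
apply/simple_ok_cons; rewrite /= setIT; split; last exact: ih.
by split => //; exact: measurableI.
Qed.

Lemma simple_okS D s : measurable D -> simple_ok setT s -> simple_ok D s.
Proof.
move=> mD; elim: s => // p s ih /simple_ok_cons[[mp fp] hs].
apply/simple_ok_cons; split; last exact: ih.
split => //; apply: le_lt_trans fp; rewrite setIT.
by apply: le_measure; rewrite ?inE//; exact: measurableI.
Qed.

Lemma simple_eval_cutf D s : simple_eval (simple_cutf D s) = cutf D (simple_eval s).
Proof.
apply/funext => t; rewrite /cutf; elim: s => [|p s ih].
  by rewrite /simple_eval !big_nil; case: ifP.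
rewrite /= !simple_eval_cons ih /= (_ : `[< (p.1 `&` D) t >] = `[< p.1 t >] && `[< D t >]).
  by case: `[< D t >]; rewrite ?andbT ?andbF ?addr0.
by rewrite -asbool_and.
Qed.

Lemma simple_int_cutf D s : simple_int setT (simple_cutf D s) = simple_int D s.
Proof. by rewrite /simple_int big_map; apply: eq_bigr => p _ /=; rewrite setIT. Qed.

Lemma cutfB D g g' t : cutf D g t - cutf D g' t = cutf D (fun t => g t - g' t) t.
Proof. by rewrite /cutf; case: ifP; rewrite ?subr0. Qed.

Lemma restrict_nrm_cutf D g : (fun t => (nrm (g t))%:E) \_ D = (fun t => (nrm (cutf D g t))%:E).
Proof.
apply/funext => t; rewrite patchE /cutf.
rewrite (_ : (t \in D) = `[< D t >])//.
by case: ifP; rewrite ?nrm0.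
Qed.

Lemma simple_evalN s t : simple_eval [seq (p.1, - p.2) | p <- s] t = - simple_eval s t.
Proof.
rewrite /simple_eval big_map -sumrN; apply: eq_bigr => p _ /=.
by case: ifP; rewrite ?oppr0.
Qed.

Lemma bint_simple s : simple_ok setT s -> bint (simple_eval s) (simple_int setT s).
Proof.
move=> os e e0; exists s; split; rewrite ?subrr ?nrm0 ?ltW//.
by apply: uint_leW (ltW e0) uint_le0 => t; rewrite subrr nrm0.
Qed.

(** The distance to [g] is not known to be measurable, so a measurable majorant is needed. Off a
    null Borel set [B] the distance from [u n] to [g] is the limit over [k] of the distances from
    [u n] to [u k], hence measurable there. *)
Lemma bochner_bint D g I : is_bochner_int D g I -> bint (cutf D g) I.
Proof.
move=> [mD [u [ok [[N [[B [mB B0 NB]] cvgu]] [cint csum]]]]] e e0.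
have [n0 _ hn0] := proj1 (cvg_nrmP _ _) csum _ e0.
have [n1 _ hn1] : \forall n \near \oo, (\int[mu]_(t in D) (nrm (simple_eval (u n) t - g t))%:E <= e%:E)%E.
  have e0' : \forall x \near (0 : \bar R)%E, (x < e%:E)%E by apply: open_ereal_lt'; rewrite lte_fin.
  by have [k0 _ hk0] := cint _ e0'; exists k0 => // k /hk0 /ltW.
pose n := maxn n0 n1.
pose h k t := nrm (cutf D (simple_eval (u k)) t - cutf D g t).
exists (simple_cutf D (u n)); split; first exact: simple_ok_cutf.
- rewrite simple_eval_cutf.
  (* The value [+oo] makes [m] a majorant on [B] too, and costs nothing since [B] is null. *)
  pose m t : \bar R := if t \in B then +oo%E else (h n t)%:E.
  have mm : measurable_fun setT m.
    apply: measurable_fun_if => //.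
      apply: (measurable_fun_bool true); rewrite setTI (_ : _ @^-1` _ = B)//.
      by apply/seteqP; split => t /= tB; [exact/set_mem|exact/mem_set].
    rewrite setTI; set E := (X in measurable_fun X).
    have nE t : E t -> ~ N t.
      by rewrite /E /= => tB /NB; apply: contraFnot tB => tB; exact/mem_set.
    apply: (@emeasurable_fun_cvg _ _ _ _ (fun k t => (nrm (simple_eval (simple_cutf D (u n)) t -
       simple_eval (simple_cutf D (u k)) t))%:E)).
      move=> k; apply/measurable_EFinP.
      rewrite [X in measurable_fun _ X](_ : _ = fun t => nrm (0 + simple_eval (simple_cutf D (u n) ++
         [seq (p.1, - p.2) | p <- simple_cutf D (u k)]) t)); last first.
        apply/funext => t; rewrite add0r simple_eval_cat; congr (nrm (_ + _)).
        by rewrite simple_evalN.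
      apply: measurable_funTS; apply: (@measurable_simple _ _ _ setT) => //.
      apply: simple_ok_cat; first exact: simple_ok_cutf.
      by apply: (@simple_ok_map _ _ _ (fun x => - x)); exact: simple_ok_cutf.
    move=> t /nE nN; rewrite !simple_eval_cutf; apply: cvg_EFin; first exact: nearW.
    apply/cvgrPdist_le => d d0.
    have : \forall k \near \oo, nrm (cutf D (simple_eval (u k)) t - cutf D g t) <= d.
      case: (pselect (D t)) => Dt.
        have [k0 _ hk0] := proj1 (cvg_nrmP _ _) (cvgu t Dt nN) d d0.
        by exists k0 => // k /hk0; rewrite /cutf asboolT.
      by apply: nearW => k; rewrite /cutf asboolF// subrr nrm0 ltW.
    case=> k0 _ hk0; exists k0 => // k /hk0; apply: le_trans; rewrite /h/= simple_eval_cutf.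
    move: (cutf _ _ _) (cutf _ _ _) (cutf _ _ _) => a b c.
    rewrite ler_norml; have := nrmB_tri a c b; have := nrmB_tri b c a; rewrite (nrmBC b a); lra.
  exists m; split => //.
    move=> t; rewrite /m; case: ifP => // _; exact: leey.
  rewrite (@ge0_negligible_integral _ _ _ mu _ B)//; last first.
    by move=> t _; rewrite /m; case: ifP => // _; rewrite lee_fin nrm_ge0.
  apply: le_trans (hn1 n _); last exact: leq_maxr.
  rewrite integral_mkcond [leRHS]integral_mkcond restrict_nrm_cutf.
  apply: ge0_le_integral_any => t.
    by rewrite patchE; case: ifP => // _; rewrite /m; case: ifP => //; rewrite lee_fin nrm_ge0.
  rewrite patchE; case: ifP => [|_]; last by rewrite lee_fin nrm_ge0.
  by move=> /set_mem[_ /= nB]; rewrite /m memNset// /h cutfB.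
by rewrite simple_int_cutf; apply: hn0; rewrite /= leq_maxl.
Qed.

(** With errors 2^-(k+1) the sum of the majorants has integral at most 1, so it is finite a.e.;
    wherever it is finite its terms tend to 0, which is the a.e. convergence. *)
Lemma bint_bochner D g I : measurable D -> bint (cutf D g) I -> is_bochner_int D g I.
Proof.
move=> mD bg; pose e (k : nat) : R := 1 / (2 ^ (k + 1))%:R.
have e0 k : 0 < e k by rewrite divr_gt0// ltr0n expn_gt0.
have /choice[u hu] : forall k, exists sm : seq (set R * X) * (R -> \bar R), [/\ simple_ok setT sm.1,
    [/\ measurable_fun setT sm.2, forall t, ((nrm (simple_eval sm.1 t - cutf D g t))%:E <= sm.2 t)%E &
     (\int[mu]_t sm.2 t <= (e k)%:E)%E] & nrm (simple_int setT sm.1 - I) <= e k].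
  by move=> k; have [s [os [m hm] ns]] := bg _ (e0 k); exists (s, m).
have m0 k t : (0 <= (u k).2 t)%E.
  by have [_ [_ h _] _] := hu k; apply: le_trans (h t); rewrite lee_fin nrm_ge0.
have mm k : measurable_fun setT (u k).2 by have [_ [] ] := hu k.
have e_cvg : e @ \oo --> (0 : R).
  have := @cvg_geometric R 2^-1 2^-1; rewrite ger0_norm ?invr_ge0// => h.
  rewrite (_ : e = geometric 2^-1 2^-1); first by apply: h; rewrite invf_lt1 ?ltr1n.
  by apply/funext => k; rewrite /e /= addn1 natrX exprS exprVn -invfM div1r.
have sum_fin : (\int[mu]_t (\sum_(k <oo) (u k).2 t) < +oo)%E.
  rewrite integral_nneseries//.
  apply: (@le_lt_trans _ _ (\sum_(k <oo) (e k)%:E)%E).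
    apply: lee_nneseries => k _; first by move=> _; apply: integral_ge0.
    by have [_ [] ] := hu k.
  rewrite (cvg_lim _ (@cvg_geometric_eseries_half R 1 0))//; by rewrite ltey.
pose s k := simple_cutf D (u k).1.
have os k : simple_ok setT (s k).
  by apply: simple_ok_cutf => //; apply: simple_okS => //; case: (hu k).
have es k t : nrm (simple_eval (s k) t - cutf D g t) <= nrm (simple_eval (u k).1 t - cutf D g t).
  rewrite /s simple_eval_cutf /cutf; case: ifP => // _; by rewrite subrr nrm0 nrm_ge0.
split => //; exists s; split; first by move=> k; exact: simple_okS.
split; [|split].
- have Sint : mu.-integrable setT (fun t => \sum_(k <oo) (u k).2 t)%E.
    apply/integrableP; split; first exact: (@ge0_emeasurable_sum _ _ R setT (fun k => (u k).2) xpredT (fun k t _ _ => m0 k t) (fun k _ => mm k)).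
    by under eq_integral do (rewrite gee0_abs; last exact: nneseries_ge0).
  exists (~` [set t | setT t -> (\sum_(k <oo) (u k).2 t)%E \is a fin_num]); split.
    exact: integrable_ae Sint.
  move=> t Dt /contrapT /(_ Logic.I) /= St; apply/cvg_nrmP => d d0.
  have tail : \forall x \near (0 : \bar R)%E, (x < d%:E)%E by apply: open_ereal_lt'; rewrite lte_fin.
  have foo : (\sum_(0 <= k <oo) (u k).2 t < +oo)%E by rewrite ltey_eq St.
  (* The k-th term is bounded by the tail of the series from k on, which tends to 0. *)
  have [k0 _ hk0] := @nneseries_tail_cvg _ (fun k => (u k).2 t) xpredT foo (fun k _ => m0 k t) _ tail.
  exists k0 => // k k0k; have -> : g t = cutf D g t by rewrite /cutf asboolT.
  apply: le_trans (es k t) _; rewrite -lee_fin; apply: le_trans (ltW (hk0 k k0k)).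
  have [_ [_ h _] _] := hu k; apply: le_trans (h t) _.
  apply: le_trans (nneseries_lim_ge k.+1 _) => //; by rewrite big_nat1.
- have ic k : (\int[mu]_(t in D) (nrm (simple_eval (s k) t - g t))%:E <= (e k)%:E)%E.
    have [_ [_ h hi] _] := hu k; apply: le_trans hi.
    rewrite integral_mkcond restrict_nrm_cutf; apply: ge0_le_integral_any => t.
      by rewrite lee_fin nrm_ge0.
    apply: le_trans (h t); rewrite lee_fin; apply: le_trans (es k t).
    by rewrite /s simple_eval_cutf /cutf; case: `[< D t >]; rewrite ?subrr ?nrm0.
  apply: (@squeeze_cvge _ _ _ _ (fun=> 0%E) _ (fun k => (e k)%:E)).
  + by apply: nearW => k; rewrite ic integral_ge0// => t _; rewrite lee_fin nrm_ge0.
  + exact: cvg_cst.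
  + by apply: cvg_EFin; [exact: nearW|exact: e_cvg].
- apply/cvg_nrmP => d d0.
  have [k0 _ hk0] : \forall k \near \oo, e k <= d.
    by move/cvgrPdist_le : e_cvg => /(_ _ d0); apply: filterS => k; rewrite sub0r normrN ger0_norm// ltW.
  exists k0 => // k /hk0 ed; apply: le_trans ed.
  have -> : simple_int D (s k) = simple_int setT (s k).
    rewrite /simple_int /s !big_map; apply: eq_bigr => p _ /=.
    by rewrite -setIA setIid setIT.
  apply: bint_nrm (bintB (bint_simple (os k)) bg) _.
  have [_ hm _] := hu k; apply: uint_leW (es k) (lexx _) _.
  by exists (u k).2.
Qed.

(** Uniqueness of the value makes the choice hidden in [xget] immaterial. *)
Lemma bochner_intE D g I : measurable D -> bint (cutf D g) I -> bochner_int D g = I.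
Proof.
move=> mD bg; rewrite /bochner_int; case: xgetP => [J _ /bochner_bint bJ|].
  exact: bint_unique bJ bg.
by move=> /(_ I) /(_ (bint_bochner mD bg)).
Qed.

End bochner.

(** * Calculus for vector-valued functions *)

Section derivative.
Context {R : realType} {X : normedModType R[i]^o}.
Implicit Types (G g : R -> X) (a b s x y : R).

(* Connectedness of [a, b]: local estimates propagate to the whole interval. *)
Lemma real_ind (P : R -> Prop) a b : a <= b -> P a ->
  (forall x, a <= x <= b -> exists2 d, 0 < d & forall y z, a <= y -> x - d < y -> y <= x -> x <= z ->
     z < x + d -> z <= b -> P y -> P z) -> P b.
Proof.
move=> ab Pa h; pose S := [set x | a <= x <= b /\ P x].
have Sa : S a by rewrite /S /= lexx.
have hS : has_sup S by split; [exists a|exists b => x [/andP[]]].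
have as_ : a <= sup S by exact: sup_upper_bound.
have sb : sup S <= b by apply: sup_le_ub => [|x [/andP[]]//]; exists a.
have [|d d0 hd] := h (sup S); first by rewrite as_.
have [y [/andP[ay yb] Py] yd] := sup_adherent d0 hS.
have ys : y <= sup S by apply: sup_upper_bound => //; rewrite /S /= ay yb.
(* A point of [S] close below [sup S] hands [P] to [z]; as [z] cannot exceed [sup S], it must be
   [b]. *)
pose z := Num.min b (sup S + d / 2).
have d2 : 0 < d / 2 by rewrite divr_gt0.
have Pz : P z.
  apply: hd Py => //; rewrite /z ?le_min ?gt_min ?sb ?ge_min ?lexx//=.
    by rewrite lerDl ltW.
  by rewrite ltrD2l ltr_pdivrMr// ltr_pMr// ltr1n orbT.
have : z <= sup S.
  apply: sup_upper_bound => //; split=> //; rewrite /z le_min ab/= ge_min lexx/= andbT.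
  by rewrite (le_trans as_)// lerDl ltW.
rewrite /z ge_min => /orP[bs|]; last by rewrite gerDl leNgt d2.
suff <- : z = b by [].
by rewrite /z; apply: min_idPl; rewrite (le_trans bs)// lerDl ltW.
Qed.

Lemma nbhs_realP (P : set R) x : nbhs x P <-> exists2 d, 0 < d & forall y, `|y - x| <= d -> P y.
Proof.
split=> [/nbhs_ballP[d /= d0 h]|[d d0 h]].
  exists (d / 2) => [|y yd]; first by rewrite divr_gt0.
  apply: h; rewrite /ball/= distrC (le_lt_trans yd)// ltr_pdivrMr// ltr_pMr// ltr1n//.
by apply/nbhs_ballP; exists d => //= y; rewrite /ball/= distrC => /ltW /h.
Qed.

Lemma contP g x : {for x, continuous g} <->
  forall e, 0 < e -> exists2 d, 0 < d & forall y, `|y - x| <= d -> nrm (g y - g x) <= e.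
Proof.
split=> [/cvg_nrmP h e /h /nbhs_realP//|h].
by apply/cvg_nrmP => e /h ?; apply/nbhs_realP.
Qed.

(** First-order expansion: it avoids the quotient and includes the point [y = s]. *)
Lemma has_rderivP G s v : has_rderiv G s v <-> forall e, 0 < e -> exists2 d, 0 < d &
  forall y, `|y - s| <= d -> nrm (G y - G s - (y - s)%:C *: v) <= e * `|y - s|.
Proof.
have E h : h != 0 -> nrm (G (s + h) - G s - h%:C *: v) =
    `|h| * nrm ((h^-1)%:C *: (G (s + h) - G s) - v).
  move=> h0; rewrite -nrmZR scalerBr scalerA -rmorphM divff// rmorph1 scale1r//.
split=> [/cvg_nrmP h e e0|h].
  have /nbhs_ballP[d /= d0 hd] := h e e0.
  exists (d / 2) => [|y yd]; first by rewrite divr_gt0.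
  have [->|ys] := eqVneq y s; first by rewrite !subrr scale0r subrr nrm0 normr0 mulr0.
  have := E (y - s); rewrite subr_eq0 ys (addrC s) subrK => -> //.
  rewrite mulrC ler_wpM2r//; have /= := hd (y - s); rewrite (addrC s) subrK; apply.
    by rewrite /ball/= sub0r normrN (le_lt_trans yd)// ltr_pdivrMr// ltr_pMr// ltr1n.
  by rewrite subr_eq0.
apply/cvg_nrmP => e /h [d d0 hd].
apply/nbhs_ballP; exists d => //= y; rewrite /ball/= sub0r normrN => yd y0.
have := hd (s + y); rewrite addrAC subrr add0r => /(_ (ltW yd)).
by rewrite E// mulrC ler_pM2r// normr_gt0.
Qed.

Lemma rderiv_cont G s v : has_rderiv G s v -> {for s, continuous G}.
Proof.
move=> /has_rderivP /(_ _ ltr01)[d d0 hd]; apply/contP => e e0.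
have v1 : 0 < 1 + nrm v by rewrite ltr_pwDl// nrm_ge0.
exists (Num.min d (e / (1 + nrm v))); first by rewrite lt_min d0 divr_gt0.
move=> y; rewrite le_min => /andP[/hd h ye].
rewrite -(subrK ((y - s)%:C *: v) (G y - G s)); apply: le_trans (nrmD _ _) _.
apply: le_trans (lerD h (lexx _)) _; rewrite nrmZR -(mulrC (nrm v)) -mulrDl.
by rewrite mulrC -ler_pdivlMr.
Qed.

Lemma rderivD G1 G2 s v1 v2 : has_rderiv G1 s v1 -> has_rderiv G2 s v2 ->
  has_rderiv (fun x => G1 x + G2 x) s (v1 + v2).
Proof.
move=> h1 h2; rewrite /has_rderiv (_ : (fun h => _) = (fun h => (h^-1)%:C *: (G1 (s + h) - G1 s)) \+
   (fun h => (h^-1)%:C *: (G2 (s + h) - G2 s))); first exact: cvgD.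
by apply/funext => h /=; rewrite -scalerDr opprD addrACA.
Qed.

Lemma rderiv_cst (v : X) s : has_rderiv (fun=> v) s 0.
Proof.
rewrite /has_rderiv (_ : (fun h => _) = fun=> 0); first exact: cvg_cst.
by apply/funext => h; rewrite subrr scaler0.
Qed.

Lemma rderivN G s v : has_rderiv G s v -> has_rderiv (fun x => - G x) s (- v).
Proof.
move=> h; rewrite /has_rderiv (_ : (fun h => _) = -%R \o (fun h => (h^-1)%:C *: (G (s + h) - G s))).
  by apply: (cvgN h).
by apply/funext => k /=; rewrite -scalerN opprB opprK addrC.
Qed.

Lemma rderivB G1 G2 s v1 v2 : has_rderiv G1 s v1 -> has_rderiv G2 s v2 ->
  has_rderiv (fun x => G1 x - G2 x) s (v1 - v2).
Proof. by move=> h1 /rderivN; exact: rderivD. Qed.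

Lemma rderivZ (c : R -> R[i]^o) c' G s v : has_rderiv c s c' -> has_rderiv G s v ->
  has_rderiv (fun x => c x *: G x) s (c' *: G s + c s *: v).
Proof.
move=> hc hG; rewrite /has_rderiv (_ : (fun h => _) =
   (fun h => ((h^-1)%:C *: (c (s + h) - c s)) *: G (s + h)) \+
   (fun h => c s *: ((h^-1)%:C *: (G (s + h) - G s)))).
  apply: cvgD; last exact: cvgZl_tmp.
  apply: cvgZ; first exact: hc.
  have /contP hG' := rderiv_cont hG; apply/cvg_nrmP => e /hG'[d d0 hd].
  apply/nbhs_ballP; exists d => //= y; rewrite /ball/= sub0r normrN => yd y0.
  by apply: hd; rewrite addrAC subrr add0r ltW.
apply/funext => h /=; rewrite scalerA mulrC -!scalerA -scalerDr; congr (_ *: _).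
by rewrite scalerBr scalerBl addrA subrK.
Qed.

Lemma rderiv_shift G v h s : has_rderiv G (s + h) v -> has_rderiv (fun x => G (x + h)) s v.
Proof.
move=> /has_rderivP H; apply/has_rderivP => e /H[d d0 hd]; exists d => // y yd.
by have := hd (y + h); rewrite (_ : y + h - (s + h) = y - s); [apply|ring].
Qed.

Lemma continuous_shift_add g h : continuous g -> continuous (fun s => g (s + h)).
Proof.
move=> cg s; apply/contP => e e0; have [d d0 hd] := proj1 (contP _ _) (cg (s + h)) e e0.
by exists d => // y yd; apply: hd; rewrite (_ : y + h - (s + h) = y - s)//; ring.
Qed.

End derivative.

(** * Mean value inequality and gluing of local approximations *)

Section mean_value.
Context {R : realType} {X : normedModType R[i]^o}.
Implicit Types (G D g : R -> X) (a b s x y z : R).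

(** Vector-valued functions have no intermediate point, so the estimate with the slightly larger
    slope [K + k] is propagated from [a] by [real_ind]; the total excess is [e]. *)
Lemma mvt_le G D a b K : a <= b -> (forall s, a <= s <= b -> has_rderiv G s (D s)) ->
  (forall s, a <= s <= b -> nrm (D s) <= K) -> nrm (G b - G a) <= K * (b - a).
Proof.
move=> ab dG DK; have K0 : 0 <= K by apply: le_trans (nrm_ge0 _) (DK a _); rewrite lexx.
have [->|ab'] := eqVneq a b; first by rewrite !subrr nrm0 mulr0.
have ba0 : 0 < b - a by rewrite subr_gt0 lt_neqAle ab'.
apply/ler_addgt0Pr => e e0; set k := e / (b - a).
have k0 : 0 < k by rewrite divr_gt0.
rewrite -[e](divfK (lt0r_neq0 ba0)) -/k -mulrDl.
apply: (@real_ind _ (fun x => nrm (G x - G a) <= (K + k) * (x - a)) a b ab).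
  by rewrite !subrr nrm0 mulr0.
move=> x xab; have [d d0 hd] := proj1 (has_rderivP _ _ _) (dG x xab) k k0.
have est y : `|y - x| <= d -> nrm (G y - G x) <= (K + k) * `|y - x|.
  move=> /hd h; rewrite -(subrK ((y - x)%:C *: D x) (G y - G x)).
  apply: le_trans (nrmD _ _) _; rewrite addrC mulrDl lerD//.
  by rewrite nrmZR mulrC ler_wpM2r// DK.
exists d => // y z ay dy yx xz zd zb hy.
have h1 : nrm (G z - G x) <= (K + k) * (z - x).
  by have := est z; rewrite ger0_norm ?subr_ge0//; apply; lra.
have h2 : nrm (G x - G y) <= (K + k) * (x - y).
  by have := est y; rewrite distrC nrmBC ger0_norm ?subr_ge0//; apply; lra.
have h3 := nrmB_tri (G y) (G z) (G a); have h4 := nrmB_tri (G x) (G z) (G y).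
have -> : (K + k) * (z - a) = (K + k) * (z - x) + (K + k) * (x - y) + (K + k) * (y - a) by ring.
lra.
Qed.

Lemma rderiv0_cst G a b : a <= b -> (forall s, a <= s <= b -> has_rderiv G s 0) -> G b = G a.
Proof.
move=> ab dG; apply/eqP; rewrite -subr_eq0; apply/eqP/nrm_le0.
by rewrite (le_trans (mvt_le (D := fun=> 0) (K := 0) ab dG _))// ?mul0r// => s _; rewrite nrm0.
Qed.

Lemma rderiv_inj G1 G2 D a b : a <= b -> (forall s, a <= s <= b -> has_rderiv G1 s (D s)) ->
  (forall s, a <= s <= b -> has_rderiv G2 s (D s)) -> G1 b - G1 a = G2 b - G2 a.
Proof.
move=> ab h1 h2; have := @rderiv0_cst (fun x => G1 x - G2 x) a b ab.
move=> h; apply/eqP; rewrite subr_eq addrAC -subr_eq opprK; apply/eqP.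
have -> : G1 b = G1 b - G2 b + G2 b by rewrite subrK.
rewrite h; last by move=> s sab; rewrite -(subrr (D s)); apply: rderivB; [exact: h1|exact: h2].
by rewrite addrAC subrK addrC.
Qed.

Lemma cutf_itv a b g t : cutf `[a, b[%classic g t = if a <= t < b then g t else 0.
Proof.
rewrite /cutf; case: ifP => /asboolP; first by rewrite /= in_itv/= => ->.
by rewrite /= in_itv/= => /negP/negbTE ->.
Qed.

Lemma cutf_ray b g t : cutf `]-oo, b[%classic g t = if t < b then g t else 0.
Proof.
rewrite /cutf; case: ifP => /asboolP; first by rewrite /= in_itv/= => ->.
by rewrite /= in_itv/= => /negP/negbTE ->.
Qed.

(** Replaces compactness and partitions: [Q] is a class closed under sums (integrable functions, or
    those satisfying Riemann-Lebesgue), and [m] is the weight relative to which the error is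
    measured. *)
Lemma loc_approx (Q : (R -> X) -> Prop) G (m : R -> R) a b e : a <= b -> (forall t, 0 <= m t) -> 0 <= e ->
  Q (fun=> 0) -> (forall g h, Q g -> Q h -> Q (fun t => g t + h t)) ->
  (forall x, a <= x <= b -> exists2 d, 0 < d & exists2 g,
     (forall y z, y <= z -> Q (cutf `[y, z[%classic g)) &
     forall t, a <= t < b -> `|t - x| <= d -> nrm (g t - G t) <= e * m t) ->
  exists2 g, Q g & forall t, nrm (g t - cutf `[a, b[%classic G t) <= e * m t.
Proof.
move=> ab m0 e0 Q0 QD hl.
(* Vanishing to the right of the current endpoint is added to the induction, so that the next piece
   can simply be summed. *)
suff [g [? ? ?]] : exists g, [/\ Q g, forall t, b <= t -> g t = 0 &
    forall t, nrm (g t - cutf `[a, b[%classic G t) <= e * m t] by exists g.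
apply: (@real_ind _ (fun x => exists g, [/\ Q g, forall t, x <= t -> g t = 0 & forall t,
  nrm (g t - cutf `[a, x[%classic G t) <= e * m t]) a b ab).
  exists (fun=> 0); split=> // t; rewrite cutf_itv; case: ifP => [/andP[at_ /(le_lt_trans at_)]|_].
    by rewrite ltxx.
  by rewrite subrr nrm0 mulr_ge0.
move=> x xab; have [d d0 [g hQ hg]] := hl x xab.
exists d => // y z ay dy yx xz zd zb [g' [Qg' g'0 hg']].
have yz : y <= z := le_trans yx xz.
exists (fun t => g' t + cutf `[y, z[%classic g t); split.
- by apply: QD => //; apply: hQ; exact: le_trans xz.
- move=> t zt; rewrite g'0 ?(le_trans yz)// cutf_itv.
  by rewrite (ltNge t) zt andbF addr0.
move=> t; have := hg' t; rewrite !cutf_itv; case: (ltP t y) => ty.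
  by rewrite /= andbT addr0 (lt_le_trans ty yz) andbT.
rewrite andbF subr0 g'0// nrm0 => h'; rewrite /= add0r.
case: (ltP t z) => tz /=; last by rewrite andbF subr0 nrm0.
rewrite (le_trans ay ty)/=; apply: hg; first by rewrite (le_trans ay ty) (lt_le_trans tz).
rewrite ler_norml; lra.
Qed.

End mean_value.

(** * Integrability, primitives and the fundamental theorem *)

Section calculus.
Context {R : realType} {X : normedModType R[i]^o}.
Local Notation mu := (@lebesgue_measure R).
Implicit Types (G D g q : R -> X) (a b r s x y z : R) (I J : X).
Hypothesis cX : nrm_complete X.

Definition integrable_b g := exists I, bint g I.

Lemma integrable_b0 : integrable_b (fun=> 0).
Proof. by exists 0; exact: bint0. Qed.

Lemma integrable_bD g h : integrable_b g -> integrable_b h -> integrable_b (fun t => g t + h t).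
Proof. by move=> [I bI] [J bJ]; exists (I + J); exact: bintD. Qed.

Lemma integrable_b_approx g (m : R -> R) e0 : 0 <= e0 -> (forall t, 0 <= m t) -> uint_le m e0 ->
  (forall e, 0 < e -> exists2 h, integrable_b h & forall t, nrm (h t - g t) <= e * m t) ->
  integrable_b g.
Proof.
move=> e00 m0 um H; apply: bint_exists => // e epos.
have e1 : 0 < e0 + 1 by rewrite ltr_wpDl.
have [h [I bh] hh] := H _ (divr_gt0 epos e1).
exists h, I; split => //.
apply: uint_leW hh _ (uint_leZ _ m0 um); last by rewrite divr_ge0// ltW.
by rewrite -mulrA ler_piMr ?(ltW epos)// mulrC ler_pdivrMr// mul1r lerDl.
Qed.

Lemma integrable_b_cutf A g : measurable A -> integrable_b g -> integrable_b (cutf A g).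
Proof. by move=> mA [I bg]; exact: bint_cutf bg. Qed.

Lemma continuous_integrable g a b : a <= b -> continuous g -> integrable_b (cutf `[a, b[%classic g).
Proof.
move=> ab cg; pose m t : R := if `[< `[a, b[%classic t >] then 1 else 0.
have m0 t : 0 <= m t by rewrite /m; case: ifP.
apply: (@integrable_b_approx _ m (1 * (b - a))) => //; first by rewrite mul1r subr_ge0.
  exact: uint_le_itv.
move=> e e0; apply: loc_approx => //; first exact: ltW.
- exact: integrable_b0.
- exact: integrable_bD.
move=> x xab; have [d d0 hd] := proj1 (contP _ _) (cg x) e e0.
exists d => //; exists (fun=> g x).
  by move=> y z yz; eexists; exact: bint_cst_itv.
by move=> t tab /hd; rewrite nrmBC /m asboolT ?mulr1//= in_itv.
Qed.

(** Freezing [c] locally gives an error at most [e] times the norm of [g], whose upper integral is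
    finite. This is what gives meaning to psi F when F is only locally integrable. *)
Lemma scale_integrable (c : R -> R[i]^o) g a b : a <= b -> continuous c -> integrable_b g ->
  integrable_b (cutf `[a, b[%classic (fun t => c t *: g t)).
Proof.
move=> ab cc [I bg]; have [e1 e10 ue1] := bint_uint_le bg.
apply: (@integrable_b_approx _ (fun t => nrm (g t)) e1) => //; first by move=> t; exact: nrm_ge0.
move=> e e0; apply: loc_approx => //; first by move=> t; exact: nrm_ge0.
- exact: ltW.
- exact: integrable_b0.
- exact: integrable_bD.
move=> x xab; have [d d0 hd] := proj1 (contP _ _) (cc x) e e0.
exists d => //; exists (fun t => c x *: g t).
  by move=> y z yz; apply: integrable_b_cutf => //; eexists; exact: bintZ bg.
by move=> t tab /hd h; rewrite -scalerBl nrmZ ler_wpM2r ?nrm_ge0// nrmBC.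
Qed.

Definition bval g := xget 0 [set I | bint g I].

Lemma bvalE g I : bint g I -> bval g = I.
Proof. by move=> bg; apply: xget_unique => // J bJ; exact: bint_unique bJ bg. Qed.

Lemma bvalP g : integrable_b g -> bint g (bval g).
Proof. by move=> [I bg]; rewrite (bvalE bg). Qed.

(** Integrating from minus infinity avoids a base point: for compactly supported [q], the primitive
    is 0 to the left of the support and the full integral to its right. *)
Definition prim q x := bval (cutf `]-oo, x[%classic q).

Lemma prim_sub q x y : integrable_b q -> x <= y -> bint (cutf `[x, y[%classic q) (prim q y - prim q x).
Proof.
move=> iq xy; have h z : bint (cutf `]-oo, z[%classic q) (prim q z).
  by apply: bvalP; exact: integrable_b_cutf.
apply: bint_ext (bintB (h y) (h x)) => t; rewrite cutf_itv !cutf_ray.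
case: (ltP t x) => [tx|xt] /=; first by rewrite (lt_le_trans tx xy) subrr.
by rewrite subr0.
Qed.

Lemma bint_itv_near q I v x y e : x <= y -> 0 <= e -> bint (cutf `[x, y[%classic q) I ->
  (forall t, x <= t < y -> nrm (q t - v) <= e) -> nrm (I - (y - x)%:C *: v) <= e * (y - x).
Proof.
move=> xy e0 bq hv; apply: bint_nrm (bintB bq (bint_cst_itv v xy)) _.
apply: uint_leW (lexx _) (uint_le_itv xy e0) => t; rewrite !cutf_itv.
case: ifP => h; last by rewrite subrr nrm0; case: ifP.
by rewrite asboolT ?hv//= in_itv.
Qed.

Lemma prim_near q x y v (e : R) : integrable_b q -> 0 <= e ->
  (forall s, `|s - x| <= `|y - x| -> nrm (q s - v) <= e) ->
  nrm (prim q y - prim q x - (y - x)%:C *: v) <= e * `|y - x|.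
Proof.
move=> iq e0 hq; have [xy|/ltW yx] := leP x y.
  rewrite ger0_norm ?subr_ge0// in hq *; apply: bint_itv_near (prim_sub iq xy) _ => //.
  by move=> t /andP[xt ty]; apply: hq; rewrite ger0_norm ?subr_ge0//; lra.
rewrite distrC ger0_norm ?subr_ge0// in hq *.
have -> : prim q y - prim q x - (y - x)%:C *: v = - (prim q x - prim q y - (x - y)%:C *: v).
  by rewrite [RHS]opprB -[y - x]opprB rmorphN scaleNr opprK addrC opprB.
rewrite nrmN; apply: bint_itv_near yx e0 (prim_sub iq yx) _.
by move=> t /andP[xt ty]; apply: hq; rewrite distrC ger0_norm ?subr_ge0//; lra.
Qed.

Lemma prim_rderiv q x : integrable_b q -> {for x, continuous q} -> has_rderiv (prim q) x (q x).
Proof.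
move=> iq cq; apply/has_rderivP => e e0; have [d d0 hd] := proj1 (contP _ _) cq e e0.
exists d => // y yd; apply: prim_near => //; first exact: ltW.
by move=> s sx; apply: hd; exact: le_trans yd.
Qed.

Lemma ftc G D a b : a <= b -> (forall s, has_rderiv G s (D s)) -> continuous D ->
  bint (cutf `[a, b[%classic D) (G b - G a).
Proof.
(* The margin 1 keeps [q] equal to [D] around every point of [a, b], so [prim q] is differentiable
   at the endpoints too. *)
move=> ab dG cD; pose q := cutf `[a - 1, b + 1[%classic D.
have iq : integrable_b q by apply: continuous_integrable => //; lra.
have -> : G b - G a = prim q b - prim q a.
  apply: (@rderiv_inj _ _ _ _ D) => // s sab.
  have qs : forall y, `|y - s| <= 1/2 -> q y = D y.
    move=> y; rewrite ler_norml /q cutf_itv => ys; have -> // : a - 1 <= y < b + 1.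
    by apply/andP; split; lra.
  have <- : q s = D s by apply: qs; rewrite subrr normr0; lra.
  apply: prim_rderiv => //; apply/contP => e e0.
  have [d d0 hd] := proj1 (contP _ _) (cD s) e e0.
  exists (Num.min d (1/2)); first by rewrite lt_min d0; lra.
  move=> y; rewrite le_min => /andP[yd y1]; rewrite !qs ?hd//.
  by rewrite subrr normr0; lra.
apply: bint_ext (prim_sub iq ab) => t; rewrite /q !cutf_itv.
case: ifP => // h; have -> // : a - 1 <= t < b + 1.
by apply/andP; split; lra.
Qed.

(** Vanishing is required at distance exactly [r] as well, so such a function equals its cut to the
    half-open interval from -r to r. *)
Definition csupp (r : R) g := forall s, r <= `|s| -> g s = 0.

Lemma csupp_cutf r g : csupp r g -> cutf `[- r, r[%classic g = g.
Proof.
move=> h; apply/funext => t; rewrite cutf_itv; case: ifP => // /negbT/negP tr.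
rewrite h// leNgt ltr_norml; apply/negP => /andP[h1 h2]; apply: tr; by rewrite ltW.
Qed.

Lemma csuppW r r' g : r <= r' -> csupp r g -> csupp r' g.
Proof. by move=> rr h s rs; apply: h; exact: le_trans rs. Qed.

Lemma csupp_integrable r g : csupp r g -> continuous g -> integrable_b g.
Proof.
move=> sg cg; have h : csupp (`|r|) g by apply: csuppW sg; rewrite ler_norm.
by rewrite -(csupp_cutf h); apply: continuous_integrable => //; rewrite -subr_ge0 opprK addr_ge0.
Qed.

Lemma prim_le r q x : csupp r q -> x <= - r -> prim q x = 0.
Proof.
move=> sq xr; apply: bvalE; apply: bint_ext bint0 => t; rewrite cutf_ray; case: ifP => // tx.
by rewrite sq// -normrN (le_trans _ (ler_norm _))//; lra.
Qed.

Lemma prim_ge r q x : csupp r q -> r <= x -> prim q x = bval q.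
Proof.
move=> sq xr; rewrite /prim; congr bval; apply/funext => t; rewrite cutf_ray.
case: ltP => // xt; rewrite sq// (le_trans _ (ler_norm _))//; exact: le_trans xt.
Qed.

Lemma bval_prim r q P : csupp r q -> continuous q -> (forall s, has_rderiv P s (q s)) ->
  forall x y, x <= - r -> r <= y -> bint q (P y - P x).
Proof.
move=> sq cq dP x y xr ry; have iq := csupp_integrable sq cq.
have -> : P y - P x = bval q; last exact: bvalP.
case: (leP x y) => [xy|yx].
  rewrite -(prim_ge sq ry) -[RHS]subr0 -(prim_le sq xr).
  by apply: (@rderiv_inj _ _ _ _ q) => // s _; apply: prim_rderiv => //; exact: cq.
(* From r <= y < x <= -r the radius is negative, so [q] is identically 0. *)
have q0 s : q s = 0 by apply: sq; rewrite (le_trans _ (normr_ge0 s))//; lra.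
have -> : P x = P y.
  by apply: rderiv0_cst (ltW yx) _ => s _; rewrite -(q0 s).
rewrite subrr; apply/esym/bvalE; by apply: bint_ext bint0.
Qed.

(** Applied to a product, this is integration by parts without boundary terms. *)
Lemma ftc_csupp r G D : csupp r G -> csupp r D -> (forall s, has_rderiv G s (D s)) -> continuous D ->
  bint D 0.
Proof.
move=> sG sD dG cD; have h : r <= `|r| := ler_norm r.
have := bval_prim sD cD dG (x := - `|r|) (y := `|r|).
rewrite !sG ?normrN ?normr_id// subrr; apply => //; by rewrite lerN2.
Qed.

(** Translation invariance is read off primitives: the translate of [prim g] is a primitive of the
    translate of [g], with the same values far to the left and right. *)
Lemma bint_shift r g I h : csupp r g -> continuous g -> bint g I -> bint (fun s => g (s + h)) I.
Proof.
move=> sg cg bg; have ig := csupp_integrable sg cg.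
have [h1 h2] : - `|h| <= h /\ h <= `|h| by split; [rewrite lerNl -normrN ler_norm|exact: ler_norm].
have r1 := ler_norm r; pose R0 := `|r| + `|h|.
have sg' : csupp R0 (fun s => g (s + h)).
  move=> s sR; apply: sg; have := ler_normB (s + h) h; rewrite addrK /R0 in sR *; lra.
have cg' : continuous (fun s => g (s + h)) by exact: continuous_shift_add.
have dP s : has_rderiv (fun x => prim g (x + h)) s (g (s + h)).
  by apply: rderiv_shift; apply: prim_rderiv => //; exact: cg.
have := bval_prim sg' cg' dP (lexx _) (lexx _).
rewrite (@prim_le _ _ (- R0 + h) sg); last by rewrite /R0; lra.
by rewrite (prim_ge sg) ?subr0 ?(bvalE bg)//; rewrite /R0; lra.
Qed.

End calculus.

Ltac ceq := apply/eqP; rewrite eq_complex /=; apply/andP; split; apply/eqP; ring.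

(** * The kernel and its transform *)

Section exponential.
Context {R : realType}.
Implicit Types (x y s t a : R).

Definition cis x : R[i]^o := cos x +i* sin x.
Definition sinc x := if x == 0 then 1 else sin x / x.

Lemma cis0 : cis 0 = 1.
Proof. by rewrite /cis cos0 sin0. Qed.

Lemma cisD x y : cis (x + y) = cis x * cis y.
Proof.
by rewrite /cis cosD sinD; ceq.
Qed.

Lemma cabs_cis x : cabs (cis x) = 1.
Proof. by rewrite cabsE /= cos2Dsin2 sqrtr1. Qed.

Lemma cis_opp x : cis x - cis (- x) = (2 * sin x)%:C * 'i.
Proof.
by rewrite /cis cosN sinN; ceq.
Qed.

Lemma rderiv_real (p : R -> R) (dp s : R) : is_derive s 1 p dp ->
  has_rderiv (fun x => (p x)%:C : R[i]^o) s (dp%:C : R[i]^o).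
Proof.
move=> [dv <-]; apply/cvg_nrmP => e e0.
move/cvgrPdist_le : dv => /(_ e e0); apply: filterS => h.
rewrite distrC -cabsR; apply: le_trans; rewrite le_eqVlt; apply/orP; left; apply/eqP; congr nrm.
rewrite -/('D_1 p s) [RHS]rmorphB; congr (_ - _).
rewrite [X in (p \o shift s) X](_ : _ = h); last by rewrite /GRing.scale/= mulr1.
by rewrite /= (addrC s) -rmorphB [RHS]rmorphM.
Qed.

Lemma rderiv_cis x : has_rderiv cis x ('i * cis x).
Proof.
have -> : cis = fun x => (cos x)%:C + ('i : R[i]^o) *: ((sin x)%:C : R[i]^o).
  by apply/funext => y; rewrite /GRing.scale; ceq.
have := rderivD (rderiv_real (is_derive_cos x))
  (rderivZ (rderiv_cst ('i : R[i]^o) x) (rderiv_real (is_derive_sin x))).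
congr has_rderiv; rewrite scale0r add0r /GRing.scale; ceq.
Qed.

Lemma cis_lip x y : cabs (cis x - cis y) <= `|x - y|.
Proof.
wlog yx : x y / y <= x.
  by move=> h; have [/h //|/ltW /h] := leP y x; rewrite nrmBC distrC.
have := @mvt_le R R[i]^o cis (fun x => 'i * cis x) y x 1 yx (fun s _ => @rderiv_cis s).
rewrite mul1r ger0_norm ?subr_ge0//; apply=> s _.
by rewrite cabsM cabs_i cabs_cis mulr1.
Qed.

Lemma sinc0 : sinc 0 = 1.
Proof. by rewrite /sinc eqxx. Qed.

Lemma mul_sinc x : x * sinc x = sin x.
Proof. by rewrite /sinc; case: eqVneq => [->|x0]; rewrite ?mul0r ?sin0// mulrC divfK. Qed.

Lemma sin_cos_bounds x : 0 <= x -> `|sin x - x| <= x ^+ 2.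
Proof.
move=> x0.
have c1 s : 0 <= s <= x -> `|cos s - 1| <= x.
  move=> /andP[s0 sx]; have := cis_lip s 0; rewrite cis0 subr0 ger0_norm// => /le_trans/(_ sx).
  by apply: le_trans; have := cabs_Re (cis s - 1).
have := @mvt_le R R[i]^o (fun s => (sin s - s)%:C) (fun s => (cos s - 1)%:C) 0 x x x0.
rewrite sin0 !subr0 cabsR -expr2; apply.
  by move=> s _; apply: rderiv_real.
by move=> s /c1; rewrite cabsR.
Qed.

Lemma sin_le x : 0 <= x -> `|sin x| <= x.
Proof.
move=> x0; have := cis_lip x 0; rewrite cis0 subr0 ger0_norm//; apply: le_trans.
by have := cabs_Im (cis x - 1); rewrite /= subr0.
Qed.

Lemma sincN x : sinc (- x) = sinc x.
Proof. by rewrite /sinc oppr_eq0 sinN invrN mulrNN. Qed.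

Lemma sinc_abs x : sinc x = sinc `|x|.
Proof. by have [x0|x0] := leP 0 x; [rewrite ger0_norm|rewrite ltr0_norm// sincN]. Qed.

Lemma sinc_le1 x : `|sinc x| <= 1.
Proof.
rewrite sinc_abs; have := normr_ge0 x; move: `|x| => {}x x0.
rewrite /sinc; case: eqVneq => [_|xn0]; first by rewrite normr1.
rewrite normrM normfV (ger0_norm x0) ler_pdivrMr ?mul1r ?sin_le//.
by rewrite lt_neqAle eq_sym xn0.
Qed.

Lemma mul_sinc_le1 x : `|x * sinc x| <= 1.
Proof. by rewrite mul_sinc ler_norml sin_geN1 sin_le1. Qed.

Lemma sinc_ge x : 1 - `|x| <= sinc x.
Proof.
rewrite sinc_abs; have := normr_ge0 x; move: `|x| => {}x x0.
rewrite /sinc; case: eqVneq => [->|xn0]; first by rewrite subr0.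
rewrite ler_pdivlMr; last by rewrite lt_neqAle eq_sym xn0.
have := sin_cos_bounds x0; rewrite ler_norml expr2 => /andP[h _]; lra.
Qed.

End exponential.

(** * Averages of compactly supported functions *)

Section kernel.
Context {R : realType}.
Local Notation C := (R[i]^o).
Implicit Types (q : R -> C) (h r s x K rho : R) (n N : nat).
Let cC := @complex_nrm_complete R.

(** Convolution of [q] with the uniform density on [-h, h]; [dif] is its derivative. *)
Definition avg h q s : C := ((2 * h)^-1)%:C *: (prim q (s + h) - prim q (s - h)).
Definition dif h q s : C := ((2 * h)^-1)%:C *: (q (s + h) - q (s - h)).

Lemma rderivZc (X : normedModType C) (c : R[i]) (G : R -> X) v s : has_rderiv G s v ->
  has_rderiv (fun x => c *: G x) s (c *: v).
Proof. by move=> /(rderivZ (rderiv_cst (c : C) s)); rewrite scale0r add0r. Qed.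

Lemma rderiv_continuous (X : normedModType C) (G D : R -> X) : (forall s, has_rderiv G s (D s)) -> continuous G.
Proof. by move=> dG s; exact: rderiv_cont (dG s). Qed.

Lemma rderiv_dif h q (D : R -> C) : (forall s, has_rderiv q s (D s)) -> forall s, has_rderiv (dif h q) s (dif h D s).
Proof.
by move=> dq s; apply: rderivZc; apply: rderivB; apply: rderiv_shift.
Qed.

Lemma csupp_dif r h q : 0 <= h -> csupp r q -> csupp (r + h) (dif h q).
Proof.
move=> h0 sq s rs; rewrite /dif !sq ?subrr ?scaler0//.
  by have := ler_normB (s - h) (- h); rewrite opprK subrK normrN (ger0_norm h0); lra.
by have := ler_normB (s + h) h; rewrite addrK (ger0_norm h0); lra.
Qed.

Lemma continuous_dif h q : continuous q -> continuous (dif h q).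
Proof.
move=> cq s; apply: cvgZl_tmp; apply: cvgB; first exact: (continuous_shift_add (h := h) cq).
exact: (continuous_shift_add (h := - h) cq).
Qed.

Lemma nrm_dif h q K : 0 < h -> (forall s, cabs (q s) <= K) -> forall s, cabs (dif h q s) <= K / h.
Proof.
move=> h0 qK s; rewrite nrmZR ger0_norm; last by rewrite invr_ge0 mulr_ge0 ?ltW.
rewrite ler_pdivrMl ?mulr_gt0//; apply: le_trans (nrm_sub _ _) _.
have -> : 2 * h * (K / h) = K + K by field; rewrite gt_eqF.
exact: lerD.
Qed.

Section avg.
Variables (q : R -> C) (r h : R).
Hypotheses (h0 : 0 < h) (sq : csupp r q) (cq : continuous q).

Let iq : integrable_b q := csupp_integrable cC sq cq.

Lemma rderiv_avg s : has_rderiv (avg h q) s (dif h q s).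
Proof.
apply: rderivZc; apply: rderivB.
  by apply: (@rderiv_shift _ _ _ _ h); apply: prim_rderiv => //; exact: cq.
by apply: (@rderiv_shift _ _ _ _ (- h)); apply: prim_rderiv => //; exact: cq.
Qed.

Lemma csupp_avg : csupp (r + h) (avg h q).
Proof.
have hp := h0; move=> s rs; rewrite /avg; have [s0|s0] := leP 0 s.
  rewrite ger0_norm// in rs; have [a1 a2] : r <= s - h /\ r <= s + h by split; lra.
  by rewrite (prim_ge sq a1) (prim_ge sq a2) subrr scaler0.
rewrite ltr0_norm// in rs; have [a1 a2] : s - h <= - r /\ s + h <= - r by split; lra.
by rewrite (prim_le sq a1) (prim_le sq a2) subrr scaler0.
Qed.

Lemma nrm_avg K : (forall s, cabs (q s) <= K) -> forall s, cabs (avg h q s) <= K.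
Proof.
move=> qK s; rewrite nrmZR ger0_norm; last by rewrite invr_ge0 mulr_ge0 ?ltW.
rewrite ler_pdivrMl ?mulr_gt0//.
have := @mvt_le _ _ (prim q) q (s - h) (s + h) K.
rewrite (_ : s + h - (s - h) = 2 * h); last by ring.
have hp := h0; rewrite mulrC; apply => //; first lra.
by move=> x _; apply: prim_rderiv => //; exact: cq.
Qed.

Lemma csupp_scale (X : normedModType C) (G : R -> X) r' q' : csupp r' q' -> csupp r' (fun s => q' s *: G s).
Proof. by move=> h' s /h' ->; rewrite scale0r. Qed.

Lemma continuous_scale (X : normedModType C) (c : R -> C) (G : R -> X) :
  continuous c -> continuous G -> continuous (fun s => c s *: G s).
Proof. by move=> cc cG s; apply: cvgZ; [exact: cc|exact: cG]. Qed.

(* Averaging q amounts to averaging the function it is tested on. *)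
Lemma bint_avg (X : normedModType C) (E E1 : R -> X) : nrm_complete X -> (forall s, has_rderiv E s (E1 s)) -> continuous E1 ->
  exists I, bint (fun s => avg h q s *: E1 s) I /\
    bint (fun s => q s *: (((2 * h)^-1)%:C *: (E (s + h) - E (s - h)))) I.
Proof.
move=> cX dE cE1; have cE := rderiv_continuous dE.
pose g1 s := q s *: E (s - h); pose g2 s := q s *: E (s + h).
have sg1 : csupp r g1 by exact: csupp_scale.
have sg2 : csupp r g2 by exact: csupp_scale.
have cg1 : continuous g1 by exact: (@continuous_scale _ q (fun s => E (s - h)) cq (@continuous_shift_add _ _ E (- h) cE)).
have cg2 : continuous g2 by exact: (@continuous_scale _ q (fun s => E (s + h)) cq (@continuous_shift_add _ _ E h cE)).
have [J1 b1] := csupp_integrable cX sg1 cg1; have [J2 b2] := csupp_integrable cX sg2 cg2.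
have s1 := bint_shift cX h sg1 cg1 b1; have s2 := bint_shift cX (- h) sg2 cg2 b2.
have c1 := bintZ ((2 * h)^-1)%:C (bintB s1 s2).
exists (((2 * h)^-1)%:C *: (J2 - J1)); split; last first.
  apply: bint_ext (bintZ ((2 * h)^-1)%:C (bintB b2 b1)) => s /=.
  by rewrite /g1 /g2 -scalerBr scalerA mulrC -scalerA.
(* This is the derivative of [avg h q] times [E], so it integrates to 0; the term in [dif] consists
   of translates of [g1] and [g2]. *)
have sD : csupp (r + h) (fun s => dif h q s *: E s + avg h q s *: E1 s).
  by move=> s rs; rewrite (csupp_dif (ltW h0) sq rs) csupp_avg// !scale0r addr0.
have := @ftc_csupp _ _ cX (r + h) (fun s => avg h q s *: E s) _ _ sD.
have -> : ((2 * h)^-1)%:C *: (J2 - J1) = 0 - ((2 * h)^-1)%:C *: (J1 - J2).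
  by rewrite sub0r -scalerN opprB.
move=> H; apply: bint_ext (bintB (H _ _ _) c1) => [s||s|s] /=.
- by rewrite /g1 /g2 /dif addrK subrK -scalerBl scalerA addrAC subrr add0r.
- exact: csupp_scale csupp_avg.
- by apply: rderivZ => //; exact: rderiv_avg.
- apply: cvgD; first by apply: cvgZ; [exact: continuous_dif|exact: cE].
  by apply: cvgZ; [exact: (rderiv_continuous rderiv_avg)|exact: cE1].
Qed.

End avg.

End kernel.

Section spline.
Context {R : realType}.
Local Notation C := (R[i]^o).
Implicit Types (q E : R -> C) (phi : R -> R) (h r s x K rho : R) (n N : nat).
Let cC := @complex_nrm_complete R.

Lemma rderiv_comp_mul (X : normedModType C) (G : R -> X) v k s : has_rderiv G (s * k) v ->
  has_rderiv (fun x => G (x * k)) s (k%:C *: v).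
Proof.
move=> /has_rderivP H; apply/has_rderivP => e e0.
have k1 : 0 < `|k| + 1 by rewrite ltr_wpDl.
have [d d0 hd] := H _ (divr_gt0 e0 k1).
exists (d / (`|k| + 1)); first by rewrite divr_gt0.
move=> y; rewrite ler_pdivlMr// => yd; have := hd (y * k).
rewrite -mulrBl normrM scalerA -rmorphM => h.
apply: le_trans (h _) _.
  by apply: le_trans yd; rewrite ler_wpM2l// lerDl.
rewrite (_ : e / (`|k| + 1) * _ = e * `|y - s| * (`|k| / (`|k| + 1))); last by ring.
by rewrite ler_piMr ?mulr_ge0 ?(ltW e0)// ler_pdivrMr// mul1r lerDl.
Qed.

Lemma rderiv_cis_mul x s : has_rderiv (fun t => cis (t * x)) s ((x%:C * 'i) *: cis (s * x) : C).
Proof.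
have := rderiv_comp_mul (@rderiv_cis _ (s * x)).
by rewrite [(x%:C * 'i) *: _]/GRing.scale /= -mulrA.
Qed.

Lemma continuous_cis_mul x : continuous (fun t : R => cis (t * x)).
Proof. by move=> s; apply: rderiv_cont; exact: rderiv_cis_mul. Qed.

(** The Fourier transform as a relation; its values can be required to be real because the splines
    used are even. *)
Definition ft q phi := forall x, @bint R C (fun s => q s *: cis (s * x)) ((phi x)%:C : C).

Lemma rderiv_id s : has_rderiv (fun x => x%:C : C) s 1.
Proof. by apply: rderiv_real. Qed.

(** Take E(s) = e^(isx) in [bint_avg]: its difference quotient over 2h is i sin(hx)/h times E, and
    dividing by the factor ix of E' leaves sinc(hx). *)
Lemma ft_avg q phi r h : 0 < h -> csupp r q -> continuous q -> ft q phi ->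
  ft (avg h q) (fun x => sinc (h * x) * phi x).
Proof.
move=> h0 sq cq fq x; have h2 : 2 * h != 0 by rewrite gt_eqF// mulr_gt0.
(* At x = 0 one cannot divide by ix; E(s) = s is used instead. *)
have [->|x0] := eqVneq x 0.
  have [||I [b1 b2]] := @bint_avg _ q r h h0 sq cq C (fun s => s%:C) (fun=> 1) cC.
  - by move=> s; exact: rderiv_id.
  - by move=> s; exact: cvg_cst.
  rewrite mulr0 sinc0 mul1r; have <- : I = (phi 0)%:C.
    apply: bint_unique b2 _; apply: bint_ext (fq 0) => s; congr (_ *: _).
    rewrite mulr0 cis0 /GRing.scale; apply/eqP; rewrite eq_complex/=; apply/andP; split; apply/eqP.
      by field; rewrite gt_eqF.
    by ring.
  by apply: bint_ext b1 => s; rewrite mulr0 cis0.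
have [||I [b1 b2]] := @bint_avg _ q r h h0 sq cq C (fun s => cis (s * x))
   (fun s => (x%:C * 'i) *: cis (s * x)) cC.
- by move=> s; exact: rderiv_cis_mul.
- by move=> s; apply: cvgZl_tmp; exact: continuous_cis_mul.
have xi0 : x%:C * 'i != 0 :> R[i] by apply: mulf_neq0; rewrite eq_complex/= ?(negbTE x0)//= oner_eq0 andbF.
have EI : I = ((sin (h * x) / h)%:C * 'i) *: ((phi x)%:C : C).
  apply: bint_unique b2 _; apply: bint_ext (bintZ _ (fq x)) => s.
  rewrite scalerA mulrC -scalerA; congr (_ *: _).
  have [-> ->] : (s + h) * x = s * x + h * x /\ (s - h) * x = s * x + - (h * x) by split; ring.
  rewrite !cisD -mulrBr cis_opp /GRing.scale/= mulrCA mulrC; congr (_ * _).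
  rewrite mulrA -rmorphM; congr (_%:C * _).
  by field; rewrite gt_eqF.
apply: bint_ext (_ : bint (fun s => (x%:C * 'i)^-1 *: (avg h q s *: ((x%:C * 'i) *: cis (s * x)))) _).
  by move=> s; rewrite /GRing.scale/= mulrCA mulKf.
have -> : (sinc (h * x) * phi x)%:C = (x%:C * 'i)^-1 *: I; last exact: bintZ.
rewrite EI -mul_sinc /GRing.scale/=; apply: (mulfI xi0); rewrite mulVKf//.
apply/eqP; rewrite eq_complex/=; apply/andP; split; apply/eqP; first by ring.
by field; rewrite gt_eqF.
Qed.

End spline.

(** * The hat function and its smooth averages *)

Section hat.
Context {R : realType}.
Local Notation C := (R[i]^o).
Implicit Types (q : R -> C) (phi : R -> R) (h r s x K rho : R) (n N : nat).
Let cC := @complex_nrm_complete R.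

Definition hat rho s : C := (Num.max 0 (1 - `|s| / rho))%:C.

Lemma hat_csupp rho : 0 < rho -> csupp rho (hat rho).
Proof.
move=> r0 s rs; rewrite /hat; have -> : Num.max 0 (1 - `|s| / rho) = 0; last by [].
by apply: max_l; rewrite subr_le0 ler_pdivlMr// mul1r.
Qed.

Lemma hat_le1 rho s : 0 < rho -> cabs (hat rho s) <= 1.
Proof.
move=> r0; rewrite /hat cabsR ger0_norm ?le_max ?lexx// ge_max ler01/= gerBl divr_ge0// ltW//.
Qed.

Lemma continuous_real (p : R -> R) : continuous p -> continuous (fun s => (p s)%:C : C).
Proof.
move=> cp s; apply/contP => e e0.
have /cvgrPdist_le/(_ e e0)/nbhs_realP[d d0 hd] := cp s.
by exists d => // y /hd; rewrite -rmorphB cabsR distrC.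
Qed.

Lemma continuous_hat rho : continuous (hat rho).
Proof.
apply: continuous_real => s.
apply: (@continuous_max _ _ (fun=> 0) (fun s => 1 - `|s| / rho)); first exact: cvg_cst.
apply: cvgB; first exact: cvg_cst.
apply: cvgM; last exact: cvg_cst.
exact: norm_continuous.
Qed.

Lemma rderiv_affine (X : normedModType C) (G : R -> X) (v : X) (c d s : R) : has_rderiv G s v ->
  has_rderiv (fun x => (c + d * x)%:C *: G x) s (d%:C *: G s + (c + d * s)%:C *: v).
Proof.
move=> dG; apply: rderivZ => //; apply: rderiv_real.
by apply: is_derive_eq; rewrite add0r mul1r /GRing.scale/= mulr1.
Qed.

Lemma continuous_affine (c d : R) : continuous (fun s => (c + d * s)%:C : C).
Proof.
by apply: continuous_real => y; apply: cvgD; [exact: cvg_cst|apply: cvgM; [exact: cvg_cst|]].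
Qed.

(** The hat has a kink at 0, so each half is integrated by parts separately. The terms [K1 0] cancel
    and a second difference of [K0] remains. *)
Lemma bint_hat (X : normedModType C) (K0 K1 K2 : R -> X) rho : nrm_complete X -> 0 < rho ->
  (forall s, has_rderiv K0 s (K1 s)) -> (forall s, has_rderiv K1 s (K2 s)) -> continuous K2 ->
  bint (fun s => hat rho s *: K2 s) ((rho^-1)%:C *: (K0 rho - K0 0 - (K0 0 - K0 (- rho)))).
Proof.
move=> cX r0 d0 d1 c2.
have pos : bint (cutf `[0, rho[%classic (fun s => (1 + - rho^-1 * s)%:C *: K2 s))
   ((rho^-1)%:C *: K0 rho - (K1 0 + (rho^-1)%:C *: K0 0)).
  have := @ftc _ _ cX (fun s => (1 + - rho^-1 * s)%:C *: K1 s + (rho^-1)%:C *: K0 s)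
    (fun s => (1 + - rho^-1 * s)%:C *: K2 s) 0 rho (ltW r0).
  have -> : 1 + - rho^-1 * rho = 0 by rewrite mulNr mulVf ?gt_eqF// subrr.
  rewrite scale0r add0r mulr0 addr0 scale1r; apply.
    move=> s; rewrite (_ : _ *: K2 s = (- rho^-1)%:C *: K1 s + (1 + - rho^-1 * s)%:C *: K2 s + (rho^-1)%:C *: K1 s).
      apply: rderivD; first exact: rderiv_affine.
      exact: rderivZc.
    by rewrite addrAC -scalerDl -rmorphD addNr scale0r add0r.
  by move=> s; apply: cvgZ; [exact: continuous_affine|exact: c2].
have neg : bint (cutf `[- rho, 0[%classic (fun s => (1 + rho^-1 * s)%:C *: K2 s))
   (K1 0 + (- rho^-1)%:C *: K0 0 - (- rho^-1)%:C *: K0 (- rho)).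
  have := @ftc _ _ cX (fun s => (1 + rho^-1 * s)%:C *: K1 s + (- rho^-1)%:C *: K0 s)
    (fun s => (1 + rho^-1 * s)%:C *: K2 s) (- rho) 0.
  have -> : 1 + rho^-1 * - rho = 0 by rewrite mulrN mulVf ?gt_eqF// subrr.
  rewrite scale0r add0r mulr0 addr0 scale1r; apply; first by rewrite oppr_le0 ltW.
    move=> s; rewrite (_ : _ *: K2 s = (rho^-1)%:C *: K1 s + (1 + rho^-1 * s)%:C *: K2 s + (- rho^-1)%:C *: K1 s).
      apply: rderivD; first exact: rderiv_affine.
      exact: rderivZc.
    by rewrite addrAC -scalerDl -rmorphD subrr scale0r add0r.
  by move=> s; apply: cvgZ; [exact: continuous_affine|exact: c2].
have -> : (rho^-1)%:C *: (K0 rho - K0 0 - (K0 0 - K0 (- rho))) =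
  (rho^-1)%:C *: K0 rho - (K1 0 + (rho^-1)%:C *: K0 0) +
  (K1 0 + (- rho^-1)%:C *: K0 0 - (- rho^-1)%:C *: K0 (- rho)).
  rewrite rmorphN !scaleNr opprK !scalerBr opprB opprD !addrA.
  by rewrite [RHS](addrAC _ _ (_ *: K0 (- rho))) (addrAC _ _ (K1 0)) subrK (addrAC _ (_ *: K0 (- rho))).
apply: bint_ext (bintD pos neg) => s; rewrite !cutf_itv /hat.
have [s0|s0] := leP 0 s.
  rewrite /= andbF addr0 ger0_norm//; case: ltP => sr /=.
    rewrite max_r; first by congr (_%:C *: _); rewrite mulNr mulrC.
    by rewrite subr_ge0 ler_pdivrMr// mul1r ltW.
  by rewrite max_l ?scale0r// subr_le0 ler_pdivlMr// mul1r.
rewrite /= add0r andbT ltr0_norm//; case: leP => sr.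
  rewrite max_r; first by congr (_%:C *: _); rewrite mulNr opprK mulrC.
  by rewrite subr_ge0 ler_pdivrMr// mul1r lerNl.
by rewrite max_l ?scale0r// subr_le0 ler_pdivlMr// mul1r lerNr ltW.
Qed.

End hat.

Section kernel_exists.
Context {R : realType}.
Local Notation C := (R[i]^o).
Implicit Types (q : R -> C) (phi : R -> R) (h r s x K rho : R) (n N : nat).
Let cC := @complex_nrm_complete R.

(** The second difference of e^(isx) is 2 cos(rho x) - 2 = -4 sin(rho x / 2)^2, to be divided by
    (ix)^2; at x = 0 the function s^2/2 takes the place of the exponential. *)
Lemma ft_hat rho : 0 < rho -> ft (hat rho) (fun x => rho * sinc (rho / 2 * x) ^+ 2).
Proof.
move=> r0 x; have [->|x0] := eqVneq x 0.
  have := @bint_hat _ C (fun s => (s ^+ 2 / 2)%:C) (fun s => s%:C) (fun=> 1) rho cC r0.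
  rewrite mulr0 sinc0 expr1n mulr1 => H.
  apply: bint_ext (_ : @bint R C (fun s => hat rho s *: (1 : C)) _).
    by move=> s; rewrite mulr0 cis0.
  have -> : rho%:C = (rho^-1)%:C *: ((rho ^+ 2 / 2)%:C - (0 ^+ 2 / 2)%:C - ((0 ^+ 2 / 2)%:C - ((- rho) ^+ 2 / 2)%:C)) :> C.
    by rewrite /GRing.scale; apply/eqP; rewrite eq_complex/=; apply/andP; split; apply/eqP; field; rewrite gt_eqF.
  apply: H.
  - move=> s; apply: rderiv_real; apply: is_derive_eq; rewrite /GRing.scale/=; by field.
  - by move=> s; exact: rderiv_id.
  - by move=> s; exact: cvg_cst.
have xi0 : x%:C * 'i != 0 :> R[i] by apply: mulf_neq0; rewrite eq_complex/= ?(negbTE x0)//= oner_eq0 andbF.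
have H := @bint_hat _ C (fun s => cis (s * x)) (fun s => (x%:C * 'i) *: cis (s * x))
  (fun s => (x%:C * 'i) *: ((x%:C * 'i) *: cis (s * x))) rho cC r0.
have {}H : @bint R C (fun s => hat rho s *: ((x%:C * 'i) *: ((x%:C * 'i) *: cis (s * x))))
   ((rho^-1)%:C *: (cis (rho * x) - cis (0 * x) - (cis (0 * x) - cis (- rho * x)))).
  apply: H.
  - by move=> s; exact: rderiv_cis_mul.
  - by move=> s; apply: rderivZc; exact: rderiv_cis_mul.
  - by move=> s; do 2 apply: cvgZl_tmp; exact: continuous_cis_mul.
have := bintZ ((x%:C * 'i) ^- 2) H; congr bint.
  apply/funext => s; rewrite /GRing.scale/=.
  by rewrite mulrCA; congr (_ * _); rewrite mulrA -expr2 mulKf// expf_neq0.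
have E : rho * x = rho / 2 * x + rho / 2 * x by field.
have Es : sin (rho / 2 * x) ^+ 2 = (rho / 2 * x * sinc (rho / 2 * x)) ^+ 2 by rewrite mul_sinc.
have Ec : cos (rho * x) = 1 - 2 * sin (rho / 2 * x) ^+ 2.
  rewrite E cosD -!expr2; have := cos2Dsin2 (rho / 2 * x); lra.
have -> : cis (rho * x) - cis (0 * x) - (cis (0 * x) - cis (- rho * x)) = (- (4 * sin (rho / 2 * x) ^+ 2))%:C.
  rewrite mul0r cis0 mulNr /cis cosN sinN Ec; ceq.
have x2 : (x%:C * 'i) ^+ 2 = (- x ^+ 2)%:C :> R[i].
  by rewrite expr2; ceq.
rewrite x2 /GRing.scale/=; apply: (@mulfI _ ((- x ^+ 2)%:C : R[i])).
  by rewrite -x2 expf_neq0.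
rewrite mulVKf; last by rewrite -x2 expf_neq0.
rewrite Es; apply/eqP; rewrite eq_complex/=; apply/andP; split; apply/eqP; last by ring.
by field; rewrite gt_eqF.
Qed.

(** [p] lists the derivatives of [q]: class C^n, support in [-r, r], and one factor 1/h per
    derivative. *)
Definition has_spline n r h q := exists p : nat -> R -> C,
  [/\ p 0%N = q, forall j, (j < n)%N -> forall s, has_rderiv (p j) s (p j.+1 s) &
   forall j, (j <= n)%N -> [/\ continuous (p j), csupp r (p j) & forall s, cabs (p j s) <= h^-1 ^+ j]].

Lemma spline_hat rho h : 0 < rho -> has_spline 0 rho h (hat rho).
Proof.
move=> r0; exists (fun=> hat rho); split; first exact: erefl.
  by move=> j; rewrite ltn0 => /notF[].
move=> j; rewrite leqn0 => /eqP ->.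
by split; [exact: continuous_hat|exact: hat_csupp|move=> s; rewrite expr0 hat_le1].
Qed.

Lemma spline_avg0 r h k q : 0 < k -> has_spline 0 r h q -> has_spline 0 (r + k) h (avg k q).
Proof.
move=> k0 [p [<- _ /(_ 0%N isT)[cp sp bp]]].
exists (fun=> avg k (p 0%N)); split; first exact: erefl.
  by move=> j; rewrite ltn0 => /notF[].
move=> j; rewrite leqn0 => /eqP ->; split.
- by move=> s; apply: rderiv_cont; exact: (rderiv_avg sp cp).
- exact: csupp_avg.
- exact: (nrm_avg k0 sp cp bp).
Qed.

(** The derivative of order j+1 of the average is [dif h] of the old derivative of order j, which
    costs exactly one factor 1/h. *)
Lemma spline_avg n r h q : 0 < h -> has_spline n r h q -> has_spline n.+1 (r + h) h (avg h q).
Proof.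
move=> h0 [p [<- dp hp]]; have [cp sp bp] := hp 0%N isT.
exists (fun j => if j is j'.+1 then dif h (p j') else avg h (p 0%N)); split; first exact: erefl.
  move=> [_ s|j]; first exact: (rderiv_avg sp cp).
  by rewrite ltnS => jn; apply: rderiv_dif; exact: dp.
move=> [_|j]; first split.
- by move=> s; apply: rderiv_cont; exact: (rderiv_avg sp cp).
- exact: csupp_avg.
- exact: (nrm_avg h0 sp cp bp).
rewrite ltnS => /hp[cj sj bj]; split; first exact: continuous_dif.
  exact: csupp_dif (ltW h0) sj.
by rewrite exprSr; exact: nrm_dif.
Qed.

Lemma has_spline_cont n r h q : has_spline n r h q -> continuous q /\ csupp r q.
Proof. by move=> [p [<- _ /(_ 0%N isT)[cp sp _]]]. Qed.

(* The total width is rho for the hat, 2 rho for the two averages that make the transform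
   decay like x ^- 4, and rho for the N averages that make the spline of class C^N. *)
Lemma kernel_exists rho N : 0 < rho -> (0 < N)%N -> exists psi,
  has_spline N (4 * rho) (rho / N%:R) psi /\
  ft psi (fun x => sinc (rho / N%:R * x) ^+ N * (rho * (sinc (rho / 2 * x) * sinc (rho * x)) ^+ 2)).
Proof.
move=> r0 N0; have Nr : 0 < N%:R :> R by rewrite ltr0n.
pose h := rho / N%:R; have h0 : 0 < h by rewrite divr_gt0.
pose psi2 := avg rho (avg rho (hat rho)).
have s1 := spline_avg0 r0 (spline_hat h r0).
have s2 := spline_avg0 r0 s1.
have [c0 p0] := has_spline_cont (spline_hat h r0).
have [c1 p1] := has_spline_cont s1.
have f2 : ft psi2 (fun x => rho * (sinc (rho / 2 * x) * sinc (rho * x)) ^+ 2).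
  have := ft_avg r0 p1 c1 (ft_avg r0 p0 c0 (ft_hat r0)).
  congr ft; apply/funext => x; by rewrite exprMn; ring.
suff H n : has_spline n (rho + rho + rho + n%:R * h) h (iter n (avg h) psi2) /\
    ft (iter n (avg h) psi2) (fun x => sinc (h * x) ^+ n * (rho * (sinc (rho / 2 * x) * sinc (rho * x)) ^+ 2)).
  exists (iter N (avg h) psi2); have [HN fN] := H N; split => //.
  have -> : 4 * rho = rho + rho + rho + N%:R * h; last by [].
  by rewrite /h; field; rewrite gt_eqF.
elim: n => [|n [IH1 IH2]] /=.
  rewrite mul0r addr0; split => //.
  by move: f2; congr ft; apply/funext => x; rewrite expr0 mul1r.
have [cn sn] := has_spline_cont IH1; split.
  have -> : rho + rho + rho + n.+1%:R * h = rho + rho + rho + n%:R * h + h; last exact: spline_avg.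
  by rewrite -natr1; ring.
have := ft_avg h0 sn cn IH2; congr ft; apply/funext => x.
by rewrite [sinc (h * x) ^+ n.+1]exprS mulrA.
Qed.

End kernel_exists.

(** * The Cauchy weight and pointwise bounds on the kernel *)

Section cauchy_weight.
Context {R : realType}.
Local Notation mu := (@lebesgue_measure R).
Implicit Types (x y t s h rho : R) (N n : nat).

(** Kernels are dominated by the square of this weight: one factor absorbs a factor |x| or gives
    smallness at infinity, the other is integrated. *)
Definition wgt y := (1 + y ^+ 2)^-1.

Lemma wgt_den_gt0 y : 0 < 1 + y ^+ 2.
Proof. by rewrite ltr_pwDl// sqr_ge0. Qed.

Lemma wgt_gt0 y : 0 < wgt y.
Proof. by rewrite invr_gt0 wgt_den_gt0. Qed.

Lemma wgt_ge0 y : 0 <= wgt y.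
Proof. exact/ltW/wgt_gt0. Qed.

Lemma wgt_le1 y : wgt y <= 1.
Proof. by rewrite invf_le1 ?wgt_den_gt0// lerDl sqr_ge0. Qed.

Lemma mul_wgt_le1 y : `|y| * wgt y <= 1.
Proof.
rewrite ler_pdivrMr ?wgt_den_gt0// mul1r -(real_normK (num_real y)).
have := sqr_ge0 (`|y| - 1); have := normr_ge0 y; nra.
Qed.

Lemma continuous_wgt : continuous wgt.
Proof. exact: continuous_oneDsqrV. Qed.

Lemma integral_wgt : (\int[mu]_x (wgt x)%:E = pi%:E)%E.
Proof.
rewrite ge0_symfun_integralT//; [|exact: wgt_ge0|exact: continuous_wgt|].
  rewrite -set_itvcy (@ge0_continuous_FTC2y _ wgt atan 0 (pi / 2)).
  - by rewrite atan0 sube0 -EFinM mulrC divfK.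
  - by move=> x _; exact: wgt_ge0.
  - by apply: continuous_subspaceT; exact: continuous_wgt.
  - exact: cvgy_atan.
  - by move=> x _; exact: derivable_atan.
  - by apply: cvg_at_right_filter; exact: continuous_atan.
  - by move=> x _; exact: derive1_atan.
by move=> x; rewrite /wgt /= sqrrN.
Qed.

(** This scaling is the source of the error of order 1/rho in the smoothing estimate. *)
Lemma uint_le_wgt rho t : 0 < rho -> uint_le (fun x => wgt (rho * (t - x))) (pi / rho).
Proof.
move=> r0; pose F x := rho * x + - (rho * t).
have dF x : is_derive x 1 F rho.
  by apply: is_derive_eq; rewrite /GRing.scale/=; ring.
have F'E : derive1 F = cst rho by apply/funext => x; rewrite derive1E derive_val.
have H : (\int[mu]_x (((wgt \o F) * derive1 F) x)%:E = pi%:E)%E.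
  rewrite -(@increasing_ge0_integration_by_substitutionT _ F wgt) ?integral_wgt//.
  - by move=> x y xy; rewrite /F ltrD2r ltr_pM2l.
  - by rewrite F'E => x; exact: cvg_cst.
  - by rewrite F'E; exact: is_cvg_cst.
  - by rewrite F'E; exact: is_cvg_cst.
  - apply/cvgrNyPle => A; apply: filterS (nbhs_ninfty_le (num_real (A / rho + t))) => x xA.
    by rewrite /F -mulrN -mulrDr mulrC -ler_pdivlMr// lerBlDr.
  - apply/cvgryPge => A; apply: filterS (nbhs_pinfty_ge (num_real (A / rho + t))) => x xA.
    by rewrite /F -mulrN -mulrDr mulrC -ler_pdivrMr// lerBrDr.
  - exact: continuous_wgt.
  - exact: wgt_ge0.
have mw : measurable_fun setT (fun x => rho * wgt (rho * (t - x))).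
  apply: continuous_measurable_fun => x; apply: cvgM; first exact: cvg_cst.
  apply: (@continuous_comp _ _ _ (fun x => rho * (t - x)) wgt); last exact: continuous_wgt.
  by apply: cvgM; [exact: cvg_cst|apply: cvgB; [exact: cvg_cst|]].
have u1 : uint_le (fun x => rho * wgt (rho * (t - x))) pi.
  apply: uint_le_measurable => //; rewrite -H le_eqVlt; apply/orP; left; apply/eqP.
  apply: eq_integral => x _; congr EFin; rewrite F'E /= mulrC; congr (_ * _).
  by rewrite /wgt /F; congr ((1 + _)^-1); ring.
have := uint_leZ (_ : 0 <= rho^-1) _ u1.
rewrite invr_ge0 ltW// => /(_ isT) H2; rewrite mulrC.
apply: uint_leW (lexx _) (H2 _) => x; last by rewrite mulr_ge0 ?wgt_ge0 ?ltW.
by rewrite mulKf// gt_eqF.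
Qed.

Lemma uint_le_wgt1 : uint_le wgt pi.
Proof.
by apply: uint_le_measurable; [exact: continuous_measurable_fun continuous_wgt|rewrite integral_wgt].
Qed.

End cauchy_weight.

Section kernel_bounds.
Context {R : realType}.
Implicit Types (x y t s h rho b : R) (N n m : nat).

Lemma bernoulli_ge b n : 0 <= b <= 1 -> 1 - n%:R * b <= (1 - b) ^+ n.
Proof.
move=> /andP[b0 b1]; elim: n => [|n ih]; first by rewrite mul0r subr0 expr0.
rewrite exprS; have b2 : 0 <= 1 - b by lra.
apply: le_trans (ler_wpM2l b2 ih).
have n0 : 0 <= n%:R :> R by [].
rewrite -natr1; nra.
Qed.

Definition ker rho N x := sinc (rho / N%:R * x) ^+ N * (rho * (sinc (rho / 2 * x) * sinc (rho * x)) ^+ 2).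

(** Positivity of the kernel is the reason for an even number of averages. *)
Lemma ker_ge0 rho m x : 0 <= rho -> 0 <= ker rho (m.*2) x.
Proof.
move=> r0; apply: mulr_ge0; last by rewrite mulr_ge0 ?sqr_ge0.
by rewrite -mul2n exprM exprn_ge0// sqr_ge0.
Qed.

(** With A = (sinc(y/2) sinc y)^2, both A <= 1 and y^4 A <= 4 hold, so 2 y^2 A <= A + y^4 A <= 5 and
    A (1 + y^2)^2 <= 1 + 5 + 4. The N extra factors are at most 1, so the bound is uniform in N. *)
Lemma ker_le rho N x : 0 <= rho -> ker rho N x <= 10 * rho * wgt (rho * x) ^+ 2.
Proof.
move=> r0; set y := rho * x.
apply: (@le_trans _ _ (rho * (sinc (rho / 2 * x) * sinc y) ^+ 2)).
  rewrite /ker; apply: ler_piMl; first by rewrite mulr_ge0 ?sqr_ge0.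
  by rewrite (le_trans (ler_norm _))// normrX exprn_ile1// sinc_le1.
have -> : 10 * rho * wgt y ^+ 2 = rho * (10 * wgt y ^+ 2) by ring.
apply: ler_wpM2l => //.
have -> : rho / 2 * x = y / 2 by rewrite /y mulrAC.
set A := _ ^+ 2.
have A1 : A <= 1.
  by rewrite /A -[leLHS]ger0_norm ?sqr_ge0// normrX exprn_ile1// normrM; apply: mulr_ile1 => //; exact: sinc_le1.
have A0 : 0 <= A by rewrite sqr_ge0.
have A4 : y ^+ 4 * A <= 4.
  have -> : y ^+ 4 * A = 4 * ((y / 2 * sinc (y / 2)) * (y * sinc y)) ^+ 2 by rewrite /A; field.
  rewrite ler_piMr// -[leLHS]ger0_norm ?sqr_ge0// normrX exprn_ile1//.
  by rewrite normrM; apply: mulr_ile1 => //; exact: mul_sinc_le1.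
have hw : wgt y * (1 + y ^+ 2) = 1 by rewrite mulVf// gt_eqF// wgt_den_gt0.
have E : A = A * (1 + y ^+ 2) ^+ 2 * wgt y ^+ 2.
  by rewrite -mulrA -exprMn mulrC [_ * wgt y]mulrC hw expr1n mul1r.
rewrite [leLHS]E; apply: ler_wpM2r; first exact: sqr_ge0.
have := sqr_ge0 (y ^+ 2 - 1).
have -> : (y ^+ 2 - 1) ^+ 2 = y ^+ 4 - 2 * y ^+ 2 + 1 by ring.
have -> : A * (1 + y ^+ 2) ^+ 2 = A + 2 * (y ^+ 2 * A) + y ^+ 4 * A by ring.
move: (y ^+ 4) (y ^+ 2) A4 => a b A4 ab; nra.
Qed.

Lemma mul_ker_le rho N x : 0 <= rho -> `|x| * ker rho N x <= 10 * wgt (rho * x).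
Proof.
move=> r0; apply: le_trans (ler_wpM2l (normr_ge0 _) (ker_le N x r0)) _.
have := mul_wgt_le1 (rho * x); rewrite normrM ger0_norm// => h.
have -> : `|x| * (10 * rho * wgt (rho * x) ^+ 2) = 10 * wgt (rho * x) * (rho * `|x| * wgt (rho * x)) by ring.
by rewrite ler_piMr// mulr_ge0// wgt_ge0.
Qed.

(** The three factors are at least 1/2, (3/4)^2 and (1/2)^2. The first bound is independent of N, as
    (1 - 1/(2N))^N >= 1/2 by Bernoulli. *)
Lemma ker_lower rho N x : 0 < rho -> (0 < N)%N -> rho * `|x| <= 1 / 2 -> 1 / 16 * rho <= ker rho N x.
Proof.
move=> r0 N0 rx; have Nr : 0 < N%:R :> R by rewrite ltr0n.
have n1 : 1 <= N%:R :> R by rewrite ler1n.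
have s1 : 3 / 4 <= sinc (rho / 2 * x).
  apply: le_trans (sinc_ge _); have a : 0 <= rho / 2 by rewrite divr_ge0// ltW.
  rewrite normrM (ger0_norm a) (_ : rho / 2 * `|x| = rho * `|x| / 2); [lra|ring].
have s2 : 1 / 2 <= sinc (rho * x).
  by apply: le_trans (sinc_ge _); rewrite normrM (ger0_norm (ltW r0)); lra.
have s3 : 1 / 2 <= sinc (rho / N%:R * x) ^+ N.
  pose b : R := (2 * N%:R)^-1.
  have b0 : 0 <= b <= 1.
    apply/andP; split; first by rewrite invr_ge0 mulr_ge0// ltW.
    by rewrite invf_le1 ?mulr_gt0//; lra.
  apply: (@le_trans _ _ ((1 - b) ^+ N)).
    have := bernoulli_ge N b0; apply: le_trans; rewrite /b invfM mulrCA divff ?gt_eqF//; lra.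
  have sb : 1 - b <= sinc (rho / N%:R * x).
    apply: le_trans (sinc_ge _); rewrite lerD2l lerN2 normrM (ger0_norm (divr_ge0 (ltW r0) (ltW Nr))).
    have -> : rho / N%:R * `|x| = rho * `|x| / N%:R by ring.
    have -> : b = 1 / 2 / N%:R by rewrite /b; field; rewrite gt_eqF.
    by apply: ler_wpM2r; rewrite ?invr_ge0 ?(ltW Nr).
  have b1 : 0 <= 1 - b by case/andP: b0 => ? ?; lra.
  by apply: lerXn2r => //; rewrite nnegrE ?(le_trans b1).
rewrite /ker; have s12 : 9 / 64 <= (sinc (rho / 2 * x) * sinc (rho * x)) ^+ 2.
  have : 3 / 8 <= sinc (rho / 2 * x) * sinc (rho * x) by nra.
  by move: (_ * sinc _) => u hu; rewrite expr2; nra.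
move: (sinc _ ^+ N) (_ ^+ 2) s3 s12 => a b' h1 h2.
have : 1 / 16 <= a * b' by nra.
nra.
Qed.

End kernel_bounds.

(** * The boundary identity *)

Section dominated.
Context {R : realType} {X : normedModType R[i]^o}.
Local Notation C := (R[i]^o).
Implicit Types (G g : R -> X) (q c : R -> C) (a b r s t x y K : R).
Hypothesis cX : nrm_complete X.

Lemma cutf_setT g : cutf setT g = g.
Proof. by apply/funext => t; rewrite /cutf asboolT. Qed.

Lemma cutf_pos g t : cutf `[0, +oo[%classic g t = if 0 <= t then g t else 0.
Proof.
rewrite /cutf; case: ifP => /asboolP; first by rewrite /= in_itv/= andbT => ->.
by rewrite /= in_itv/= andbT => /negP/negbTE ->.
Qed.

Lemma wgt_small (e : R) : 0 < e -> exists2 b, 0 <= b & forall t, b <= `|t| -> wgt t <= e.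
Proof.
move=> e0; exists (1 + e^-1); first by rewrite addr_ge0// invr_ge0 ltW.
move=> t bt; rewrite /wgt invf_ple ?posrE ?wgt_den_gt0//.
rewrite -(real_normK (num_real t)); have ei : 0 <= e^-1 by rewrite invr_ge0 ltW.
by move: bt ei; move: (e^-1) (`|t|) => u v; nra.
Qed.

Lemma integrable_dom G K : 0 <= K -> (forall b, 0 <= b -> integrable_b (cutf `[- b, b[%classic G)) ->
  (forall t, nrm (G t) <= K * wgt t ^+ 2) -> integrable_b G.
Proof.
move=> K0 hb hG; have m0 t : 0 <= K * wgt t by rewrite mulr_ge0// wgt_ge0.
have um : uint_le (fun t => K * wgt t) (K * pi).
  by apply: uint_leZ => //; [exact: wgt_ge0|exact: uint_le_wgt1].
apply: integrable_b_approx um _ => //; first by rewrite mulr_ge0// pi_ge0.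
move=> e e0; have [b b0 hw] := wgt_small e0.
exists (cutf `[- b, b[%classic G); first exact: hb.
move=> t; rewrite cutf_itv; case: ifP => [_|/negP bt].
  by rewrite subrr nrm0 mulr_ge0// ltW.
have {}bt : b <= `|t|.
  rewrite leNgt; apply/negP; rewrite ltr_norml => /andP[h1 h2]; apply: bt; by rewrite ltW.
rewrite sub0r nrmN (le_trans (hG t))// expr2 mulrA mulrC ler_wpM2r// hw//.
Qed.

Lemma integrable_pos (c : R -> C) g B K : 0 <= K -> 0 <= B -> continuous c -> continuous g ->
  (forall t, nrm (g t) <= B) -> (forall t, 0 <= t -> cabs (c t) <= K * wgt t ^+ 2) ->
  integrable_b (cutf `[0, +oo[%classic (fun t => c t *: g t)).
Proof.
move=> K0 B0 cc cg gB hc; apply: (@integrable_dom _ (K * B)); first exact: mulr_ge0.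
  move=> b b0; rewrite (_ : cutf _ _ = cutf `[0, b[%classic (fun t => c t *: g t)).
    by apply: continuous_integrable => //; exact: continuous_scale.
  apply/funext => t; rewrite !cutf_itv cutf_pos; case: (leP 0 t) => t0 /=.
    by rewrite (le_trans _ t0)// oppr_le0.
  by case: ifP.
move=> t; rewrite cutf_pos; case: ifP => t0; last first.
  by rewrite nrm0; apply: mulr_ge0; [exact: mulr_ge0|exact: sqr_ge0].
by rewrite nrmZ mulrAC ler_pM ?nrm_ge0// hc.
Qed.

(** The fifth power of e^(at/5) >= k (1 + t) gives five powers of 1 + t: one for the factor on the
    left, four for the squared weight. *)
Lemma exp_decay a : 0 < a -> exists2 K, 0 <= K & forall t, 0 <= t -> (1 + t) * expR (- (a * t)) <= K * wgt t ^+ 2.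
Proof.
move=> a0; pose k := Num.min 1 (a / 5).
have k0 : 0 < k by rewrite lt_min ltr01 divr_gt0.
exists (k ^- 5); first by rewrite invr_ge0 exprn_ge0// ltW.
move=> t t0.
have e1 : k * (1 + t) <= expR (a / 5 * t).
  apply: le_trans (expR_ge1Dx _).
  have [k1 k2] : k <= 1 /\ k <= a / 5 by rewrite /k !ge_min !lexx orbT.
  nra.
have e5 : (k * (1 + t)) ^+ 5 <= expR (a * t).
  have -> : a * t = 5%:R * (a / 5 * t) by field.
  rewrite expRM_natl; apply: lerXn2r => //; rewrite nnegrE ?expR_ge0// mulr_ge0 ?ltW//.
  by rewrite ltr_pwDl.
have w1 : wgt t * (1 + t ^+ 2) = 1 by rewrite mulVf// gt_eqF// wgt_den_gt0.
have w2 : 1 <= wgt t * (1 + t) ^+ 2.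
  rewrite -w1 ler_wpM2l ?wgt_ge0//; nra.
have w4 : 1 <= wgt t ^+ 2 * (1 + t) ^+ 4.
  rewrite (_ : _ * _ = (wgt t * (1 + t) ^+ 2) ^+ 2); last by ring.
  by rewrite exprn_ege1.
rewrite expRN ler_pdivrMr ?expR_gt0//.
apply: (@le_trans _ _ (k ^- 5 * wgt t ^+ 2 * (k * (1 + t)) ^+ 5)); last first.
  by rewrite ler_wpM2l// mulr_ge0 ?sqr_ge0// invr_ge0 exprn_ge0// ltW.
have -> : k ^- 5 * wgt t ^+ 2 * (k * (1 + t)) ^+ 5 = wgt t ^+ 2 * (1 + t) ^+ 4 * (1 + t).
  by field; rewrite gt_eqF.
by rewrite ler_peMl// addr_ge0.
Qed.

Lemma expC_cis a s t : expC (- (a%:C + 'i * s%:C) * t%:C) = (expR (- (a * t)))%:C * cis (- (s * t)).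
Proof.
rewrite /expC /cis.
have -> : complex.Re (- (a%:C + 'i * s%:C) * t%:C) = - (a * t) by rewrite /=; ring.
have -> : complex.Im (- (a%:C + 'i * s%:C) * t%:C) = - (s * t) by rewrite /=; ring.
by congr (_ * _); ceq.
Qed.

End dominated.

(** * Interchange of the damped integrals *)

Section fubini.
Context {R : realType} {X : normedModType R[i]^o}.
Local Notation C := (R[i]^o).
Implicit Types (a b r s t tau x y e K L B : R).
Let cC := @complex_nrm_complete R.

Lemma continuous_lip (Y : normedModType C) (h : R -> Y) L : 0 <= L ->
  (forall x y, nrm (h x - h y) <= L * `|x - y|) -> continuous h.
Proof.
move=> L0 hl x; apply/contP => e e0; have L1 : 0 < L + 1 by rewrite ltr_wpDl.
exists (e / (L + 1)); first by rewrite divr_gt0.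
move=> y; rewrite ler_pdivlMr// => yx; apply: le_trans (hl _ _) _; apply: le_trans yx.
by rewrite mulrC ler_wpM2l// lerDl.
Qed.

Lemma uint_le_csupp (Y : normedModType C) (h : R -> Y) r K : 0 <= r -> 0 <= K -> csupp r h ->
  (forall s, `|s| <= r -> nrm (h s) <= K) -> uint_le (fun s => nrm (h s)) (K * (2 * r)).
Proof.
move=> r0 K0 sh hK; have rr : - r <= r by lra.
apply: uint_leW (uint_le_itv rr K0) => [s|]; last by rewrite opprK mulr_natl mulr2n.
case: ifP => [/asboolP/=|/asboolP].
  by rewrite in_itv/= => /andP[h1 h2]; apply: hK; rewrite ler_norml h1 ltW.
move=> /= hs; rewrite sh ?nrm0// leNgt ltr_norml; apply/negP => /andP[h1 h2]; apply: hs.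
by rewrite in_itv/= h2 ltW.
Qed.

Variables (psi : R -> C) (r t : R).
Hypotheses (r0 : 0 <= r) (spsi : csupp r psi) (cpsi : continuous psi) (bpsi : forall s, cabs (psi s) <= 1).

Definition twist tau s : C := psi s *: cis (s * (t - tau)).
(** The Fourier integral of psi at t - tau restricted to frequencies below [x]: 0 for x <= -r and
    phi(t - tau) for x >= r. *)
Definition ptwist x tau : C := prim (twist tau) x.

Lemma csupp_twist tau : csupp r (twist tau).
Proof. by move=> s /spsi h; rewrite /twist h scale0r. Qed.

Lemma continuous_twist tau : continuous (twist tau).
Proof. by move=> s; apply: cvgZ; [exact: cpsi|exact: continuous_cis_mul]. Qed.

Lemma nrm_twist tau s : cabs (twist tau s) <= 1.
Proof. by rewrite nrmZ cabs_cis mulr1. Qed.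

Lemma twist_lip tau tau' s : cabs (twist tau s - twist tau' s) <= `|s| * `|tau - tau'|.
Proof.
rewrite -scalerBr nrmZ -[leRHS]mul1r ler_pM ?nrm_ge0//; apply: le_trans (cis_lip _ _) _.
by rewrite (_ : _ - _ = s * (tau' - tau)) ?normrM ?(distrC tau')//; ring.
Qed.

Let itwist tau : integrable_b (twist tau) := csupp_integrable cC (csupp_twist tau) (continuous_twist (tau := tau)).

Let bptwist x tau : @bint R C (cutf `]-oo, x[%classic (twist tau)) (ptwist x tau).
Proof. by apply: bvalP; exact: integrable_b_cutf. Qed.

Lemma ptwist_lip x tau tau' : cabs (ptwist x tau - ptwist x tau') <= 2 * r * r * `|tau - tau'|.
Proof.
apply: bint_nrm (bintB (@bptwist x tau) (@bptwist x tau')) _.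
have K0 : 0 <= r * `|tau - tau'| by rewrite mulr_ge0.
have s1 : csupp r (fun s => twist tau s - twist tau' s : C).
  by move=> s rs; rewrite !csupp_twist// subr0.
apply: uint_leW (uint_le_csupp r0 K0 s1 _) => [s||s sr].
- rewrite !cutf_ray; case: ifP => // _; by rewrite subr0 nrm0 nrm_ge0.
- by rewrite le_eqVlt; apply/orP; left; apply/eqP; ring.
- by apply: le_trans (twist_lip _ _ _) _; rewrite ler_wpM2r.
Qed.

Lemma ptwist_bound x tau : cabs (ptwist x tau) <= 2 * r.
Proof.
apply: bint_nrm (@bptwist x tau) _.
apply: uint_leW (uint_le_csupp r0 ler01 (@csupp_twist tau) _) => [s||s sr].
- by rewrite !cutf_ray; case: ifP => // _; rewrite nrm0 nrm_ge0.
- by rewrite mul1r.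
- exact: nrm_twist.
Qed.

(** The derivative in [x] is uniform in [tau] up to a factor 1 + tau, which the damping e^(-a tau)
    absorbs; this permits differentiation under the integral. *)
Lemma ptwist_near x e : 0 < e -> exists2 d, 0 < d & forall y tau, `|y - x| <= d -> 0 <= tau ->
  cabs (ptwist y tau - ptwist x tau - (y - x)%:C *: twist tau x) <= e * (1 + tau) * `|y - x|.
Proof.
move=> e0; pose c := 2 + `|t|; have c0 : 0 < c by rewrite /c; have := normr_ge0 t; lra.
pose e1 := e / c; have e10 : 0 < e1 by rewrite divr_gt0.
have [d d0 hd] := proj1 (contP _ _) (@cpsi x) e1 e10.
exists (Num.min d e1); first by rewrite lt_min d0.
move=> y tau; rewrite le_min => /andP[yd ye] tau0.
apply: prim_near => //; first by rewrite mulr_ge0 ?(ltW e0)// addr_ge0.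
move=> s sx; have h1 := hd s (le_trans sx yd).
have -> : twist tau s - twist tau x = (psi s - psi x) *: cis (s * (t - tau)) +
    psi x *: (cis (s * (t - tau)) - cis (x * (t - tau))).
  by rewrite scalerBl scalerBr addrA subrK.
have h2 : cabs (cis (s * (t - tau)) - cis (x * (t - tau))) <= e1 * (`|t| + tau).
  apply: le_trans (cis_lip _ _) _; rewrite -mulrBl normrM ler_pM//.
    exact: le_trans sx ye.
  by rewrite (le_trans (ler_normB _ _))// (ger0_norm tau0).
apply: le_trans (nrmD _ _) _.
have h3 : e1 + e1 * (`|t| + tau) <= e * (1 + tau).
  have -> : e = e1 * c by rewrite /e1 divfK// gt_eqF.
  rewrite /c; have := normr_ge0 t; move: (`|t|) => T T0.
  have : 0 <= e1 * (1 + tau + T * tau) by rewrite mulr_ge0 ?(ltW e10)// !addr_ge0// mulr_ge0.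
  lra.
apply: le_trans h3; rewrite !nrmZ cabs_cis mulr1; apply: lerD => //.
apply: le_trans h2; rewrite ler_piMl ?nrm_ge0//.
Qed.

Variables (g : R -> X) (B a : R) (phi : R -> R).
Hypotheses (cX : nrm_complete X) (cg : continuous g) (B0 : 0 <= B) (gB : forall tau, nrm (g tau) <= B) (a0 : 0 < a).
Hypothesis (fpsi : ft psi phi).

Definition lapl s := bval (cutf `[0, +oo[%classic
   (fun tau => ((expR (- (a * tau)))%:C * cis (- (s * tau)) : C) *: g tau)).

Definition damped x := bval (cutf `[0, +oo[%classic
   (fun tau => ((expR (- (a * tau)))%:C * ptwist x tau : C) *: g tau)).

Lemma continuous_expR_neg : continuous (fun tau : R => (expR (- (a * tau)))%:C : C).
Proof.
apply: continuous_real => x; apply: (@continuous_comp _ _ _ (fun tau => - (a * tau)) expR).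
  by apply: cvgN; apply: cvgM; [exact: cvg_cst|].
exact: continuous_expR.
Qed.

Lemma continuous_cmul (u v : R -> C) : continuous u -> continuous v -> continuous (fun s => u s * v s : C).
Proof. by move=> cu cv s; apply: cvgM; [exact: cu|exact: cv]. Qed.

Lemma integrable_damped (c : R -> C) K : continuous c -> 0 <= K ->
  (forall tau, 0 <= tau -> cabs (c tau) <= K * (1 + tau)) ->
  integrable_b (cutf `[0, +oo[%classic (fun tau => ((expR (- (a * tau)))%:C * c tau : C) *: g tau)).
Proof.
move=> cc K0 hc; have [D D0 hD] := exp_decay a0.
apply: (@integrable_pos _ _ cX _ g B (K * D) (mulr_ge0 K0 D0) B0 _ cg gB).
  by apply: continuous_cmul; [exact: continuous_expR_neg|exact: cc].
move=> tau tau0; rewrite cabsM cabsR ger0_norm ?expR_ge0//.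
rewrite -mulrA; apply: le_trans (ler_wpM2l K0 (hD tau tau0)).
rewrite mulrA [leLHS]mulrC; apply: ler_wpM2r; first exact: expR_ge0.
exact: hc.
Qed.

Lemma uint_le_damped K (h : R -> R) : 0 <= K -> (forall tau, 0 <= tau -> h tau <= K * ((1 + tau) * expR (- (a * tau)))) ->
  (forall tau, tau < 0 -> h tau <= 0) -> forall D, (forall t, 0 <= t -> (1 + t) * expR (- (a * t)) <= D * wgt t ^+ 2) ->
  0 <= D -> uint_le h (K * D * pi).
Proof.
move=> K0 h1 h2 D hD D0.
apply: uint_leW (lexx _) (uint_leZ (mulr_ge0 K0 D0) wgt_ge0 uint_le_wgt1) => tau.
have [tau0|tau0] := leP 0 tau; last by rewrite (le_trans (h2 _ tau0))// !mulr_ge0// wgt_ge0.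
apply: le_trans (h1 _ tau0) _; rewrite -mulrA ler_wpM2l// (le_trans (hD _ tau0))// ler_wpM2l//.
by rewrite expr2 ler_piMl ?wgt_ge0// wgt_le1.
Qed.

End fubini.

Section fubini2.
Context {R : realType} {X : normedModType R[i]^o}.
Local Notation C := (R[i]^o).
Implicit Types (a b r s t tau x y e K L B : R).
Let cC := @complex_nrm_complete R.

Variables (psi : R -> C) (r t : R).
Hypotheses (r0 : 0 <= r) (spsi : csupp r psi) (cpsi : continuous psi) (bpsi : forall s, cabs (psi s) <= 1).
Variables (g : R -> X) (B a : R) (phi : R -> R).
Hypotheses (cX : nrm_complete X) (cg : continuous g) (B0 : 0 <= B) (gB : forall tau, nrm (g tau) <= B) (a0 : 0 < a).
Hypothesis (fpsi : ft psi phi).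

Let dint (c : R -> C) : R -> X := cutf `[0, +oo[%classic (fun tau => ((expR (- (a * tau)))%:C * c tau : C) *: g tau).

(** [D] does not depend on [c], and the bound is linear in [K]: small coefficients give small
    integrals. Both the continuity of [lapl] and the derivative of [damped] rest on this. *)
Lemma damped_bound : exists2 D, 0 <= D & forall (c : R -> C) K I, 0 <= K ->
  (forall tau, 0 <= tau -> cabs (c tau) <= K * (1 + tau)) -> bint (dint c) I -> nrm I <= K * D.
Proof.
have [D D0 hD] := exp_decay a0; exists (B * D * pi); first by rewrite !mulr_ge0// pi_ge0.
move=> c K I K0 hc bI; rewrite mulrA mulrA; apply: bint_nrm bI _.
apply: (@uint_le_damped _ a) => // [|tau tau0|tau tau0]; first exact: mulr_ge0.
  rewrite /dint cutf_pos tau0 nrmZ cabsM cabsR ger0_norm ?expR_ge0//.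
  have h1 := hc _ tau0; have h2 := gB tau.
  have -> : K * B * ((1 + tau) * expR (- (a * tau))) = expR (- (a * tau)) * (K * (1 + tau)) * B by ring.
  rewrite ler_pM ?mulr_ge0 ?expR_ge0 ?nrm_ge0//.
  by rewrite ler_wpM2l// expR_ge0.
by rewrite /dint cutf_pos (leNgt 0 tau) tau0 nrm0.
Qed.

Lemma continuous_cis_neg s : continuous (fun tau : R => cis (- (s * tau))).
Proof.
have -> : (fun tau => cis (- (s * tau))) = fun tau => cis (tau * - s).
  by apply/funext => x; congr cis; ring.
exact: continuous_cis_mul.
Qed.

Lemma bint_lapl s : bint (dint (fun tau => cis (- (s * tau)))) (lapl g a s).
Proof.
apply: bvalP; apply: (integrable_damped cX cg B0 gB a0 _ ler01).
  exact: continuous_cis_neg.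
by move=> tau tau0; rewrite cabs_cis mul1r lerDl.
Qed.

Lemma dintB c1 c2 tau : dint c1 tau - dint c2 tau = dint (fun tau => c1 tau - c2 tau) tau.
Proof. by rewrite /dint !cutf_pos; case: ifP; rewrite ?subr0// -scalerBl -mulrBr. Qed.

Lemma dintZ k c tau : k *: dint c tau = dint (fun tau => k * c tau) tau.
Proof. by rewrite /dint !cutf_pos; case: ifP; rewrite ?scaler0// scalerA mulrCA. Qed.

Lemma continuous_lapl : continuous (lapl g a).
Proof.
have [D D0 hD] := damped_bound; apply: (@continuous_lip _ _ _ D) => // x y.
rewrite mulrC; apply: hD (bint_ext (@dintB _ _) (bintB (@bint_lapl x) (@bint_lapl y))) => // tau tau0.
apply: le_trans (cis_lip _ _) _.
rewrite (_ : _ - _ = (y - x) * tau); last by ring.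
by rewrite normrM distrC (ger0_norm tau0) ler_wpM2l// lerDr.
Qed.

Lemma bint_damped x : bint (dint (ptwist psi t x)) (damped psi t g a x).
Proof.
apply: bvalP; apply: (@integrable_damped _ _ _ _ _ cX cg B0 gB a0 _ (2 * r)).
- apply: (@continuous_lip _ _ _ (2 * r * r)); first by rewrite !mulr_ge0.
  by move=> u v; exact: ptwist_lip.
- by rewrite mulr_ge0.
move=> tau tau0; apply: le_trans (ptwist_bound t r0 spsi cpsi bpsi _ _) _.
by rewrite ler_peMr ?mulr_ge0// lerDl.
Qed.

Lemma rderiv_damped x : has_rderiv (damped psi t g a) x ((psi x * cis (x * t) : C) *: lapl g a x).
Proof.
have [D D0 hD] := damped_bound; apply/has_rderivP => e e0.
have D1 : 0 < D + 1 by rewrite ltr_wpDl.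
have [d d0 hd] := @ptwist_near _ psi r t spsi cpsi bpsi x (e / (D + 1)) (divr_gt0 e0 D1).
exists d => // y yx.
have := bintB (bintB (@bint_damped y) (@bint_damped x))
   (bintZ (y - x)%:C (bintZ (psi x * cis (x * t)) (@bint_lapl x))).
set I := _ - _ => bI.
apply: (@le_trans _ _ (e / (D + 1) * `|y - x| * D)); last first.
  rewrite mulrAC ler_wpM2r// mulrAC ler_pdivrMr// ler_wpM2l ?(ltW e0)//; lra.
have K0 : 0 <= e / (D + 1) * `|y - x| by rewrite mulr_ge0// divr_ge0 ?(ltW e0)// ltW.
apply: hD K0 _ (bint_ext _ bI) => [|tau]; last first.
  by rewrite /= !dintZ !dintB.
move=> tau tau0 /=; have := hd y tau yx tau0; rewrite mulrAC; apply: le_trans.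
rewrite le_eqVlt; apply/orP; left; apply/eqP; congr nrm; congr (_ - _).
rewrite /twist /GRing.scale/= -mulrA -cisD; congr (_ * (_ * cis _)); ring.
Qed.

(* Instead of Fubini: both sides, cut at s < x, have the same derivative in x. *)
Lemma fubini_damped : bint (fun s => (psi s * cis (s * t) : C) *: lapl g a s)
  (bval (dint (fun tau => (phi (t - tau))%:C))).
Proof.
pose q s := (psi s * cis (s * t) : C) *: lapl g a s.
have sq : csupp r q by move=> s /spsi h; rewrite /q h mul0r scale0r.
have cq : continuous q.
  apply: continuous_scale; last exact: continuous_lapl.
  by apply: continuous_cmul; [exact: cpsi|exact: continuous_cis_mul].
have := bval_prim cX sq cq rderiv_damped (lexx _) (lexx _).
have pr tau : ptwist psi t (- r) tau = 0 by rewrite /ptwist (prim_le (r := r))//; exact: csupp_twist.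
have pr' tau : ptwist psi t r tau = (phi (t - tau))%:C.
  rewrite /ptwist (prim_ge (r := r))//; last exact: csupp_twist.
  exact: bvalE (fpsi _).
have -> : damped psi t g a (- r) = 0.
  apply: bvalE; apply: bint_ext bint0 => tau; rewrite cutf_pos; case: ifP => //.
  by rewrite pr mulr0 scale0r.
rewrite subr0 /damped; congr (bint _ (bval _)).
by apply/funext => tau; rewrite /dint !cutf_pos pr'.
Qed.

End fubini2.

(** * Passage to the boundary *)

Section boundary.
Context {R : realType} {X : completeNormedModType R[i]^o}.
Local Notation C := (R[i]^o).
Implicit Types (a b r s t tau x y e K L B : R).
Let cC := @complex_nrm_complete R.
Let cX := @completeNormedMod_nrm_complete R X.

Variables (f F : R -> X) (B L : R).
Hypotheses (fB : forall t, 0 <= t -> nrm (f t) <= B)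
  (fL : forall s t, 0 <= s -> 0 <= t -> nrm (f s - f t) <= L * `|s - t|)
  (locF : locally_bochner F)
  (bdry : forall psi : R -> R[i]^o, continuous psi ->
     (exists r : R, forall s : R, r < `|s| -> psi s = 0) ->
     (fun a : R => bochner_int setT
        (fun s : R => psi s *: laplace f (a%:C + 'i * s%:C)))
       @ 0^'+ --> bochner_int setT (fun s : R => psi s *: F s)).

(** The constant extension to the left keeps the bound and the Lipschitz constant, so it is
    continuous on the whole line; the integrals are cut to nonnegative times anyway. *)
Definition ext0 (h : R -> X) tau := h (Num.max 0 tau).

Lemma ext0E h tau : 0 <= tau -> ext0 h tau = h tau.
Proof. by move=> tau0; rewrite /ext0 max_r. Qed.

Lemma bound_ge0 : 0 <= B.
Proof. exact: le_trans (nrm_ge0 _) (fB (lexx 0)). Qed.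

Lemma lip_ge0 : 0 <= L.
Proof. by have := fL ler01 (lexx 0); rewrite subr0 normr1 mulr1; apply: le_trans; exact: nrm_ge0. Qed.

Lemma nrm_ext0 tau : nrm (ext0 f tau) <= B.
Proof. by apply: fB; rewrite le_max lexx. Qed.

Lemma continuous_ext0 : continuous (ext0 f).
Proof.
apply: (@continuous_lip _ _ _ L) => [|x y]; first exact: lip_ge0.
apply: le_trans (fL _ _) _; rewrite ?le_max ?lexx//; apply: ler_wpM2l; first exact: lip_ge0.
by rewrite !maxEle; do 2 case: ifP => [|/negbT]; rewrite -?ltNge => h1 h2; rewrite ler_norml; have := ler_norm (x - y); have := ler_norm (y - x); rewrite (distrC y); lra.
Qed.

Variables (psi : R -> C) (r t : R) (phi : R -> R) (K : R).
Hypotheses (r0 : 0 <= r) (spsi : csupp r psi) (cpsi : continuous psi) (bpsi : forall s, cabs (psi s) <= 1).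
Hypotheses (fpsi : ft psi phi) (K0 : 0 <= K) (phiK : forall tau, `|phi (t - tau)| <= K * wgt tau ^+ 2).

Lemma lapl_laplace a s : 0 < a -> laplace f (a%:C + 'i * s%:C) = lapl (ext0 f) a s.
Proof.
move=> a0; apply: bochner_intE => //.
apply: bint_ext (bint_lapl cX continuous_ext0 bound_ge0 nrm_ext0 a0 s) => tau.
by rewrite !cutf_pos; case: ifP => // tau0; rewrite ext0E// expC_cis.
Qed.

(** The convolution of f, taken as 0 on negative times, with phi at the point [t]. *)
Definition cauchy_conv : X := bval (cutf `[0, +oo[%classic (fun tau => ((phi (t - tau))%:C : C) *: ext0 f tau)).

Lemma continuous_phi : continuous (fun tau => (phi (t - tau))%:C : C).
Proof.
have -> : (fun tau => (phi (t - tau))%:C : C) = ptwist psi t r.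
  apply/funext => tau; rewrite /ptwist (prim_ge (r := r))//; last exact: csupp_twist.
  by apply/esym/bvalE; exact: fpsi.
apply: (@continuous_lip _ _ _ (2 * r * r)); first by rewrite !mulr_ge0.
by move=> u v; exact: ptwist_lip.
Qed.

Lemma bint_cauchy_conv : bint (cutf `[0, +oo[%classic (fun tau => ((phi (t - tau))%:C : C) *: ext0 f tau)) cauchy_conv.
Proof.
apply: bvalP; apply: (integrable_pos cX K0 bound_ge0 continuous_phi continuous_ext0 nrm_ext0).
by move=> tau tau0; rewrite cabsR.
Qed.

Lemma scale_boundary_integrable : integrable_b (fun s => (psi s * cis (s * t) : C) *: F s).
Proof.
have [I /bochner_bint bI] := locF (- r) r.
have rr : - r <= r by have := r0; lra.
have iF : integrable_b (cutf `[- r, r]%classic F) by exists I.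
have cc : continuous (fun s => psi s * cis (s * t) : C).
  by apply: continuous_cmul; [exact: cpsi|exact: continuous_cis_mul].
have [J bJ] := scale_integrable cX rr cc iF.
exists J; apply: bint_ext bJ => s; rewrite cutf_itv; case: ifP => [/andP[h1 h2]|/negP h].
  by rewrite /cutf asboolT//= in_itv/= h1 ltW.
rewrite spsi ?mul0r ?scale0r// leNgt ltr_norml; apply/negP => /andP[h1 h2]; apply: h.
by rewrite h2 ltW.
Qed.

(** The boundary hypothesis is tested on psi(s) e^(ist). For a > 0 its left side is the damped
    convolution, which differs from the undamped one by at most a K B pi, since 1 - e^(-a tau) <= a
    tau and tau [wgt tau] <= 1. *)
Lemma boundary_identity : bint (fun s => (psi s * cis (s * t) : C) *: F s) cauchy_conv.
Proof.
pose Psi s : C := psi s * cis (s * t).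
have cPsi : continuous Psi by apply: continuous_cmul; [exact: cpsi|exact: continuous_cis_mul].
have sPsi : exists r : R, forall s : R, r < `|s| -> Psi s = 0.
  by exists r => s /ltW/spsi h; rewrite /Psi h mul0r.
have H := bdry cPsi sPsi.
have bF := bvalP scale_boundary_integrable.
have EF : bochner_int setT (fun s => Psi s *: F s) = bval (fun s => Psi s *: F s).
  by apply: bochner_intE => //; rewrite cutf_setT.
suff -> : cauchy_conv = bochner_int setT (fun s => Psi s *: F s) by rewrite EF.
apply: (cvg_unique _ _ H) => //.
have KB : 0 <= K * B by rewrite mulr_ge0// bound_ge0.
have KBp : 0 <= K * B * pi by rewrite mulr_ge0// pi_ge0.
apply/cvg_nrmP => e e0; near=> a.
have a0 : 0 < a by near: a; exact: nbhs_right_gt.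
have ae : a <= e / (K * B * pi + 1).
  by near: a; apply: nbhs_right_le; rewrite divr_gt0// ltr_wpDl.
have ae' : a * (K * B * pi) <= e.
  apply: le_trans (ler_wpM2r KBp ae) _; rewrite mulrAC ler_pdivrMr ?ltr_wpDl//.
  by rewrite ler_wpM2l ?(ltW e0)// lerDl.
pose c tau : C := (expR (- (a * tau)))%:C * (phi (t - tau))%:C.
have iJ : integrable_b (cutf `[0, +oo[%classic (fun tau => c tau *: ext0 f tau)).
  apply: (integrable_pos cX K0 bound_ge0 _ continuous_ext0 nrm_ext0).
    by apply: continuous_cmul; [exact: continuous_expR_neg|exact: continuous_phi].
  move=> tau tau0; rewrite cabsM !cabsR (ger0_norm (expR_ge0 _)).
  apply: le_trans (phiK tau); rewrite ler_piMl// expR_le1 oppr_le0 mulr_ge0// ltW//.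
rewrite (@bochner_intE _ _ _ _ (bval (cutf `[0, +oo[%classic (fun tau => c tau *: ext0 f tau))))//; last first.
  rewrite cutf_setT.
  have := fubini_damped t r0 spsi cpsi bpsi cX continuous_ext0 bound_ge0 nrm_ext0 a0 fpsi.
  by apply: bint_ext => s; rewrite lapl_laplace.
apply: le_trans ae'; apply: bint_nrm (bintB (bvalP iJ) bint_cauchy_conv) _.
have aKB : 0 <= a * (K * B) by rewrite mulr_ge0// ltW.
apply: uint_leW _ (uint_leZ aKB wgt_ge0 uint_le_wgt1) => [tau|]; last by rewrite -[leLHS]mulrA.
rewrite !cutf_pos; case: ifP => tau0; last by rewrite subrr nrm0 mulr_ge0// wgt_ge0.
rewrite -scalerBl nrmZ.
have -> : c tau - (phi (t - tau))%:C = ((expR (- (a * tau)) - 1) * phi (t - tau))%:C.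
  by rewrite /c rmorphM rmorphB rmorph1 mulrBl mul1r.
have at0 : 0 <= a * tau by rewrite mulr_ge0// ltW.
have e1 : `|expR (- (a * tau)) - 1| <= a * tau.
  rewrite distrC ger0_norm; first by have := expR_ge1Dx (- (a * tau)); lra.
  by rewrite subr_ge0 expR_le1 oppr_le0.
rewrite cabsR normrM.
have tw : tau * wgt tau <= 1 by have := mul_wgt_le1 tau; rewrite ger0_norm.
apply: (@le_trans _ _ (a * tau * (K * wgt tau ^+ 2) * B)).
  by apply: ler_pM; rewrite ?mulr_ge0 ?nrm_ge0 ?nrm_ext0//; apply: ler_pM.
have -> : a * tau * (K * wgt tau ^+ 2) * B = (tau * wgt tau) * (a * (K * B) * wgt tau) by ring.
by rewrite ler_piMl// mulr_ge0// wgt_ge0.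
Unshelve. all: by end_near. Qed.

End boundary.

(** * Smoothing by the kernel *)

Section approximation.
Context {R : realType}.
Local Notation C := (R[i]^o).
Implicit Types (a b r s t tau x y e K L B rho : R) (N m : nat).
Let cC := @complex_nrm_complete R.

Lemma bint_vec (X : normedModType C) (c : R -> C) (I : C) (v : X) : bint c I -> bint (fun s => c s *: v) (I *: v).
Proof.
move=> bc e e0; have v1 : 0 < nrm v + 1 by rewrite ltr_wpDl// nrm_ge0.
have [s [os us ns]] := bc (e / (nrm v + 1)) (divr_gt0 e0 v1).
have ec : nrm v * (e / (nrm v + 1)) <= e.
  by rewrite mulrCA ler_piMr ?(ltW e0)// ler_pdivrMr// mul1r lerDl.
have Es x : simple_eval [seq (p.1, p.2 *: v) | p <- s] x = simple_eval s x *: v.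
  rewrite /simple_eval big_map scaler_suml; apply: eq_bigr => p _ /=.
  by case: ifP => //; rewrite scale0r.
exists [seq (p.1, p.2 *: v) | p <- s]; split.
- elim: s os {us ns Es} => // p s ih /simple_ok_cons[h1 h2].
  by apply/simple_ok_cons; split => //; exact: ih.
- apply: uint_leW ec (uint_leZ (nrm_ge0 v) _ us) => x; last exact: nrm_ge0.
  by rewrite Es -scalerBl nrmZ mulrC.
apply: le_trans ec; apply: le_trans (ler_wpM2l (nrm_ge0 _) ns).
have -> : simple_int setT [seq (p.1, p.2 *: v) | p <- s] = simple_int setT s *: v.
  by rewrite /simple_int big_map scaler_suml; apply: eq_bigr => p _ /=; rewrite scalerA.
by rewrite -scalerBl nrmZ mulrC.
Qed.

Lemma sublinear_Re_neg : sublinear (fun z : C => Num.max 0 (- complex.Re z)).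
Proof.
split=> [x|x|x y|a x a0].
- by rewrite le_max lexx.
- rewrite ge_max nrm_ge0/=; apply: le_trans (cabs_Re x); rewrite -normrN; exact: ler_norm.
- have -> : complex.Re (x + y) = complex.Re x + complex.Re y by case: x => ? ?; case: y.
  rewrite ge_max opprD addr_ge0 ?le_max ?lexx//=.
  by rewrite lerD// le_max lexx orbT.
have -> : complex.Re (a%:C *: x) = a * complex.Re x.
  by case: x => p q; rewrite /GRing.scale /= mul0r subr0.
by rewrite ge_max mulr_ge0 ?le_max ?lexx//= -mulrN ler_wpM2l// le_max lexx orbT.
Qed.

Lemma bint_Re_ge0 (c : R -> C) (I : C) : (forall s, 0 <= complex.Re (c s)) -> bint c I -> 0 <= complex.Re I.
Proof.
move=> c0 bc; have := bint_sublinear sublinear_Re_neg bc (e := 0).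
rewrite ge_max oppr_le0 => /(_ _)/andP[]//.
apply: uint_leW (lexx _) uint_le0 => x.
by rewrite ge_max lexx oppr_le0 c0.
Qed.

(** Recentring by 1 + tau^2 <= 2 (1 + t^2) (1 + (t - tau)^2). [K] depends on [t], but it only serves
    integrability and the limit a -> 0+, and never enters a rate. *)
Lemma ker_dom rho N t : 0 < rho -> exists2 K, 0 <= K & forall tau, ker rho N (t - tau) <= K * wgt tau ^+ 2.
Proof.
move=> r0; pose K' := 2 * (1 + t ^+ 2) * (1 + rho^-1 ^+ 2).
have K'0 : 0 <= K' by rewrite !mulr_ge0// addr_ge0// sqr_ge0.
exists (10 * rho * K' ^+ 2); first by rewrite mulr_ge0 ?sqr_ge0// mulr_ge0// ltW.
move=> tau; apply: le_trans (ker_le _ _ (ltW r0)) _.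
rewrite -(mulrA (10 * rho) (K' ^+ 2)) -exprMn; apply: ler_wpM2l; first by rewrite mulr_ge0// ltW.
set x := t - tau; suff main : wgt (rho * x) <= K' * wgt tau.
  apply: lerXn2r => //; rewrite nnegrE; first exact: wgt_ge0.
  by apply: mulr_ge0 => //; exact: wgt_ge0.
rewrite /wgt ler_pdivlMr ?wgt_den_gt0// mulrC ler_pdivrMr ?wgt_den_gt0//.
have h1 : 1 + tau ^+ 2 <= 2 * (1 + t ^+ 2) * (1 + x ^+ 2).
  have -> : tau = t - x by rewrite /x; ring.
  have := sqr_ge0 (t + x); have := sqr_ge0 (t * x).
  have -> : 2 * (1 + t ^+ 2) * (1 + x ^+ 2) = 2 + 2 * t ^+ 2 + 2 * x ^+ 2 + 2 * (t * x) ^+ 2 by ring.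
  have -> : (t - x) ^+ 2 = 2 * t ^+ 2 + 2 * x ^+ 2 - (t + x) ^+ 2 by ring.
  lra.
apply: le_trans h1 _; rewrite /K' -[leRHS]mulrA; apply: ler_wpM2l.
  by rewrite mulr_ge0// addr_ge0// sqr_ge0.
have -> : (1 + rho^-1 ^+ 2) * (1 + (rho * x) ^+ 2) = 1 + x ^+ 2 + (rho^-1 ^+ 2 + (rho * x) ^+ 2).
  by field; rewrite gt_eqF.
by rewrite lerDl addr_ge0// sqr_ge0.
Qed.

Variables (X : completeNormedModType R[i]^o) (f : R -> X) (B L : R).
Hypotheses (fB : forall t, 0 <= t -> nrm (f t) <= B)
  (fL : forall s t, 0 <= s -> 0 <= t -> nrm (f s - f t) <= L * `|s - t|).

Lemma kernel_approximation (psi : R -> C) rho m r t : 0 < rho -> (0 < m)%N -> 0 <= r -> csupp r psi -> continuous psi ->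
  (forall s, cabs (psi s) <= 1) -> ft psi (ker rho m.*2) -> 1 <= t ->
  1 / 32 * nrm (f t) <= (B + L) * 10 * (pi / rho) + nrm (cauchy_conv f t (ker rho m.*2)).
Proof.
move=> rh0 m0 r0 spsi cpsi bpsi fpsi t1; have t0 : 0 <= t by apply: le_trans t1.
have N0 : (0 < m.*2)%N by rewrite double_gt0.
set phi := ker rho m.*2; have phi0 x : 0 <= phi x by apply: ker_ge0; exact: ltW.
have [K K0 hK] := ker_dom m.*2 t rh0.
have phiK tau : `|phi (t - tau)| <= K * wgt tau ^+ 2 by rewrite ger0_norm.
have cphi := @continuous_phi _ psi r t _ r0 spsi cpsi bpsi fpsi.
have [c bc] : integrable_b (fun tau => (phi (t - tau))%:C : C).
  apply: (integrable_dom cC K0) => [b b0|tau]; last by rewrite cabsR.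
  by apply: continuous_integrable => //; rewrite -subr_ge0 opprK addr_ge0.
have Rec : 1 / 32 <= complex.Re c.
  (* The kernel is at least rho/16 on an interval of length 1/(2 rho) ending at [t], so its mass is
     at least 1/32. *)
  pose k : R := 1 / 16 * rho; pose d := (2 * rho)^-1.
  have d0 : 0 <= d by rewrite invr_ge0 mulr_ge0// ltW.
  have td : t - d <= t by rewrite gerBl.
  have bk := bintB bc (@bint_cst_itv _ C (t - d) t (k%:C) td).
  have /(_ _) := bint_Re_ge0 _ bk.
  have -> : complex.Re (c - (t - (t - d))%:C *: (k%:C : C)) = complex.Re c - 1 / 32.
    rewrite (_ : t - (t - d) = d); last by ring.
    case: c {bc bk} => p q; rewrite /GRing.scale/= mul0r subr0; congr (_ - _).
    by rewrite /d /k; field; rewrite gt_eqF.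
  rewrite subr_ge0; apply => s; rewrite cutf_itv; case: ifP => [/andP[h1 h2]|_]; last by rewrite subr0; exact: phi0.
  rewrite -rmorphB /= subr_ge0; apply: ker_lower => //.
  rewrite ger0_norm; last by rewrite subr_ge0 ltW.
  have : rho * (t - s) <= rho * d by rewrite ler_wpM2l ?(ltW rh0)//; lra.
  by move/le_trans; apply; rewrite le_eqVlt; apply/orP; left; apply/eqP; rewrite /d; field; rewrite gt_eqF.
have cge : 1 / 32 <= cabs c by apply: le_trans Rec _; apply: le_trans (cabs_Re c); exact: ler_norm.
apply: (@le_trans _ _ (nrm (c *: f t))).
  by rewrite nrmZ ler_wpM2r// nrm_ge0.
set I := cauchy_conv f t phi.
rewrite -{1}(subrK I (c *: f t)); apply: le_trans (nrmD _ _) _; rewrite lerD2r.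
have bI := bint_cauchy_conv fB fL r0 spsi cpsi bpsi fpsi K0 phiK.
apply: bint_nrm (bintB (bint_vec (f t) bc) bI) _.
have B0 : 0 <= B := bound_ge0 fB.
have L0 : 0 <= L := lip_ge0 fL.
apply: uint_leW (lexx _) (uint_leZ _ _ (uint_le_wgt t rh0)) => [tau||]; last 2 first.
- by rewrite mulr_ge0// addr_ge0.
- by move=> tau; exact: wgt_ge0.
have key : `|t - tau| * phi (t - tau) <= 10 * wgt (rho * (t - tau)) by apply: mul_ker_le; exact: ltW.
apply: (@le_trans _ _ ((B + L) * (`|t - tau| * phi (t - tau)))); last first.
  by rewrite -mulrA ler_wpM2l// addr_ge0.
rewrite mulrA cutf_pos; case: ifP => [tau0|/negbT].
  rewrite -scalerBr ext0E// nrmZR ger0_norm// mulrC; apply: ler_wpM2r => //.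
  apply: le_trans (fL t0 tau0) _; rewrite ler_wpM2r// lerDr//.
(* At negative times f counts as 0, so the jump is bounded by B; as t >= 1 gives t - tau >= 1, it is
   absorbed in (B + L) (t - tau). *)
rewrite -ltNge => tau0; rewrite subr0 nrmZR ger0_norm// mulrC; apply: ler_wpM2r => //.
apply: le_trans (fB t0) _; rewrite ger0_norm; last lra.
have : 0 <= (B + L) * (t - tau - 1) by apply: mulr_ge0; [exact: addr_ge0|lra].
lra.
Qed.

End approximation.

(** * The Riemann-Lebesgue lemma *)

Section riemann_lebesgue.
Context {R : realType} {X : normedModType R[i]^o}.
Local Notation C := (R[i]^o).
Local Notation mu := (@lebesgue_measure R).
Implicit Types (G h : R -> X) (a b r s t e K : R).
Hypothesis cX : nrm_complete X.
Let cC := @complex_nrm_complete R.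

(** The class is enlarged from constants on intervals to continuous functions, indicators of
    measurable sets, simple functions and finally integrable functions of compact support. *)
Definition osc_null G := exists2 J : R -> X, (forall t, bint (fun s => cis (s * t) *: G s) (J t)) &
  forall e, 0 < e -> exists t0, forall t, t0 <= t -> nrm (J t) <= e.

Lemma osc_null0 : osc_null (fun=> 0).
Proof.
exists (fun=> 0) => [t|e e0]; last by exists 0 => t _; rewrite nrm0 ltW.
by apply: bint_ext bint0 => s; rewrite scaler0.
Qed.

Lemma osc_nullD G h : osc_null G -> osc_null h -> osc_null (fun s => G s + h s).
Proof.
move=> [J bJ hJ] [J' bJ' hJ']; exists (fun t => J t + J' t) => [t|e e0].
  by apply: bint_ext (bintD (bJ t) (bJ' t)) => s; rewrite scalerDr.
have e20 : 0 < e / 2 by rewrite divr_gt0.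
have [t0 h0] := hJ _ e20; have [t1 h1] := hJ' _ e20; exists (Num.max t0 t1) => t.
rewrite ge_max => /andP[/h0 {}h0 /h1 {}h1]; rewrite (splitr e).
by rewrite (le_trans (nrmD _ _))// lerD.
Qed.

(** Since e^(ist) has modulus 1, the L1 error is the same for all t. *)
Lemma osc_null_approx G : (forall e, 0 < e -> exists2 h, osc_null h & uint_le (fun s => nrm (h s - G s)) e) ->
  osc_null G.
Proof.
move=> H; have near t h e : uint_le (fun s => nrm (h s - G s)) e ->
    uint_le (fun s => nrm (cis (s * t) *: h s - cis (s * t) *: G s)) e.
  by apply: uint_leW => // s; rewrite -scalerBr nrmZ cabs_cis mul1r.
exists (fun t => bval (fun s => cis (s * t) *: G s)) => [t|e e0].
  apply: bvalP; apply: bint_exists => // e /H[h [J bJ _] u].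
  by exists (fun s => cis (s * t) *: h s), (J t); split => //; exact: near.
have e20 : 0 < e / 2 by rewrite divr_gt0.
have [h [J bJ hJ] u] := H _ e20; have [t0 ht0] := hJ _ e20; exists t0 => t tt0.
have bG : bint (fun s => cis (s * t) *: G s) (bval (fun s => cis (s * t) *: G s)).
  apply: bvalP; apply: bint_exists => // e' /H[h' [J' bJ' _] u'].
  by exists (fun s => cis (s * t) *: h' s), (J' t); split => //; exact: near.
have := bint_nrm (bintB (bJ t) bG) (near t _ _ u).
set Z := bval _ => hZ; rewrite (splitr e) -(subKr (J t) Z).
by apply: le_trans (nrm_sub _ _) _; rewrite lerD// ht0.
Qed.

Lemma osc_null_cst a b v : a <= b -> osc_null (cutf `[a, b[%classic (fun=> v)).
Proof.
move=> ab; have bt t : integrable_b (cutf `[a, b[%classic (fun s => cis (s * t) *: v)).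
  apply: continuous_integrable => //; apply: continuous_scale; first exact: continuous_cis_mul.
  by move=> s; exact: cvg_cst.
exists (fun t => bval (cutf `[a, b[%classic (fun s => cis (s * t) *: v))) => [t|e e0].
  by apply: bint_ext (bvalP (bt t)) => s; rewrite /cutf; case: ifP => //; rewrite scaler0.
(* The explicit primitive bounds the integral by 2 |v| / t. *)
exists (Num.max 1 (2 * nrm v / e)) => t; rewrite ge_max => /andP[t1 te].
have t0 : 0 < t by apply: lt_le_trans t1.
have ti0 : t%:C * 'i != 0 :> R[i] by apply: mulf_neq0; rewrite eq_complex/= ?(gt_eqF t0)//= oner_eq0 andbF.
have := @ftc _ _ cX (fun s => cis (s * t) *: ((t%:C * 'i)^-1 *: v)) (fun s => cis (s * t) *: v) a b ab.
move=> H; rewrite (bvalE (H _ _)).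
- rewrite -scalerBl scalerA nrmZ cabsM.
  have -> : cabs ((t%:C * 'i)^-1 : C) = t^-1.
    have zt : cabs (t%:C * 'i) = t by rewrite cabsM cabsR cabs_i mulr1 ger0_norm// ltW.
    have : t * cabs ((t%:C * 'i)^-1) = 1.
      by rewrite -{1}zt -cabsM mulfV// -(rmorph1 (@real_complex R)) cabsR normr1.
    by move/(canRL (mulKf (lt0r_neq0 t0))); rewrite mulr1.
  have h2 : cabs (cis (b * t) - cis (a * t)) <= 2.
    by apply: le_trans (nrm_sub _ _) _; rewrite !cabs_cis.
  rewrite ler_pdivrMr// in te.
  rewrite mulrAC ler_pdivrMr// mulrC (mulrC e); apply: le_trans te.
  by rewrite mulrC ler_wpM2r// nrm_ge0.
- move=> s; have := rderivZ (@rderiv_cis_mul _ t s) (rderiv_cst ((t%:C * 'i)^-1 *: v) s).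
  by rewrite scaler0 addr0 scalerA [(t%:C * 'i) *: _]/GRing.scale/= mulrAC mulfV// mul1r.
- by apply: continuous_scale; [exact: continuous_cis_mul|move=> s; exact: cvg_cst].
Qed.

Lemma osc_null_continuous G a b : a <= b -> continuous G -> osc_null (cutf `[a, b[%classic G).
Proof.
move=> ab cG; apply: osc_null_approx => e e0.
pose m t : R := if `[< `[a, b[%classic t >] then 1 else 0.
have m0 t : 0 <= m t by rewrite /m; case: ifP.
pose e1 := e / (b - a + 1).
have ba1 : 0 < b - a + 1 by lra.
have e10 : 0 < e1 by rewrite divr_gt0.
have [|||x xab|h Qh hh] := @loc_approx _ _ osc_null G m a b e1 ab m0.
- exact: ltW.
- exact: osc_null0.
- exact: osc_nullD.
- have [d d0 hd] := proj1 (contP _ _) (cG x) e1 e10; exists d => //; exists (fun=> G x).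
    by move=> y z yz; exact: osc_null_cst.
  by move=> t tab /hd; rewrite nrmBC /m asboolT ?mulr1//= in_itv.
exists h => //; apply: uint_leW hh _ (uint_leZ (ltW e10) m0 (uint_le_itv ab ler01)).
by rewrite mul1r /e1 mulrAC ler_pdivrMr// ler_wpM2l ?(ltW e0)//; lra.
Qed.

Lemma osc_null_set A a b v : a <= b -> measurable A -> osc_null (cutf (`[a, b[%classic `&` A) (fun=> v)).
Proof.
move=> ab mA; pose E := `[a, b[%classic : set R.
have mE : measurable E by exact: measurable_itv.
have fE : (mu E < +oo)%E by rewrite mu_itv// ltey.
have iA : mu.-integrable E (EFin \o (\1_A : R -> R)).
  apply/integrableP; split; first exact/measurable_EFinP.
  under eq_integral do rewrite /= ger0_norm//.
  rewrite integral_indic//; apply: le_lt_trans fE; apply: le_measure; rewrite ?inE//; exact: measurableI.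
have [g_ [cg ig gA]] := approximation_continuous_integrable mE fE iA.
apply: osc_null_approx => e e0.
have v1 : 0 < nrm v + 1 by rewrite ltr_wpDl// nrm_ge0.
have [n hn] : exists n, (\int[mu]_(z in E) `|(\1_A z - g_ n z)%:E| <= (e / (nrm v + 1))%:E)%E.
  have [|n0 _ /(_ n0 (leqnn n0)) /= h0] := gA [set x | (x < (e / (nrm v + 1))%:E)%E].
    by apply: open_ereal_lt'; rewrite lte_fin divr_gt0.
  by exists n0; exact: ltW.
exists (cutf E (fun s => (g_ n s)%:C *: v)).
  apply: osc_null_continuous => //; apply: continuous_scale; last by move=> s; exact: cvg_cst.
  exact: continuous_real.
have u1 : uint_le (fun s => if `[< E s >] then `|\1_A s - g_ n s| else 0) (e / (nrm v + 1)).
  apply: uint_le_measurable.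
    apply: measurable_fun_ifT => //.
      apply: (measurable_fun_bool true); rewrite setTI (_ : _ @^-1` _ = E)//.
      by apply/seteqP; split => x /=; [move/asboolP|move=> ?; apply/asboolP].
    apply: measurableT_comp => //; apply: measurable_funB => //.
    exact: continuous_measurable_fun.
  apply: le_trans hn; rewrite [leRHS]integral_mkcond le_eqVlt; apply/orP; left; apply/eqP.
  by apply: eq_integral => x _; rewrite patchE (_ : (x \in E) = `[< E x >])//; case: ifP.
apply: uint_leW _ (uint_leZ (nrm_ge0 v) _ u1) => [s||s]; last by case: ifP.
- rewrite /cutf (_ : `[< (E `&` A) s >] = `[< E s >] && `[< A s >]); last by rewrite -asbool_and.
  case: (`[< E s >]) => /=; last by rewrite subrr nrm0 mulr0.
  rewrite indicE (_ : (s \in A) = `[< A s >])// distrC mulrC -cabsR -nrmZ rmorphB scalerBl.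
  by case: `[< A s >]; rewrite ?rmorph1 ?scale1r ?rmorph0 ?scale0r.
by rewrite mulrCA ler_piMr ?(ltW e0)// ler_pdivrMr// mul1r lerDl.
Qed.

Lemma osc_null_bint G I r : csupp r G -> bint G I -> osc_null G.
Proof.
move=> sG bG; have r1 : csupp `|r| G by apply: csuppW sG; exact: ler_norm.
have rr : - `|r| <= `|r| by rewrite -subr_ge0 opprK addr_ge0.
apply: osc_null_approx => e /bG[s [os us _]].
exists (cutf `[- `|r|, `|r|[%classic (simple_eval s)); last first.
  apply: uint_leW us => // x; rewrite -{1}(csupp_cutf r1) /cutf.
  by case: ifP => // _; rewrite subrr nrm0 nrm_ge0.
elim: s os {us} => [_|p s ih /simple_ok_cons[[mp _] /ih IH]].
  have -> : cutf `[- `|r|, `|r|[%classic (simple_eval [::]) = fun=> 0 :> X; last exact: osc_null0.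
  by apply/funext => x; rewrite /cutf /simple_eval big_nil; case: ifP.
have := osc_nullD (osc_null_set p.2 rr mp) IH; congr osc_null; apply/funext => x.
rewrite /cutf simple_eval_cons (_ : `[< (`[- `|r|, `|r|[%classic `&` p.1) x >] =
  `[< `[- `|r|, `|r|[%classic x >] && `[< p.1 x >]); last by rewrite -asbool_and.
by case: (`[< `[- `|r|, `|r|[%classic x >]) => //=; rewrite addr0.
Qed.

End riemann_lebesgue.

(** * Repeated integration by parts *)

Section ibp.
Context {R : realType} {X : normedModType R[i]^o}.
Local Notation C := (R[i]^o).
Implicit Types (a b r s t e K A Q : R).
Hypothesis cX : nrm_complete X.

Lemma osc_ibp (G D : R -> X) r t I J : 0 < t -> csupp r G -> csupp r D -> continuous D ->
  (forall s, has_rderiv G s (D s)) ->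
  bint (fun s => cis (s * t) *: G s) I -> bint (fun s => cis (s * t) *: D s) J -> t * nrm I = nrm J.
Proof.
move=> t0 sG sD cD dG bI bJ.
have cG := rderiv_continuous dG.
have s1 : csupp r (fun s => cis (s * t) *: G s) by move=> s /sG ->; rewrite scaler0.
have s2 : csupp r (fun s => ((t%:C * 'i) *: cis (s * t) : C) *: G s + cis (s * t) *: D s).
  by move=> s rs; rewrite sG// sD// !scaler0 addr0.
have H := ftc_csupp cX s1 s2 _ _.
have {}H : bint (fun s => ((t%:C * 'i) *: cis (s * t) : C) *: G s + cis (s * t) *: D s) 0.
  apply: H => [s|]; first by apply: rderivZ => //; exact: rderiv_cis_mul.
  move=> s; apply: cvgD; apply: cvgZ; [|exact: cG|exact: continuous_cis_mul|exact: cD].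
  by apply: cvgZl_tmp; exact: continuous_cis_mul.
have E : 0 = (t%:C * 'i) *: I + J.
  apply: bint_unique H _; apply: bint_ext (bintD (bintZ (t%:C * 'i) bI) bJ) => s.
  by rewrite scalerA.
have -> : J = - ((t%:C * 'i) *: I) by apply/eqP; rewrite -addr_eq0 addrC -E.
by rewrite nrmN nrmZ cabsM cabsR cabs_i mulr1 ger0_norm// ltW.
Qed.

Variables (p : nat -> R -> C) (Fd : nat -> R -> X) (k : nat) (r a A Q t : R).
Hypotheses (r0 : 0 <= r) (a0 : 0 <= a) (A0 : 0 <= A) (Q0 : 0 <= Q) (t0 : 0 < t)
  (dp : forall j, (j < k)%N -> forall s, has_rderiv (p j) s (p j.+1 s))
  (hp : forall j, (j <= k)%N -> [/\ continuous (p j), csupp r (p j) & forall s, cabs (p j s) <= a ^+ j])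
  (dF : forall l, (l < k)%N -> forall s, has_rderiv (Fd l) s (Fd l.+1 s))
  (cF : forall l, (l <= k)%N -> continuous (Fd l))
  (hF : forall l s, (l <= k)%N -> `|s| <= r -> nrm (Fd l s) <= A * Q ^+ l).

Let G j l s := p j s *: Fd l s.

Let csG j l : (j <= k)%N -> csupp r (G j l).
Proof. by move=> /hp[_ sp _] s /sp; rewrite /G => ->; rewrite scale0r. Qed.

Let ctG j l : (j <= k)%N -> (l <= k)%N -> continuous (G j l).
Proof. by move=> /hp[cp _ _] /cF cl; exact: continuous_scale. Qed.

Let exG j l : (j <= k)%N -> (l <= k)%N -> integrable_b (fun s => cis (s * t) *: G j l s).
Proof.
move=> jk lk; apply: (@csupp_integrable _ _ cX r).
  by move=> s rs; rewrite csG// scaler0.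
by apply: continuous_scale; [exact: continuous_cis_mul|exact: ctG].
Qed.

(* I(j, l) = int psi^(j) F^(l) e^{ist} satisfies t |I(j, l)| <= |I(j+1, l)| + |I(j, l+1)|,
   which replaces the Leibniz formula for the k-th derivative of psi F. *)
Lemma ibp_iter n j l I : (j + l + n = k)%N -> bint (fun s => cis (s * t) *: (p j s *: Fd l s)) I ->
  t ^+ n * nrm I <= 2 * r * A * (a + Q) ^+ n * a ^+ j * Q ^+ l.
Proof.
elim: n j l I => [|n ih] j l I.
  rewrite addn0 => jl bI; have jk : (j <= k)%N by rewrite -jl leq_addr.
  have lk : (l <= k)%N by rewrite -jl leq_addl.
  have [cp sp bp] := hp jk.
  rewrite !expr0 mul1r mulr1.
  have K0 : 0 <= a ^+ j * (A * Q ^+ l) by rewrite !mulr_ge0// exprn_ge0.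
  have s1 : csupp r (fun s => cis (s * t) *: G j l s) by move=> s rs; rewrite csG// scaler0.
  rewrite (_ : 2 * r * A * a ^+ j * Q ^+ l = a ^+ j * (A * Q ^+ l) * (2 * r)); last by ring.
  apply: bint_nrm bI (uint_le_csupp r0 K0 s1 _) => s sr.
  by rewrite nrmZ cabs_cis mul1r nrmZ; apply: ler_pM; rewrite ?nrm_ge0 ?hF.
rewrite addnS => jl bI.
have j1 : (j < k)%N by rewrite -jl ltnS -addnA leq_addr.
have l1 : (l < k)%N by rewrite -jl ltnS addnAC leq_addl.
have [J1 b1] := exG (j := j.+1) (l := l) j1 (ltnW l1).
have [J2 b2] := exG (j := j) (l := l.+1) (ltnW j1) l1.
have h1 := ih j.+1 l J1 _ b1; have h2 := ih j l.+1 J2 _ b2.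
have e : t * nrm I = nrm (J1 + J2).
  have dG s : has_rderiv (G j l) s (G j.+1 l s + G j l.+1 s).
    by apply: rderivZ; [exact: dp|exact: dF].
  apply: (@osc_ibp (G j l) (fun s => G j.+1 l s + G j l.+1 s) r) => //.
  - exact: csG (ltnW j1).
  - by move=> s rs; rewrite !csG// ?addr0// ltnW.
  - by move=> s; apply: cvgD; apply: ctG => //; exact: ltnW.
  - by apply: bint_ext (bintD b1 b2) => s; rewrite scalerDr.
rewrite exprSr -mulrA e; have tn : 0 <= t ^+ n by rewrite exprn_ge0// ltW.
apply: le_trans (ler_wpM2l tn (nrmD _ _)) _; rewrite mulrDr.
have -> : 2 * r * A * (a + Q) ^+ n.+1 * a ^+ j * Q ^+ l =
   2 * r * A * (a + Q) ^+ n * a ^+ j.+1 * Q ^+ l + 2 * r * A * (a + Q) ^+ n * a ^+ j * Q ^+ l.+1.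
  by rewrite !exprS; ring.
by apply: lerD; [apply: h1|apply: h2]; rewrite -jl ?addSn ?addnS.
Qed.

End ibp.

(** * Vanishing at infinity and the estimate with free parameters *)

Section decay.
Context {R : realType} {X : completeNormedModType R[i]^o}.
Local Notation C := (R[i]^o).
Implicit Types (a b r s t tau x y e K A Q : R).
Let cX := @completeNormedMod_nrm_complete R X.

Variables (f F : R -> X) (B L : R).
Hypotheses (fB : forall t, 0 <= t -> nrm (f t) <= B)
  (fL : forall s t, 0 <= s -> 0 <= t -> nrm (f s - f t) <= L * `|s - t|)
  (locF : locally_bochner F)
  (bdry : forall psi : R -> R[i]^o, continuous psi ->
     (exists r : R, forall s : R, r < `|s| -> psi s = 0) ->
     (fun a : R => bochner_int setT
        (fun s : R => psi s *: laplace f (a%:C + 'i * s%:C)))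
       @ 0^'+ --> bochner_int setT (fun s : R => psi s *: F s)).

(** [psi] is chosen before [t]: [vanishing] keeps it fixed while t tends to infinity. *)
Lemma smoothing rho m : 0 < rho -> (0 < m)%N -> exists psi : R -> C,
  has_spline m.*2 (4 * rho) (rho / m.*2%:R) psi /\
  forall t, 1 <= t -> exists2 I, bint (fun s => cis (s * t) *: (psi s *: F s)) I &
    1 / 32 * nrm (f t) <= (B + L) * 10 * (pi / rho) + nrm I.
Proof.
move=> r0 m0; have N0 : (0 < m.*2)%N by rewrite double_gt0.
have [psi [sp fp]] := kernel_exists r0 N0; exists psi; split=> // t t1.
have [cp csp] := has_spline_cont sp.
have r4 : 0 <= 4 * rho by rewrite mulr_ge0// ltW.
have bp s : cabs (psi s) <= 1.
  by case: sp => q [<- _ /(_ 0%N isT)[_ _ /(_ s)]]; rewrite expr0.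
have [K K0 hK] := ker_dom m.*2 t r0.
have phiK tau : `|ker rho m.*2 (t - tau)| <= K * wgt tau ^+ 2.
  by rewrite ger0_norm//; apply: ker_ge0; exact: ltW.
exists (cauchy_conv f t (ker rho m.*2)).
  apply: bint_ext (boundary_identity fB fL locF bdry r4 csp cp bp fp K0 phiK) => s.
  by rewrite scalerA mulrC.
exact: (kernel_approximation fB fL r0 m0 r4 csp cp bp fp t1).
Qed.

Lemma vanishing : f t @[t --> +oo] --> (0 : X).
Proof.
apply/cvg_nrmP => e e0.
pose c := (B + L) * 10 * pi.
have c0 : 0 <= c.
  by rewrite !mulr_ge0// ?pi_ge0// addr_ge0 ?(bound_ge0 fB) ?(lip_ge0 fL).
(* The smoothing error and the oscillatory integral get e/64 each; their sum e/32 matches the mass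
   1/32 of the kernel. *)
pose e1 := e / 64; have e10 : 0 < e1 by rewrite divr_gt0.
have c1 : 0 < c + 1 by rewrite ltr_wpDl.
pose rho := (c + 1) / e1; have r0 : 0 < rho by rewrite divr_gt0.
have [psi [sp H]] := smoothing r0 (ltn0Sn 0).
have [cp csp] := has_spline_cont sp.
have [I0 bI0] : integrable_b (fun s => psi s *: F s).
  have r4 : 0 <= 4 * rho by rewrite mulr_ge0// ltW.
  have [J bJ] := scale_boundary_integrable locF 0 r4 csp cp.
  by exists J; apply: bint_ext bJ => s; rewrite mulr0 cis0 mulr1.
have csF : csupp (4 * rho) (fun s => psi s *: F s) by move=> s /csp ->; rewrite scale0r.
have [J bJ hJ] := osc_null_bint cX csF bI0.
have [t0 ht0] := hJ _ e10.
apply: filterS (nbhs_pinfty_ge (num_real (Num.max 1 t0))) => t; rewrite ge_max => /andP[t1 tt0].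
have [I bI hI] := H t t1; rewrite subr0.
have EI : I = J t by exact: bint_unique bI (bJ t).
have h2 := ht0 t tt0.
have h3 : (B + L) * 10 * (pi / rho) <= e1.
  rewrite mulrA -/c ler_pdivrMr// /rho mulrC divfK ?gt_eqF//; lra.
rewrite EI in hI; have : 1 / 32 * nrm (f t) <= e1 + e1 by apply: le_trans hI _; exact: lerD.
rewrite /e1; lra.
Qed.

(** Taking rho = r/4 puts the spline's support in [-r, r]: this turns 10 pi / rho into 40 pi / r,
    and the 2m averages of step rho/(2m) cost 8m/r per derivative. All parameters stay free, to be
    chosen as functions of t. *)
Lemma decay_bound k m (Fd : nat -> R -> X) r A Q t : (k <= m.*2)%N -> (0 < m)%N -> 0 < r -> 0 <= A -> 0 <= Q -> 1 <= t ->
  Fd 0%N = F -> (forall l, (l < k)%N -> forall s, has_rderiv (Fd l) s (Fd l.+1 s)) ->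
  (forall l, (l <= k)%N -> continuous (Fd l)) ->
  (forall l s, (l <= k)%N -> `|s| <= r -> nrm (Fd l s) <= A * Q ^+ l) ->
  1 / 32 * nrm (f t) <= (B + L) * 40 * pi / r + 2 * r * A * (8 * m%:R / r + Q) ^+ k / t ^+ k.
Proof.
move=> km m0 r0 A0 Q0 t1 F0 dF cF hF; have rho0 : 0 < r / 4 by rewrite divr_gt0.
have t0 : 0 < t by apply: lt_le_trans t1.
have [psi [[p [p0 dp hp]] H]] := smoothing rho0 m0.
have [I bI hI] := H t t1.
have rr : 4 * (r / 4) = r by rewrite mulrC divfK.
rewrite rr in hp.
have m2 : 0 < m.*2%:R :> R by rewrite ltr0n double_gt0.
have ha : (r / 4 / m.*2%:R)^-1 = 8 * m%:R / r.
  by rewrite -muln2 natrM; field; rewrite gt_eqF//= gt_eqF// ltr0n.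
rewrite ha in hp.
have a0 : 0 <= 8 * m%:R / r by rewrite divr_ge0 ?mulr_ge0// ltW.
have := @ibp_iter _ _ cX p Fd k r (8 * m%:R / r) A Q t (ltW r0) a0 A0 Q0 t0 _ _ dF cF hF k 0%N 0%N I (add0n k).
rewrite p0 F0 !expr0 !mulr1 => /(_ _ _ bI) h.
apply: le_trans hI _; apply: lerD.
  by rewrite le_eqVlt; apply/orP; left; apply/eqP; field; rewrite gt_eqF.
rewrite ler_pdivlMr ?exprn_gt0// mulrC; apply: h.
  by move=> j jk; apply: dp; exact: leq_trans km.
by move=> j jk; apply: hp; exact: leq_trans km.
Qed.

End decay.

(** * Rates of decay *)

Section rates.
Context {R : realType}.
Implicit Types (a b c r s t x y C K Q u : R) (k l n : nat).
Local Notation e := (expR (1 : R)).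

Lemma expR1_gt0 : 0 < e. Proof. exact: expR_gt0. Qed.

(** A weak Stirling bound; the induction step is (n/(n+1))^(n+1) <= 1/e, from 1 - x <= e^(-x). *)
Lemma fact_le l : (0 < l)%N -> l`!%:R <= e * l%:R * (l%:R / e) ^+ l :> R.
Proof.
have e0 := expR1_gt0.
elim: l => // [[_ _|l ih _]].
  by rewrite factS fact0 muln1 expr1 mulr1 mul1r divff// gt_eqF.
have {}ih := ih isT; rewrite factS natrM; set n := l.+1 in ih *.
have n0' : (0 < n)%N by []; clearbody n.
have n0 : 0 < n%:R :> R by rewrite ltr0n.
have n1 : n%:R + 1 = n.+1%:R :> R by rewrite natr1.
have m0 : 0 < n.+1%:R :> R by rewrite ltr0n.
apply: le_trans (ler_wpM2l (ltW m0) ih) _.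
have h : (n%:R / n.+1%:R) ^+ n.+1 <= e^-1 :> R.
  have -> : e^-1 = expR (- n.+1%:R^-1) ^+ n.+1.
    by rewrite -expRM_natl mulrN divff ?gt_eqF// expRN.
  apply: lerXn2r; rewrite ?nnegrE ?expR_ge0// ?divr_ge0//.
  apply: le_trans (expR_ge1Dx _); rewrite le_eqVlt; apply/orP; left; apply/eqP.
  by rewrite -n1; field; rewrite n1 gt_eqF.
rewrite expr_div_n ler_pdivrMr ?exprn_gt0// in h.
have -> : n.+1%:R * (e * n%:R * (n%:R / e) ^+ n) = e * n.+1%:R * (e ^- n * n%:R ^+ n.+1).
  by rewrite [n%:R ^+ n.+1]exprS expr_div_n; field; rewrite expf_neq0 ?gt_eqF.
have -> : (n.+1%:R / e) ^+ n.+1 = e ^- n * (e^-1 * n.+1%:R ^+ n.+1) :> R.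
  by rewrite expr_div_n [e ^+ n.+1]exprS; field; rewrite expf_neq0 ?gt_eqF.
rewrite ler_wpM2l ?mulr_ge0// ?(ltW e0)// ler_wpM2l// invr_ge0 exprn_ge0// ltW//.
Qed.

(** One base k/e for all l <= k gives the derivative bounds the geometric form A Q^l required by
    [decay_bound]. *)
Lemma fact_le_pow k l : (0 < k)%N -> (l <= k)%N -> l`!%:R <= e * k%:R * (k%:R / e) ^+ l :> R.
Proof.
move=> k0 lk; have e0 := expR1_gt0.
have k1 : 1 <= k%:R :> R by rewrite ler1n.
have lkR : l%:R <= k%:R :> R by rewrite ler_nat.
case: (posnP l) => [->|l0].
  rewrite expr0 mulr1 fact0; have := expR_ge1Dx (1 : R); nra.
apply: le_trans (fact_le l0) _; apply: ler_pM.
- by rewrite mulr_ge0// ltW.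
- by rewrite exprn_ge0// divr_ge0// ltW.
- by rewrite ler_wpM2l// ltW.
by apply: lerXn2r; rewrite ?nnegrE ?divr_ge0 ?(ltW e0)// ler_wpM2r// invr_ge0 ltW.
Qed.

Lemma Mk_pow (M : R -> R) k r : (0 < k)%N -> 0 <= M r ->
  Mk M k r ^+ k = M r ^+ k.+1 * (1 + r) ^+ 2.
Proof.
move=> k0 M0; rewrite /Mk exprMn -[(_ `^ _) ^+ k]powR_mulrn ?powR_ge0// -powRrM mulVf ?pnatr_eq0 -?lt0n//.
rewrite powRr1; first by rewrite [M r ^+ k.+1]exprSr; ring.
by apply: mulr_ge0 => //; exact: sqr_ge0.
Qed.

Lemma mul_expN_le1 u : u * expR (- u) <= 1.
Proof.
rewrite expRN ler_pdivrMr ?expR_gt0// mul1r; have := expR_ge1Dx u; lra.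
Qed.

(* With x = t / M = y / c, truncating at k = floor x gives the factor e^{-x}. *)
Lemma log_rate (M r t c y : R) k : 1 <= M -> 1 < r -> 0 < c -> c < 2^-1 -> expR y = (1 + r) * M ->
  M * y = c * t -> (0 < k)%N -> k%:R <= t / M -> t / M < k%:R + 1 ->
  r * r * M * k%:R * (8 * k%:R / r + k%:R * M / e) ^+ k / t ^+ k <=
  c^-1 / (c^-1 - 2) * expR (16 * e / c + 1).
Proof.
move=> M1 r1 c0 c2 ey Myt k0 kx xk.
have e0 := expR1_gt0.
have M0 : 0 < M by apply: lt_le_trans M1.
have r0 : 0 < r by lra.
have kR : 0 < k%:R :> R by rewrite ltr0n.
pose q := c^-1; have q2 : 2 < q by rewrite /q -[2]invrK ltf_pV2 ?posrE// invr_gt0.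
pose x := t / M; rewrite -/x in kx xk.
have x0 : 0 < x by apply: lt_le_trans kx.
have tx : t = x * M by rewrite /x divfK// gt_eqF.
have xy : x = q * y.
  rewrite /x /q -[y](mulKf (lt0r_neq0 M0)) Myt; field.
  by rewrite !gt_eqF.
have y0 : 0 < y by move: x0; rewrite xy pmulr_rgt0//; lra.
have rM : r * M <= expR y by rewrite ey ler_wpM2r ?ltW//; lra.
have rr : r <= expR y by apply: le_trans rM; rewrite ler_peMr// ltW.
have yr : y <= 2 * (r * M).
  have := expR_ge1Dx y; rewrite ey; have : (1 + r) * M <= 2 * (r * M) by nra.
  lra.
pose Q := k%:R * M / e.
have Q0 : 0 < Q by rewrite /Q divr_gt0// mulr_gt0.
(* The spline's share 8k/r is 8e/(rM) times Q, and k <= y/c <= 2rM/c, so the k-th power grows only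
   by a constant factor. *)
have h1 : (8 * k%:R / r + Q) ^+ k <= Q ^+ k * expR (16 * e / c).
  have -> : 8 * k%:R / r + Q = Q * (1 + 8 * e / (r * M)).
    by rewrite /Q; field; rewrite !gt_eqF.
  rewrite exprMn; apply: ler_wpM2l; first by rewrite exprn_ge0// ltW.
  apply: (@le_trans _ _ (expR (8 * e / (r * M)) ^+ k)).
    apply: lerXn2r; rewrite ?nnegrE ?expR_ge0 ?expR_ge1Dx// addr_ge0// divr_ge0 ?mulr_ge0 ?ltW//.
  rewrite -expRM_natl ler_expR.
  have rM0 : 0 < r * M by rewrite mulr_gt0.
  rewrite mulrA ler_pdivrMr//.
  have kq : k%:R <= q * (2 * (r * M)).
    by apply: le_trans kx _; rewrite xy ler_wpM2l//; lra.
  have -> : 16 * e / c * (r * M) = q * (2 * (r * M)) * (8 * e) by rewrite /q; ring.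
  by rewrite ler_wpM2r// mulr_ge0// ltW.
(* Q/t = (k/x)/e <= 1/e, and replacing k by x costs a factor at most e because x < k + 1. *)
have h2 : Q ^+ k / t ^+ k <= expR (1 - x).
  rewrite -expr_div_n; have -> : Q / t = (k%:R / x) * expR (- 1).
    by rewrite /Q tx expRN; field; rewrite !gt_eqF.
  rewrite exprMn -expRM_natl mulrN1; apply: (@le_trans _ _ (1 * expR (- k%:R))).
    apply: ler_wpM2r; first exact: expR_ge0.
    by apply: exprn_ile1; [rewrite divr_ge0// ltW|rewrite ler_pdivrMr// mul1r].
  by rewrite mul1r ler_expR; lra.
have h3 : r * r * M * k%:R <= expR y * expR y * (q * y).
  have -> : r * r * M * k%:R = r * (r * M) * k%:R by ring.
  rewrite -xy; apply: ler_pM => //; rewrite ?mulr_ge0 ?(ltW r0) ?(ltW M0)//.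
  by apply: ler_pM => //; rewrite ?mulr_ge0 ?(ltW r0) ?(ltW M0).
have tk : 0 < t ^+ k by rewrite exprn_gt0// tx mulr_gt0.
apply: (@le_trans _ _ (expR y * expR y * (q * y) * (expR (1 - x) * expR (16 * e / c)))).
  rewrite -mulrA; apply: ler_pM => //.
  - by rewrite !mulr_ge0// ltW.
  - by rewrite divr_ge0 ?(ltW tk)// exprn_ge0// addr_ge0 ?(ltW Q0)// divr_ge0 ?mulr_ge0// ltW.
  apply: (@le_trans _ _ (Q ^+ k * expR (16 * e / c) / t ^+ k)).
    by rewrite ler_wpM2r// invr_ge0 ltW.
  by rewrite mulrAC ler_wpM2r// expR_ge0.
(* With u = (q - 2) y, positive since q = 1/c > 2, the remaining factor is u e^(-u) <= 1. *)
have -> : expR y * expR y * (q * y) * (expR (1 - x) * expR (16 * e / c)) =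
   q / (q - 2) * (((q - 2) * y) * expR (- ((q - 2) * y))) * expR (16 * e / c + 1).
  rewrite (_ : - ((q - 2) * y) = y + y - x); last by rewrite xy; ring.
  rewrite !expRD; field; rewrite gt_eqF//; lra.
rewrite ler_wpM2r ?expR_ge0// ler_piMr ?mul_expN_le1// divr_ge0//; lra.
Qed.

End rates.

(** * Choice of the parameters *)

Section parts.
Context {R : realType} {X : completeNormedModType R[i]^o}.
Local Notation C := (R[i]^o).
Implicit Types (a b r s t tau x y K A Q : R).

Variables (f F : R -> X) (B L : R).
Hypotheses (fB : forall t, 0 <= t -> nrm (f t) <= B)
  (fL : forall s t, 0 <= s -> 0 <= t -> nrm (f s - f t) <= L * `|s - t|)
  (locF : locally_bochner F)
  (bdry : forall psi : R -> R[i]^o, continuous psi ->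
     (exists r : R, forall s : R, r < `|s| -> psi s = 0) ->
     (fun a : R => bochner_int setT
        (fun s : R => psi s *: laplace f (a%:C + 'i * s%:C)))
       @ 0^'+ --> bochner_int setT (fun s : R => psi s *: F s)).
Variable M : R -> R.
Hypotheses (monoM : forall x y : R, 0 <= x -> x <= y -> M x <= M y)
  (M1 : forall x : R, 0 <= x -> 1 <= M x).

Lemma small_radius (t r D : R) : 0 <= t -> 0 <= r -> r <= D -> nrm (f t) * r <= B * D.
Proof. by move=> t0 r0 rD; apply: ler_pM => //; [exact: nrm_ge0|exact: fB]. Qed.

Lemma polynomial_rate k (Fd : nat -> R -> X) K c : (1 <= k)%N -> Fd 0%N = F ->
  (forall j : nat, (j < k)%N -> forall s : R, has_rderiv (Fd j) s (Fd j.+1 s)) ->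
  (forall j : nat, (j <= k)%N -> continuous (Fd j)) -> 0 < K ->
  (forall (j : nat) (s : R), (j <= k)%N -> nrm (Fd j s) <= K * M `|s| ^+ j.+1) -> 0 < c ->
  exists D T : R, forall t : R, T <= t -> forall r : R, 0 <= r -> Mk M k r = c * t -> nrm (f t) * r <= D.
Proof.
move=> k0 F0 dF cF K0 hF c0.
have B0 : 0 <= B := bound_ge0 fB; have L0 : 0 <= L := lip_ge0 fL.
pose P := (8 * k%:R + 1) ^+ k * c ^+ k : R.
have P0 : 0 <= P.
  by apply: mulr_ge0; apply: exprn_ge0; rewrite ?(ltW c0)// addr_ge0// mulr_ge0.
exists (B * 1 + 32 * ((B + L) * 40 * pi + 2 * K * P)), 1 => t t1 r r0 Er.
have t0 : 0 < t by lra.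
have q1 : 0 <= (B + L) * 40 * pi by rewrite mulr_ge0 ?pi_ge0// mulr_ge0// addr_ge0.
have q2 : 0 <= 2 * K * P by rewrite mulr_ge0// mulr_ge0// ltW.
have q0 : 0 <= 32 * ((B + L) * 40 * pi + 2 * K * P).
  by apply: mulr_ge0 => //; exact: addr_ge0.
(* For bounded r the boundedness of f suffices; r > 1 is used to bound 8k/r by 8k M(r). *)
have [r1|r1] := leP r 1.
  by apply: le_trans (small_radius (ltW t0) r0 r1) _; rewrite lerDl.
have rp : 0 < r by lra.
have m1 : 1 <= M r := M1 r0; have mp : 0 < M r by lra.
have kd : (k <= k.*2)%N by rewrite -addnn leq_addr.
have := @decay_bound R X f F B L fB fL locF bdry k k Fd r (K * M r) (M r) t kd k0 rp.
rewrite mulr_ge0 ?(ltW K0) ?(ltW mp)// => /(_ isT isT t1 F0 dF cF) H.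
have {}H : 1 / 32 * nrm (f t) <= (B + L) * 40 * pi / r + 2 * r * (K * M r) * (8 * k%:R / r + M r) ^+ k / t ^+ k.
  apply: H => l s lk sr; apply: le_trans (hF l s lk) _.
  rewrite -mulrA -exprS ler_wpM2l ?(ltW K0)//.
  by apply: lerXn2r; rewrite ?nnegrE ?(ltW mp)// ?monoM// (le_trans ler01)// M1.
have tk : 0 < t ^+ k by rewrite exprn_gt0.
have Ek : M r ^+ k.+1 * (1 + r) ^+ 2 = c ^+ k * t ^+ k.
  by rewrite -(Mk_pow k0 (ltW mp)) Er exprMn.
have h1 : (8 * k%:R / r + M r) ^+ k <= ((8 * k%:R + 1) * M r) ^+ k.
  have kr : 0 <= k%:R :> R by [].
  have u0 : 0 <= 8 * k%:R :> R by rewrite mulr_ge0.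
  have ur : 8 * k%:R / r <= 8 * k%:R * M r.
    by rewrite ler_pdivrMr// -[leRHS]mulrA ler_peMr// (le_trans m1)// ler_peMr// ltW.
  have ur0 : 0 <= 8 * k%:R / r by rewrite divr_ge0// ltW.
  apply: lerXn2r; rewrite ?nnegrE; first by rewrite addr_ge0// ltW.
    by apply: mulr_ge0; [exact: addr_ge0|exact: ltW].
  by rewrite (mulrDl _ 1) mul1r lerD2r.
(* Up to constants the left side is r M(r)^(k+1) / t^k, and M(r)^(k+1) (1 + r)^2 = (ct)^k leaves c^k
   r / (1 + r)^2 <= c^k / r. *)
have h2 : 2 * r * (K * M r) * (8 * k%:R / r + M r) ^+ k / t ^+ k <= 2 * K * P / r.
  rewrite ler_pdivrMr//; apply: (@le_trans _ _ (2 * r * (K * M r) * ((8 * k%:R + 1) * M r) ^+ k)).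
    by rewrite ler_wpM2l// !mulr_ge0// ltW.
  have -> : 2 * r * (K * M r) * ((8 * k%:R + 1) * M r) ^+ k = 2 * K * (8 * k%:R + 1) ^+ k * (r * M r ^+ k.+1).
    by rewrite exprMn [M r ^+ k.+1]exprS; ring.
  have -> : 2 * K * P / r * t ^+ k = 2 * K * (8 * k%:R + 1) ^+ k * (c ^+ k * t ^+ k / r).
    by rewrite /P; field; rewrite gt_eqF.
  apply: ler_wpM2l; first by rewrite !mulr_ge0 ?exprn_ge0 ?(ltW K0)// addr_ge0// mulr_ge0.
  rewrite -Ek ler_pdivlMr//.
  have -> : r * M r ^+ k.+1 * r = M r ^+ k.+1 * (r ^+ 2) by ring.
  apply: ler_wpM2l; first by rewrite exprn_ge0// ltW.
  by apply: lerXn2r; rewrite ?nnegrE ?(ltW rp)//; lra.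
have h3 : 1 / 32 * nrm (f t) <= ((B + L) * 40 * pi + 2 * K * P) / r.
  by rewrite [leRHS]mulrDl; apply: le_trans H _; rewrite lerD2l.
rewrite ler_pdivlMr// in h3.
apply: (@le_trans _ _ (32 * ((B + L) * 40 * pi + 2 * K * P))); last by rewrite lerDr mulr1.
lra.
Qed.

Lemma logarithmic_rate (Fd : nat -> R -> X) K c : Fd 0%N = F ->
  (forall (j : nat) (s : R), has_rderiv (Fd j) s (Fd j.+1 s)) -> 0 < K ->
  (forall (j : nat) (s : R), nrm (Fd j s) <= K * j`!%:R * M `|s| ^+ j.+1) -> 0 < c < 2^-1 ->
  exists D T : R, forall t : R, T <= t -> forall r : R, 0 <= r -> Mlog M r = c * t -> nrm (f t) * r <= D.
Proof.
move=> F0 dF K0 hF /andP[c0 c2].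
have B0 : 0 <= B := bound_ge0 fB; have L0 : 0 <= L := lip_ge0 fL.
pose e := expR (1 : R); have e0 : 0 < e := expR_gt0 _.
pose P := c^-1 / (c^-1 - 2) * expR (16 * e / c + 1).
have ci : 2 < c^-1 by rewrite -[2]invrK ltf_pV2 ?posrE// invr_gt0.
have P0 : 0 <= P by rewrite mulr_ge0 ?expR_ge0// divr_ge0//; lra.
pose D := 32 * ((B + L) * 40 * pi + 2 * K * e * P).
have q1 : 0 <= (B + L) * 40 * pi by rewrite mulr_ge0 ?pi_ge0// mulr_ge0// addr_ge0.
have q2 : 0 <= 2 * K * e * P by rewrite mulr_ge0// mulr_ge0 ?(ltW e0)// mulr_ge0// ltW.
have D0 : 0 <= D by apply: mulr_ge0 => //; exact: addr_ge0.
have e1 : 1 <= e by have := expR_ge1Dx (1 : R); rewrite -/e; lra.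
exists (B * e + D), 1 => t t1 r r0 Er.
have t0 : 0 < t by lra.
have [r1|r1] := leP r e.
  by apply: le_trans (small_radius (ltW t0) r0 r1) _; rewrite lerDl.
have rp : 0 < r by lra.
have m1 : 1 <= M r := M1 r0; have mp : 0 < M r by lra.
pose y := ln (1 + r) + ln (M r).
have ey : expR y = (1 + r) * M r by rewrite expRD !lnK ?posrE//; lra.
have x0 : 0 <= t / M r by rewrite divr_ge0// ltW.
pose k := Num.truncn (t / M r).
have /andP[kx xk] := truncn_itv x0.
rewrite -/k in kx xk; rewrite -natr1 in xk.
(* If k = 0 then t/M(r) < 1, so y = c t/M(r) < 1 and r < (1 + r) M(r) = e^y < e, against r > e; this
   is why small r was cut off at e. *)
have k0 : (0 < k)%N.
  rewrite lt0n; apply/negP => /eqP k00; rewrite k00 add0r in xk.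
  have : r < e.
    apply: (@lt_le_trans _ _ (expR y)); first by rewrite ey; nra.
    rewrite ler_expR; have : y = c * (t / M r) by rewrite mulrA -Er /Mlog -/y mulrC mulKf// gt_eqF.
    nra.
  by rewrite ltNge (ltW r1).
have kd : (k <= k.*2)%N by rewrite -addnn leq_addr.
have kR : 0 <= k%:R :> R by [].
have A0 : 0 <= K * M r * (e * k%:R) by rewrite !mulr_ge0// ltW.
have Q0 : 0 <= k%:R * M r / e by rewrite divr_ge0 ?mulr_ge0// ltW.
have H : 1 / 32 * nrm (f t) <= (B + L) * 40 * pi / r +
    2 * r * (K * M r * (e * k%:R)) * (8 * k%:R / r + k%:R * M r / e) ^+ k / t ^+ k.
  apply: (@decay_bound R X f F B L fB fL locF bdry k k Fd) => //.
  - by move=> l lk; exact: rderiv_continuous (dF l).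
  move=> l s lk sr; apply: le_trans (hF l s) _.
  (* The factorial bound puts the polynomial factor e k into A and leaves Q = k M(r) / e. *)
  apply: (@le_trans _ _ (K * (e * k%:R * (k%:R / e) ^+ l) * M r ^+ l.+1)).
    apply: ler_pM; rewrite ?mulr_ge0 ?(ltW K0) ?exprn_ge0 ?(le_trans ler01 (M1 _))//.
      by rewrite ler_wpM2l ?(ltW K0)// fact_le_pow.
    by apply: lerXn2r; rewrite ?nnegrE ?(ltW mp)// ?monoM// (le_trans ler01)// M1.
  rewrite le_eqVlt; apply/orP; left; apply/eqP.
  have -> : k%:R * M r / e = k%:R / e * M r by ring.
  by rewrite [(k%:R / e * M r) ^+ l]exprMn exprS; ring.
have r1' : 1 < r by lra.
have h2 := log_rate m1 r1' c0 c2 ey Er k0 kx xk.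
rewrite -/e -/P in h2.
have h3 : 1 / 32 * nrm (f t) * r <= (B + L) * 40 * pi + 2 * K * e * P.
  apply: le_trans (ler_wpM2r r0 H) _; rewrite [leLHS]mulrDl divfK ?gt_eqF// lerD2l.
  rewrite (_ : 2 * r * (K * M r * (e * k%:R)) * (8 * k%:R / r + k%:R * M r / e) ^+ k / t ^+ k * r = 2 * K * e * (r * r * M r * k%:R * (8 * k%:R / r + k%:R * M r / e) ^+ k / t ^+ k)); last by ring.
  by apply: ler_wpM2l; rewrite ?mulr_ge0// ltW.
have Be : 0 <= B * e by rewrite mulr_ge0// ltW.
rewrite /D; lra.
Qed.

End parts.

Theorem theorem2p1 (R : realType) (X : completeNormedModType R[i]^o)
    (f F : R -> X) :
  (exists B : R, forall t : R, 0 <= t -> nrm (f t) <= B) ->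
  {within `[0, +oo[, continuous f} ->
  (exists L : R, forall s t : R, 0 <= s -> 0 <= t ->
     nrm (f s - f t) <= L * `|s - t|) ->
  locally_bochner F ->
  (forall psi : R -> R[i]^o, continuous psi ->
     (exists r : R, forall s : R, r < `|s| -> psi s = 0) ->
     (fun a : R => bochner_int setT
        (fun s : R => psi s *: laplace f (a%:C + 'i * s%:C)))
       @ 0^'+ --> bochner_int setT (fun s : R => psi s *: F s)) ->
  (f t @[t --> +oo] --> (0 : X)) /\
  (forall M : R -> R,
     {within `[0, +oo[, continuous M} ->
     (forall x y : R, 0 <= x -> x <= y -> M x <= M y) ->
     (forall x : R, 0 <= x -> 1 <= M x) ->
     (* (a) *)
     (forall (k : nat), (1 <= k)%N ->
        forall Fd : nat -> R -> X, Fd 0%N = F ->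
        (forall j : nat, (j < k)%N -> forall s : R,
            has_rderiv (Fd j) s (Fd j.+1 s)) ->
        (forall j : nat, (j <= k)%N -> continuous (Fd j)) ->
        forall C : R, 0 < C ->
        (forall (j : nat) (s : R), (j <= k)%N ->
            nrm (Fd j s) <= C * M `|s| ^+ j.+1) ->
        forall c : R, 0 < c ->
        exists K T : R, forall t : R, T <= t ->
          forall r : R, 0 <= r -> Mk M k r = c * t -> nrm (f t) * r <= K) /\
     (* (b) *)
     (forall Fd : nat -> R -> X, Fd 0%N = F ->
        (forall (j : nat) (s : R), has_rderiv (Fd j) s (Fd j.+1 s)) ->
        forall C : R, 0 < C ->
        (forall (j : nat) (s : R),
            nrm (Fd j s) <= C * j`!%:R * M `|s| ^+ j.+1) ->
        forall c : R, 0 < c < 2^-1 ->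
        exists K T : R, forall t : R, T <= t ->
          forall r : R, 0 <= r -> Mlog M r = c * t -> nrm (f t) * r <= K)).
Proof.
move=> [B fB] _ [L fL] locF bdry; split; first exact: vanishing fB fL locF bdry.
move=> M _ monoM M1; split.
  move=> k k1 Fd F0 dF cF C C0 hF c c0.
  exact: (polynomial_rate fB fL locF bdry monoM M1 k1 F0 dF cF C0 hF c0).
move=> Fd F0 dF C C0 hF c c2.
exact: (logarithmic_rate fB fL locF bdry monoM M1 F0 dF C0 hF c2).
Qed.
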